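(* Let $d\ge2$. For $j\ge1$ define the completely positive map $\eta_j:\mathcal B(H^2(\mathbb G_d))\to\mathcal B\big(\bigoplus_{i=1}^dH^2(\mathbb G_d)\big)$ by $$\eta_j(T)=\begin{bmatrix}Z_1^{*j}\\ \vdots\\ Z_{d-1}^{*j}\\ T_p^{*j}\end{bmatrix}T\begin{bmatrix}Z_1^j&\cdots&Z_{d-1}^j&T_p^j\end{bmatrix},$$ where $Z_l=U_h^*Y_lU_h$ for $1\le l\le d-1$. A bounded operator $T$ on $H^2(\mathbb G_d)$ is compact if and only if $\eta_j(T)\to0$ in norm as $j\to\infty$.
   Context: $\mathbb D$ is the open unit disk and $\mathbb T$ the unit circle. For $1\le i\le d$, $s_i(\bm z)=\sum_{1\le k_1<\cdots<k_i\le d}z_{k_1}\cdots z_{k_i}$ on $\mathbb C^d$, and $\bm s=(s_1,\dots,s_d)$ is the symmetrization map, with complex Jacobian determinant $J_{\bm s}$. $\mathbb G_d=\bm s(\mathbb D^d)$, with points written $(s_1,\dots,s_{d-1},p)$. $d\bm\theta$ is normalized Lebesgue measure on $\mathbb T^d$ and $\|J_{\bm s}\|^2=\int_{\mathbb T^d}|J_{\bm s}(e^{i\bm\theta})|^2d\bm\theta$. $H^2(\mathbb G_d)$ is the Hilbert space of holomorphic $f$ on $\mathbb G_d$ with $\|f\|=\|J_{\bm s}\|^{-1}\big\{\sup_{0<r<1}\int_{\mathbb T^d}|f\circ\bm s(re^{i\bm\theta})|^2|J_{\bm s}(re^{i\bm\theta})|^2d\bm\theta\big\}^{1/2}<\infty$.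 $T_p$ is the operator of multiplication by the last coordinate function $p$ on $H^2(\mathbb G_d)$. $H^2_{\mathrm{anti}}(\mathbb D^d)$ is the subspace of the Hardy space $H^2(\mathbb D^d)$ consisting of $f$ with $f(\bm z_\sigma)=\mathrm{sgn}(\sigma)f(\bm z)$ for all $\bm z\in\mathbb D^d$ and all $\sigma$ in the permutation group $\Sigma_d$ of $\{1,\dots,d\}$, where $\bm z_\sigma=(z_{\sigma(1)},\dots,z_{\sigma(d)})$. For integers $p_1>p_2>\cdots>p_d\ge0$ and $\bm p=(p_1,\dots,p_d)$, put $\bm a_{\bm p}(\bm z)=\sum_{\sigma\in\Sigma_d}\mathrm{sgn}(\sigma)z_1^{p_{\sigma(1)}}\cdots z_d^{p_{\sigma(d)}}$; these functions form an orthogonal basis of $H^2_{\mathrm{anti}}(\mathbb D^d)$. For $1\le j\le d-1$, $Y_j$ is the isometry on $H^2_{\mathrm{anti}}(\mathbb D^d)$ determined by $Y_j\bm a_{\bm p}=\bm a_{\bm p+\bm f_j}$, where $\bm f_j=(1,\dots,1,0,\dots,0)$ with $j$ ones. $U_h:H^2(\mathbb G_d)\to H^2_{\mathrm{anti}}(\mathbb D^d)$ is the unitary $U_hf=\|J_{\bm s}\|^{-1}J_{\bm s}\cdot(f\circ\bm s)$. *)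

(* Defs.v *)
From HB Require Import structures.
From mathcomp Require Import all_boot all_order all_algebra perm.
From mathcomp Require Import all_classical all_reals all_analysis.
From mathcomp Require Import complex.
Set Implicit Arguments.
Unset Strict Implicit.
Unset Printing Implicit Defensive.
Import Order.TTheory GRing.Theory Num.Theory.
Import numFieldTopology.Exports numFieldNormedType.Exports.
Local Open Scope classical_set_scope.
Local Open Scope ring_scope.
Local Open Scope complex_scope.

(** The complex numbers as a normed module over themselves, which also gives
    [R[i]] and the row vectors over it their topology. *)
HB.instance Definition _ (R : rcfType) := NormedModule.copy R[i] R[i]^o.

(** A Hilbert space is given concretely, by a subspace [hcar] of an ambient
    space and its norm. Operators are functions between the ambient spaces, of
    which only the values on [hcar] matter. *)
Record hspace (R : realType) (V : lmodType R[i]) :=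
  HSpace { hcar : set V ; hnorm : V -> R }.

Section operators.
Context {R : realType}.

(** Polarization; linear in the first argument. *)
Definition hdot (V : lmodType R[i]) (H : hspace V) (f g : V) : R[i] :=
  4^-1 * \sum_(k < 4) 'i ^+ k * ((hnorm H (f + 'i ^+ k *: g)) ^+ 2)%:C.

Section two_spaces.
Context {V W : lmodType R[i]} (H : hspace V) (K : hspace W).

Definition bounded_op (T : V -> W) : Prop :=
  [/\ forall f, hcar H f -> hcar K (T f),
      forall (a : R[i]) f g, hcar H f -> hcar H g ->
        T (a *: f + g) = a *: T f + T g
    & exists M : R, forall f, hcar H f -> hnorm K (T f) <= M * hnorm H f].

Definition opnorm (T : V -> W) : \bar R :=
  ereal_sup [set (hnorm K (T f))%:E | f in [set f | hcar H f /\ hnorm H f <= 1]].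

Definition compact_op (T : V -> W) : Prop :=
  bounded_op T /\
  forall u : nat -> V,
    (forall k, hcar H (u k)) -> (exists M : R, forall k, hnorm H (u k) <= M) ->
    exists2 phi : nat -> nat, {homo phi : m n / (m < n)%N} &
      exists2 g, hcar K g &
        hnorm K (T (u (phi k)) - g) @[k --> \oo] --> (0 : R).

Definition is_adjoint (A : V -> W) (B : W -> V) : Prop :=
  forall f g, hcar H f -> hcar K g -> hdot K (A f) g = hdot H f (B g).

End two_spaces.

Definition adjoint (V W : lmodType R[i]) (H : hspace V) (K : hspace W)
    (A : V -> W) : W -> V :=
  xget (fun=> 0) [set B | bounded_op K H B /\ is_adjoint H K A B].

(** The orthogonal direct sum of [d] copies of [H]. *)
Definition hsum (d : nat) (V : lmodType R[i]) (H : hspace V) :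
    hspace ('I_d -> V) :=
  HSpace [set h : 'I_d -> V | forall k, hcar H (h k)]
    (fun h => Num.sqrt (\sum_(k < d) hnorm H (h k) ^+ 2)).

Definition row_op (d : nat) (V W : lmodType R[i]) (A : 'I_d -> V -> W) :
    ('I_d -> V) -> W :=
  fun h => \sum_(k < d) A k (h k).

Definition col_op (d : nat) (V W : lmodType R[i]) (B : 'I_d -> V -> W) :
    V -> ('I_d -> W) :=
  fun f k => B k f.

End operators.

Section symmetrized_polydisc.
Context {R : realType} (n : nat).
Local Notation C := R[i].
Local Notation d := n.+2.

(** The dimension [d = n.+2] ranges over the integers [d >= 2]. *)
Definition fspace : lmodType C := ('rV[C]_d -> C).

Definition polydisc : set 'rV[C]_d := [set z | forall k, `|z 0 k| < 1].

(** The coordinate of index [i] is the elementary symmetric polynomial of degree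
    [i.+1], since ordinals start at 0. *)
Definition symmap (z : 'rV[C]_d) : 'rV[C]_d :=
  \row_(i < d) \sum_(A : {set 'I_d} | #|A| == i.+1) \prod_(k in A) z 0 k.

Definition jac (z : 'rV[C]_d) : C := \det (jacobian symmap z).

Definition sym_polydisc : set 'rV[C]_d := symmap @` polydisc.

Definition circle_point (r : R) (t : 'rV[R]_d) : 'rV[C]_d :=
  \row_(k < d) (r%:C * (cos (t 0 k) +i* sin (t 0 k))).

End symmetrized_polydisc.

Arguments fspace R n : clear implicits.

(** The integral over the [m]-dimensional torus with respect to normalized
    Lebesgue measure, as an iterated integral over the angles. *)
Fixpoint torus_integral {R : realType} (m : nat) :
    ('rV[R]_m -> \bar R) -> \bar R :=
  match m with
  | 0 => fun g => g 0
  | m'.+1 => fun g =>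
      (((2 * pi)^-1)%:E *
       \int[lebesgue_measure]_(t in `[0%R, (2 * pi)%R])
         torus_integral (fun u : 'rV[R]_m' => g (row_mx t%:M u)%R))%E
  end.

Section hardy_spaces.
Context {R : realType} (n : nat).
Local Notation C := R[i].
Local Notation d := n.+2.
Local Notation V := (fspace R n).

Definition torus_integral_at (g : 'rV[C]_d -> R) (r : R) : \bar R :=
  torus_integral (fun t => (g (circle_point r t))%:E).

Definition holomorphic_on (D : set 'rV[C]_d) (f : V) : Prop :=
  forall z, D z -> differentiable f z.

(** A function on a domain is represented by its extension by zero. *)
Definition supported_in (D : set 'rV[C]_d) (f : V) : Prop :=
  forall z, ~ D z -> f z = 0.

Definition sq_modulus (f : V) (z : 'rV[C]_d) : R :=
  ComplexField.Normc.normc (f z) ^+ 2.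

Definition jac_norm : R :=
  Num.sqrt (fine (torus_integral_at (sq_modulus (@jac R n)) 1)).

Definition sup_integral (g : 'rV[C]_d -> R) : \bar R :=
  ereal_sup [set torus_integral_at g r | r in `]0%R, 1%R[ ].

Definition sym_density (f : V) (z : 'rV[C]_d) : R :=
  sq_modulus f (symmap z) * sq_modulus (@jac R n) z.

Definition H2sym : hspace V :=
  HSpace
    [set f | [/\ holomorphic_on (@sym_polydisc R n) f,
                 supported_in (@sym_polydisc R n) f
               & (sup_integral (sym_density f) < +oo)%E]]
    (fun f => jac_norm^-1 * Num.sqrt (fine (sup_integral (sym_density f)))).

Definition H2 : hspace V :=
  HSpace
    [set f | [/\ holomorphic_on (@polydisc R n) f,
                 supported_in (@polydisc R n) f
               & (sup_integral (sq_modulus f) < +oo)%E]]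
    (fun f => Num.sqrt (fine (sup_integral (sq_modulus f)))).

Definition antisymmetric (f : V) : Prop :=
  forall (sg : 'S_d) z, polydisc z -> f (col_perm sg z) = (-1) ^+ sg * f z.

Definition H2anti : hspace V :=
  HSpace (hcar H2 `&` antisymmetric) (hnorm H2).

Definition strictly_decreasing (p : 'I_d -> nat) : Prop :=
  forall i j : 'I_d, (i < j)%N -> (p j < p i)%N.

Definition anti_monomial (p : 'I_d -> nat) : V :=
  patch (fun=> 0) (@polydisc R n)
    (fun z => \sum_(sg : 'S_d) (-1) ^+ sg * \prod_(i < d) z 0 i ^+ p (sg i)).

Definition add_ones (j : nat) (p : 'I_d -> nat) : 'I_d -> nat :=
  fun i => (p i + (i < j))%N.

Definition is_Yop (j : nat) (Y : V -> V) : Prop :=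
  [/\ bounded_op H2anti H2anti Y,
      forall f, hcar H2anti f -> hnorm H2anti (Y f) = hnorm H2anti f
    & forall p, strictly_decreasing p ->
        Y (anti_monomial p) = anti_monomial (add_ones j p)].

Definition Yop (j : nat) : V -> V := xget (fun=> 0) (is_Yop j).

Definition Uh (f : V) : V :=
  patch (fun=> 0) (@polydisc R n)
    (fun z => (jac_norm^-1)%:C * (jac z * f (symmap z))).

Definition Zop (l : nat) : V -> V := adjoint H2sym H2anti Uh \o Yop l \o Uh.

Definition Tp (f : V) : V := fun w => w 0 ord_max * f w.

(** The entries of the row defining [eta], namely [Zop 1], ..., [Zop d.-1] and
    then [Tp]. *)
Definition entry (k : 'I_d) : V -> V :=
  if k == ord_max then Tp else Zop k.+1.

Definition eta (j : nat) (T : V -> V) : ('I_d -> V) -> ('I_d -> V) :=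
  col_op (fun k => iter j (adjoint H2sym H2sym (entry k)))
    \o T \o row_op (fun k => iter j (entry k)).

End hardy_spaces.

(* Main.v *)
From HB Require Import structures.
Require Import Defs.
From mathcomp Require Import all_boot all_order all_algebra all_solvable all_field perm.
From mathcomp Require Import all_classical all_reals all_analysis.
From mathcomp Require finmap.
From mathcomp Require Import measurable_realfun complex ring lra zify.
Import Order.TTheory GRing.Theory Num.Theory.
Import numFieldTopology.Exports numFieldNormedType.Exports.
Set Implicit Arguments.
Unset Strict Implicit.
Unset Printing Implicit Defensive.
Local Open Scope classical_set_scope.
Local Open Scope ring_scope.
Local Notation Re := complex.Re.
Local Notation Im := complex.Im.

(** In suitable coordinates the theorem is a statement about the backward shifts
    of square summable families indexed by [d]-tuples of naturals.

    The map [f |-> jac * (f o symmap)] identifies [H2sym] isometrically, up to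
    the factor [jac_norm], with [H2anti]. A function in [H2anti] is determined by
    its Taylor coefficients at strictly decreasing exponents, since antisymmetry
    gives all the others; such an exponent [p] is encoded by its gaps
    [m_i = p_i - p_(i+1) - 1], which range over all [d]-tuples ([of_gaps]).
    Parseval's formula ([hardy_norm]) then makes the family of the
    [Num.sqrt (d`!) * taylor F (of_gaps m)] orthonormal coordinates
    ([anti_coords], [sym_coords]). Adding [j] ones to [p] increases the gap of
    index [j - 1] by one, and multiplication by the product of all coordinates,
    which is what the last coordinate of [symmap] becomes, increases the last
    gap by one. So the entries of the row are the [d] commuting shifts of the
    gap coordinates ([entry_is_shift]).

    For shifts the criterion is elementary ([compact_eta], [eta_compact]). The
    adjoint of a shift is the backward shift, whose powers are contractions
    tending strongly to 0; on the relatively compact image of the unit ball under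
    a compact [T] this convergence is uniform, so the norm of [eta j T] tends to
    0. Conversely, the range of the row of the [j]-th powers consists of the
    vectors without coordinates in the box [m_i < j], and the column of the
    backward shifts controls all coordinates of [T x] outside of that box. A
    small norm of [eta j T] therefore makes [T] small from the complement of a
    finite box to the complement of a finite box; a bounded sequence whose
    coordinates converge, and for which the coordinates of its image converge
    (a diagonal subsequence), then has a Cauchy image.

    The analysis needed for the identification is developed from the Cauchy
    theory of one variable. Goursat's argument by bisection, run in polar
    coordinates, shows that the circular means of a differentiable function do
    not depend on the radius ([circ_const]), from which come the Cauchy formula
    and Taylor coefficients; expanding in one variable after the other gives
    Taylor series on the polydisc ([taylor_series]).

    Surjectivity onto [H2anti] is the one place where the geometry of the
    symmetrized polydisc matters. The Jacobian is a constant multiple of the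
    Vandermonde determinant ([vander_jac]), and the quotient of the determinant
    of the [z_i ^+ a_j] by it is a polynomial [quot_det a] in the elementary
    symmetric functions, a determinant formed by the remainders of the powers of
    [X] modulo the characteristic polynomial. The series of the [quot_det a] with
    the Taylor coefficients of [G] converges to the preimage of [G]: in the Newton
    basis the remainder of [X ^+ m] is bounded by a multiple of [rho ^+ m] as soon
    as the roots are smaller than [rho] ([quot_det_le]), and the roots depend
    continuously enough on the coefficients for this to hold near each point
    ([near_symmap]). *)

(** * Complex moduli and functions of a real variable *)

Section modulus.
Context {R : realType}.
Local Notation C := R[i].
Implicit Types (x y z : C).

Definition nc z : R := ComplexField.Normc.normc z.

Lemma nc_def z : nc z = Num.sqrt (Re z ^+ 2 + Im z ^+ 2).
Proof. by case: z. Qed.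

Lemma normC_nc z : `|z| = (nc z)%:C%C.
Proof. by rewrite normc_def nc_def. Qed.

Lemma nc_ge0 z : 0 <= nc z.
Proof. by rewrite nc_def sqrtr_ge0. Qed.

Lemma ncM x y : nc (x * y) = nc x * nc y.
Proof. exact: ComplexField.Normc.normcM. Qed.

Lemma ncD x y : nc (x + y) <= nc x + nc y.
Proof. exact: le_normcD. Qed.

Lemma ncN x : nc (- x) = nc x.
Proof. by case: x => a b; rewrite !nc_def /= !sqrrN. Qed.

Lemma nc0 : nc 0 = 0.
Proof. exact: ComplexField.Normc.normc0. Qed.

Lemma nc1 : nc 1 = 1.
Proof. exact: ComplexField.Normc.normc1. Qed.

Lemma nc_eq0 x : (nc x == 0) = (x == 0).
Proof.
apply/eqP/eqP => [|->]; last exact: nc0.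
exact: ComplexField.Normc.eq0_normc.
Qed.

Lemma nc_gt0 x : (0 < nc x) = (x != 0).
Proof. by rewrite lt_neqAle nc_ge0 andbT eq_sym nc_eq0. Qed.

Lemma ncV x : nc x^-1 = (nc x)^-1.
Proof. exact: ComplexField.Normc.normcV. Qed.

Lemma ncX x n : nc (x ^+ n) = nc x ^+ n.
Proof. by elim: n => [|n IH]; rewrite ?expr0 ?nc1// !exprS ncM IH. Qed.

Lemma ncB x y : nc (x - y) <= nc x + nc y.
Proof. by rewrite -(ncN y); apply: ncD. Qed.

Lemma ncC x y : nc (x - y) = nc (y - x).
Proof. by rewrite -ncN opprB. Qed.

Lemma nc_tri x y z : nc (x - z) <= nc (x - y) + nc (y - z).
Proof. by have := ncD (x - y) (y - z); rewrite addrA subrK. Qed.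

Lemma nc_real (a : R) : nc a%:C%C = `|a|.
Proof. by rewrite nc_def /= expr0n addr0 sqrtr_sqr. Qed.

Lemma nc_ge_Re z : `|Re z| <= nc z.
Proof.
by rewrite nc_def -sqrtr_sqr ler_wsqrtr// lerDl sqr_ge0.
Qed.

Lemma nc_ge_Im z : `|Im z| <= nc z.
Proof.
by rewrite nc_def -sqrtr_sqr ler_wsqrtr// lerDr sqr_ge0.
Qed.

Lemma nc_le_ReIm z : nc z <= `|Re z| + `|Im z|.
Proof.
rewrite -[leLHS]ger0_norm ?nc_ge0// -ler_sqr ?nnegrE ?addr_ge0//.
rewrite real_normK ?num_real// nc_def sqr_sqrtr ?addr_ge0 ?sqr_ge0//.
rewrite sqrrD !real_normK ?num_real//.
rewrite addrAC lerDl mulrn_wge0// mulr_ge0//.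
Qed.

Lemma nc_sum (I : Type) (r : seq I) (P : pred I) (F : I -> C) :
  nc (\sum_(i <- r | P i) F i) <= \sum_(i <- r | P i) nc (F i).
Proof.
elim/big_rec2: _ => [|i a b _ h]; first by rewrite nc0.
by apply: (le_trans (ncD _ _)); rewrite lerD2l.
Qed.

Lemma nc_prod (I : Type) (r : seq I) (P : pred I) (F : I -> C) :
  nc (\prod_(i <- r | P i) F i) = \prod_(i <- r | P i) nc (F i).
Proof.
elim/big_rec2: _ => [|i a b _ h]; first by rewrite nc1.
by rewrite ncM h.
Qed.

(** The complex exponential on the imaginary axis. *)
Definition ei (t : R) : C := (cos t +i* sin t)%C.

Lemma nc_ei t : nc (ei t) = 1.
Proof. by rewrite nc_def /= cos2Dsin2 sqrtr1. Qed.

Lemma ei0 : ei 0 = 1.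
Proof. by rewrite /ei cos0 sin0. Qed.

Lemma ei2pi : ei (2 * pi) = 1.
Proof. by rewrite /ei mulr_natl cos2pi sin2pi. Qed.

Lemma eiD s t : ei (s + t) = ei s * ei t.
Proof.
rewrite /ei cosD sinD; apply/eqP; rewrite eq_complex /=; apply/andP; split;
  by apply/eqP; ring.
Qed.

Lemma ei_neq0 t : ei t != 0.
Proof. by rewrite -nc_gt0 nc_ei. Qed.

End modulus.
Section primitives.
Context {R : realType}.
Local Notation C := R[i].
Implicit Types (G H : R -> C) (u v w : C).

Lemma ReD u v : Re (u + v) = Re u + Re v. Proof. by case: u v => [? ?] [? ?]. Qed.
Lemma ImD u v : Im (u + v) = Im u + Im v. Proof. by case: u v => [? ?] [? ?]. Qed.
Lemma ReN u : Re (- u) = - Re u. Proof. by case: u. Qed.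
Lemma ImN u : Im (- u) = - Im u. Proof. by case: u. Qed.
Lemma ReM u v : Re (u * v) = Re u * Re v - Im u * Im v.
Proof. by case: u v => [? ?] [? ?]. Qed.
Lemma ImM u v : Im (u * v) = Re u * Im v + Im u * Re v.
Proof. by case: u v => [? ?] [? ?]; rewrite /= addrC. Qed.

(** The derivative of a complex-valued function of a real variable, taken on
    both components so that real calculus applies. *)
Definition cder G (t : R) v : Prop :=
  is_derive t 1 (fun s => Re (G s)) (Re v) /\
  is_derive t 1 (fun s => Im (G s)) (Im v).

Lemma cderD G H t u v : cder G t u -> cder H t v -> cder (fun s => G s + H s) t (u + v).
Proof.
move=> [G1 G2] [H1 H2]; split.
- under eq_fun do rewrite ReD.
  by rewrite ReD; exact: is_deriveD.
- under eq_fun do rewrite ImD.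
  by rewrite ImD; exact: is_deriveD.
Qed.

Lemma cderZ G t c u : cder G t u -> cder (fun s => c * G s) t (c * u).
Proof.
move=> [G1 G2]; split.
- under eq_fun do rewrite ReM.
  rewrite ReM; have := is_deriveB (is_deriveZ (Re c) G1) (is_deriveZ (Im c) G2).
  by apply.
- under eq_fun do rewrite ImM.
  rewrite ImM; have := is_deriveD (is_deriveZ (Re c) G2) (is_deriveZ (Im c) G1).
  by apply.
Qed.

Lemma cderN G t u : cder G t u -> cder (fun s => - G s) t (- u).
Proof. by move=> /(cderZ (-1)); rewrite mulN1r; under eq_fun do rewrite mulN1r. Qed.

Lemma cderB G H t u v : cder G t u -> cder H t v -> cder (fun s => G s - H s) t (u - v).
Proof. by move=> hG hH; apply: cderD hG (cderN hH). Qed.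

Lemma cder_cst c t : cder (fun=> c) t 0.
Proof. by split; exact: is_derive_cst. Qed.

Lemma cder_id t : cder (fun s : R => s%:C%C) t 1.
Proof. by split; [exact: is_derive_id|exact: is_derive_cst]. Qed.

Lemma cder_ei t : cder (@ei R) t ('i%C * ei t).
Proof.
split; rewrite ?ReM ?ImM /= ?mul0r ?mul1r ?add0r ?sub0r.
- exact: is_derive_cos.
- exact: is_derive_sin.
Qed.

Lemma real_mvt (g dg : R -> R) (a b eta : R) : a <= b ->
  (forall t, a <= t <= b -> is_derive t 1 g (dg t)) ->
  (forall t, a <= t <= b -> `|dg t| <= eta) ->
  `|g b - g a| <= eta * (b - a).
Proof.
move=> ab dgP bd.
have [] := @MVT_segment R g dg a b ab.
- by move=> t /andP[/ltW ? /ltW ?]; apply: dgP; apply/andP; split.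
- apply: derivable_within_continuous => t /=; rewrite in_itv/= => tab.
  by have [] := dgP _ tab.
- move=> c; rewrite in_itv/= => cab ->.
  by rewrite normrM (ger0_norm (_ : 0 <= b - a)) ?subr_ge0// ler_wpM2r ?subr_ge0// bd.
Qed.

Lemma cder_mvt G (dG : R -> C) (a b eta : R) : a <= b ->
  (forall t, a <= t <= b -> cder G t (dG t)) ->
  (forall t, a <= t <= b -> nc (dG t) <= eta) ->
  nc (G b - G a) <= 2 * eta * (b - a).
Proof.
move=> ab dGP bd.
apply: (le_trans (nc_le_ReIm _)); rewrite ReD ImD ReN ImN.
rewrite -mulrA mulr_natl mulr2n; apply: lerD.
- apply: (@real_mvt (fun t => Re (G t)) (fun t => Re (dG t))) => // t tab.
    by have [] := dGP _ tab.
  exact: le_trans (nc_ge_Re _) (bd _ tab).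
- apply: (@real_mvt (fun t => Im (G t)) (fun t => Im (dG t))) => // t tab.
    by have [] := dGP _ tab.
  exact: le_trans (nc_ge_Im _) (bd _ tab).
Qed.

Definition rprim (a : R) (g : R -> R) : R -> R :=
  fun x => (\int[lebesgue_measure]_(t in [set` Interval (BLeft a) (BRight x)]) (g t))%R.

Lemma rprimP (a : R) (g : R -> R) (t : R) : continuous g -> a < t ->
  is_derive t 1 (rprim a g) (g t).
Proof.
move=> cg at_.
have := @continuous_FTC1 R g (BLeft a) t (t + 1) _ _ _ (cg t).
case=> //.
- by rewrite ltrDl.
- apply: continuous_compact_integrable; first exact: segment_compact.
  exact: continuous_subspaceT.
- by move=> d1 d2; apply: DeriveDef; [exact: d1|rewrite -derive1E; exact: d2].
Qed.

Definition ccont G : Prop := forall t e, 0 < e ->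
  exists2 d, 0 < d & forall s, `|s - t| < d -> nc (G s - G t) <= e.

Lemma ccont_Re G : ccont G -> continuous (fun t => Re (G t)).
Proof.
move=> cG t; apply/cvgrPdist_le => e e0; have [d d0 h] := cG t e e0.
near=> s; rewrite -ReN -ReD; apply: (le_trans (nc_ge_Re _)).
rewrite ncC; apply: h; rewrite distrC.
by near: s; exact: cvgr_dist_lt.
Unshelve. all: by end_near. Qed.

Lemma ccont_Im G : ccont G -> continuous (fun t => Im (G t)).
Proof.
move=> cG t; apply/cvgrPdist_le => e e0; have [d d0 h] := cG t e e0.
near=> s; rewrite -ImN -ImD; apply: (le_trans (nc_ge_Im _)).
rewrite ncC; apply: h; rewrite distrC.
by near: s; exact: cvgr_dist_lt.
Unshelve. all: by end_near. Qed.

(** A primitive of a continuous function, valid to the right of [a]. *)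
Definition cprim (a : R) G : R -> C :=
  fun x => (rprim a (fun t => Re (G t)) x +i* rprim a (fun t => Im (G t)) x)%C.

Lemma cprimP a G t : ccont G -> a < t -> cder (cprim a G) t (G t).
Proof.
by move=> cG at_; split; apply: rprimP => //; [exact: ccont_Re|exact: ccont_Im].
Qed.

Lemma ccont_cont (g : R -> R) : continuous g -> forall t e, 0 < e ->
  exists2 d, 0 < d & forall s, `|s - t| < d -> `|g s - g t| <= e.
Proof.
move=> cg t e e0; have /cvgrPdist_le /(_ e e0) := cg t.
move=> /nbhs_ballP[d /= d0 h]; exists d => // s st.
by rewrite distrC; apply: h; rewrite /ball/= distrC.
Qed.

Lemma ccont_ei : ccont (@ei R).
Proof.
move=> t e e0; have e20 : 0 < e / 2 by rewrite divr_gt0.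
have [d1 d10 h1] := ccont_cont (@continuous_cos R) t e20.
have [d2 d20 h2] := ccont_cont (@continuous_sin R) t e20.
exists (Num.min d1 d2); first by rewrite lt_min d10.
move=> s; rewrite lt_min => /andP[s1 s2].
apply: (le_trans (nc_le_ReIm _)); rewrite [leRHS]splitr; apply: lerD; [exact: h1|exact: h2].
Qed.

End primitives.

(** * Cauchy theory in one variable *)

Section bisection.
Context {R : realType}.

Lemma nested_intervals (X W : nat -> R) :
  (forall n, X n <= X n.+1) -> (forall n, X n.+1 + W n.+1 <= X n + W n) ->
  (forall n, 0 <= W n) -> exists a, forall n, X n <= a <= X n + W n.
Proof.
move=> X1 X2 W0.
have mX m n : (m <= n)%N -> X m <= X n.
  elim: n => [|n IH]; first by rewrite leqn0 => /eqP->.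
  by rewrite leq_eqVlt => /orP[/eqP->//|/IH h]; exact: le_trans h (X1 n).
have mW m n : (m <= n)%N -> X n + W n <= X m + W m.
  elim: n => [|n IH]; first by rewrite leqn0 => /eqP->.
  by rewrite leq_eqVlt => /orP[/eqP->//|/IH h]; exact: le_trans (X2 n) h.
have ub n m : X m <= X n + W n.
  case: (leqP m n) => mn; first by rewrite (le_trans (mX _ _ mn))// lerDl.
  by rewrite (le_trans _ (mW _ _ (ltnW mn)))// lerDl.
have hs : has_sup (range X).
  split; first by exists (X 0%N), 0%N.
  by exists (X 0%N + W 0%N) => _ [m _ <-]; exact: ub.
exists (sup (range X)) => n; apply/andP; split.
  by apply: sup_upper_bound => //; exists n.
apply: ge_sup; first by exists (X 0%N), 0%N.
by move=> _ [m _ <-]; exact: ub.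
Qed.

(** Every property of rectangles that passes from four quarters to the whole and
    holds for small rectangles around each point holds for the given one.
    Rectangles keep the proportions [L : T]; [s] is the scaling factor. *)
Lemma bisection_ind (L T x0 y0 : R) (P : R -> R -> R -> Prop) : 0 <= L -> 0 <= T ->
  (forall x y s, 0 < s ->
    P x y (s / 2) -> P (x + s / 2 * L) y (s / 2) ->
    P x (y + s / 2 * T) (s / 2) -> P (x + s / 2 * L) (y + s / 2 * T) (s / 2) ->
    P x y s) ->
  (forall a b, x0 <= a <= x0 + L -> y0 <= b <= y0 + T ->
    exists2 d, 0 < d & forall x y s, 0 < s < d ->
      x0 <= x -> x <= a <= x + s * L -> x + s * L <= x0 + L ->
      y0 <= y -> y <= b <= y + s * T -> y + s * T <= y0 + T ->
      P x y s) ->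
  P x0 y0 1.
Proof.
move=> L0 T0 sub loc; apply: contrapT => nP.
pose f (z : R * R) (s : R) : R * R :=
  if `[< ~ P z.1 z.2 (s / 2) >] then z else
  if `[< ~ P (z.1 + s / 2 * L) z.2 (s / 2) >] then (z.1 + s / 2 * L, z.2) else
  if `[< ~ P z.1 (z.2 + s / 2 * T) (s / 2) >] then (z.1, z.2 + s / 2 * T) else
  (z.1 + s / 2 * L, z.2 + s / 2 * T).
have fP z s : 0 < s -> ~ P z.1 z.2 s -> ~ P (f z s).1 (f z s).2 (s / 2).
  move=> s0 nPz; rewrite /f.
  case: asboolP => //= /contrapT h1; case: asboolP => //= /contrapT h2.
  by case: asboolP => //= /contrapT h3 h4; apply: nPz; exact: sub.
have f1 z s : 0 < s -> z.1 <= (f z s).1 <= z.1 + s / 2 * L.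
  move=> s0; have : 0 <= s / 2 * L by rewrite mulr_ge0// divr_ge0// ltW.
  by rewrite /f => h; do !case: asboolP => //= _; rewrite ?lexx ?lerDl ?h.
have f2 z s : 0 < s -> z.2 <= (f z s).2 <= z.2 + s / 2 * T.
  move=> s0; have : 0 <= s / 2 * T by rewrite mulr_ge0// divr_ge0// ltW.
  by rewrite /f => h; do !case: asboolP => //= _; rewrite ?lexx ?lerDl ?h.
pose s n : R := 2^-1 ^+ n.
have s_gt0 n : 0 < s n by rewrite exprn_gt0.
have sS n : s n.+1 = s n / 2 by rewrite /s exprSr.
pose z := fix z n := if n is m.+1 then f (z m) (s m) else (x0, y0).
have zP n : ~ P (z n).1 (z n).2 (s n).
  by elim: n => [|n IH] //=; rewrite sS; exact: fP.
have z1 n : (z n).1 <= (z n.+1).1 by have /andP[] := f1 (z n) _ (s_gt0 n).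
have z2 n : (z n).2 <= (z n.+1).2 by have /andP[] := f2 (z n) _ (s_gt0 n).
have z1' n : (z n.+1).1 + s n.+1 * L <= (z n).1 + s n * L.
  have /andP[_ h] := f1 (z n) _ (s_gt0 n); rewrite sS /=.
  have -> : s n * L = s n / 2 * L + s n / 2 * L by rewrite -mulrDl -splitr.
  by rewrite addrA lerD2r.
have z2' n : (z n.+1).2 + s n.+1 * T <= (z n).2 + s n * T.
  have /andP[_ h] := f2 (z n) _ (s_gt0 n); rewrite sS /=.
  have -> : s n * T = s n / 2 * T + s n / 2 * T by rewrite -mulrDl -splitr.
  by rewrite addrA lerD2r.
have [a ha] := @nested_intervals _ (fun n => s n * L) z1 z1' (fun n => mulr_ge0 (ltW (s_gt0 n)) L0).
have [b hb] := @nested_intervals _ (fun n => s n * T) z2 z2' (fun n => mulr_ge0 (ltW (s_gt0 n)) T0).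
have /= ha0 := ha 0%N; have /= hb0 := hb 0%N.
rewrite /s expr0 !mul1r in ha0 hb0.
have [d d0 hd] := loc _ _ ha0 hb0.
have [N sN] : exists N, s N < d.
  have : s n @[n --> \oo] --> 0 by apply: cvg_expr; rewrite ger0_norm// invf_lt1// ltr1n.
  move=> /cvgrPdist_lt /(_ _ d0) [N _ h]; exists N.
  by have := h N (leqnn N); rewrite sub0r normrN ger0_norm// ltW.
have m1 n : x0 <= (z n).1 by elim: n => //= n IH; exact: le_trans (z1 n).
have m2 n : y0 <= (z n).2 by elim: n => //= n IH; exact: le_trans (z2 n).
have w1 n : (z n).1 + s n * L <= x0 + L.
  by elim: n => [|n IH]; [rewrite /s expr0 mul1r|exact: le_trans (z1' n) IH].
have w2 n : (z n).2 + s n * T <= y0 + T.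
  by elim: n => [|n IH]; [rewrite /s expr0 mul1r|exact: le_trans (z2' n) IH].
by apply: (zP N); apply: hd; rewrite ?s_gt0.
Qed.

End bisection.
Section goursat.
Context {R : realType}.
Local Notation C := R[i].
Implicit Types (Q f : C -> C) (z h : C).

Definition cont_at f z := forall e : R, 0 < e ->
  exists2 d : R, 0 < d & forall h, nc h < d -> nc (f (z + h) - f z) <= e.

Definition cdiff_with f z D := forall e : R, 0 < e ->
  exists2 d : R, 0 < d & forall h, nc h < d -> nc (f (z + h) - f z - D * h) <= e * nc h.

Definition cdiff f z := exists D, cdiff_with f z D.

Lemma cdiff_cont f z : cdiff f z -> cont_at f z.
Proof.
move=> [D /(_ 1 ltr01)[d d0 hd]] e e0.
have k0 : 0 < 1 + nc D by rewrite ltr_wpDr// nc_ge0.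
exists (Num.min d (e / (1 + nc D))); first by rewrite lt_min d0 divr_gt0.
move=> h; rewrite lt_min => /andP[/hd h1 h2].
rewrite -(subrK (D * h) (_ - _)); apply: (le_trans (ncD _ _)); rewrite ncM.
rewrite ltr_pdivlMr// mulrDr mulr1 in h2; nra.
Qed.

Lemma ccontM (F G : R -> C) : ccont F -> ccont G -> ccont (fun t => F t * G t).
Proof.
move=> cF cG t e e0.
have k1 : 0 < e / 2 / (nc (G t) + 1) by rewrite !divr_gt0// ltr_wpDl ?nc_ge0.
have k2 : 0 < Num.min 1 (e / 2 / (nc (F t) + 1)).
  by rewrite lt_min ltr01 !divr_gt0// ltr_wpDl ?nc_ge0.
have [d1 d10 h1] := cF t _ k1.
have [d2 d20 h2] := cG t _ k2.
exists (Num.min d1 d2); first by rewrite lt_min d10.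
move=> s; rewrite lt_min => /andP[/h1 {}h1 /h2]; rewrite le_min => /andP[h3 {}h2].
have -> : F s * G s - F t * G t = (F s - F t) * G s + F t * (G s - G t) by ring.
apply: (le_trans (ncD _ _)); rewrite !ncM [leRHS]splitr; apply: lerD.
- have : nc (G s) <= nc (G t) + 1.
    by rewrite -(subrK (G t) (G s)) (le_trans (ncD _ _))// addrC lerD2l.
  move=> /(ler_pM (nc_ge0 _) (nc_ge0 _) h1) /le_trans; apply.
  by rewrite divfK// gt_eqF// ltr_wpDl ?nc_ge0.
- have h : nc (F t) <= nc (F t) + 1 by rewrite lerDl.
  have /le_trans := ler_pM (nc_ge0 _) (nc_ge0 _) h h2; apply.
  by rewrite mulrC divfK// gt_eqF// ltr_wpDl ?nc_ge0.
Qed.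

Lemma ccont_cst (c : C) : ccont (fun _ : R => c).
Proof. by move=> t e e0; exists 1 => // s _; rewrite subrr nc0 ltW. Qed.

Lemma cont_at_ccont f (F : R -> C) : (forall t, cont_at f (F t)) -> ccont F ->
  ccont (fun t => f (F t)).
Proof.
move=> cf cF t e e0; have [d d0 hd] := cf t e e0.
have d20 : 0 < d / 2 by rewrite divr_gt0.
have [d' d'0 hd'] := cF t _ d20; exists d' => // s /hd' hs.
have := hd (F s - F t); rewrite [F t + _]addrC subrK; apply.
by rewrite (le_lt_trans hs)// ltr_pdivrMr// ltr_pMr// ltr1n.
Qed.

Lemma nc_ei_sub (s t : R) : nc (ei s - ei t) <= 2 * `|s - t|.
Proof.
wlog ts : s t / t <= s.
  by move=> H; case: (leP t s) => [/H//|/ltW /H]; rewrite ncC distrC.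
have -> : 2 * `|s - t| = 2 * 1 * (s - t) by rewrite mulr1 ger0_norm ?subr_ge0.
apply: (@cder_mvt _ _ (fun t => 'i%C * ei t)) => // x _; first exact: cder_ei.
by rewrite ncM nc_ei mulr1 nc_def /= expr0n expr1n add0r sqrtr1.
Qed.

Lemma nc_polar (rho t : R) : 0 <= rho -> nc (rho%:C%C * ei t) = rho.
Proof. by move=> r0; rewrite ncM nc_ei nc_real mulr1 ger0_norm. Qed.

Definition circ_fun Q (rho : R) : R -> C := fun t => Q (rho%:C%C * ei t).

(** [2 pi] times the mean of [Q] over the circle of radius [rho]. *)
Definition circ Q rho : C :=
  cprim (-1) (circ_fun Q rho) (2 * pi) - cprim (-1) (circ_fun Q rho) 0.

Lemma circ_fun_cont Q rho : 0 <= rho -> (forall z, nc z = rho -> cont_at Q z) ->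
  ccont (circ_fun Q rho).
Proof.
move=> r0 cQ; apply: cont_at_ccont; first by move=> t; apply: cQ; rewrite nc_polar.
by apply: ccontM; [exact: ccont_cst|exact: ccont_ei].
Qed.

(** Along a circular sector the integral of [Q] over the boundary vanishes by
    bisection; for a full turn the two radial sides cancel, so that only the
    two circular means remain. *)
Lemma circ_const Q (a b : R) : 0 < a -> a <= b ->
  (forall z, a <= nc z <= b -> cdiff Q z) -> circ Q a = circ Q b.
Proof.
move=> a0 ab dQ.
have cQ z : a <= nc z <= b -> cont_at Q z by move=> /dQ; exact: cdiff_cont.
pose cl (t : R) := Num.max a (Num.min b t).
have cl_in t : a <= cl t <= b by rewrite /cl le_max lexx ge_max ab ge_min lexx.
have clE t : a <= t <= b -> cl t = t by move=> /andP[h1 h2]; rewrite /cl (min_idPr h2) (max_idPr h1).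
have cl_lip s t : `|cl s - cl t| <= `|s - t|.
  have h1 := ler_norm (s - t); have h2 := ler_norm (t - s).
  rewrite distrC in h2; rewrite ler_norml; apply/andP; rewrite /cl.
  by split; case: (leP b s) => ?; case: (leP b t) => ?; case: (leP a b) => ?; case: (leP a s) => ?; case: (leP a t) => ?; lra.
pose A rho := cprim (-1) (circ_fun Q rho).
pose bf (u : C) (t : R) := Q ((cl t)%:C%C * u) * ((cl t)^-1)%:C%C.
pose B u := cprim (a - 1) (bf u).
have AP rho t : a <= rho <= b -> -1 < t -> cder (A rho) t (Q (rho%:C%C * ei t)).
  move=> /andP[r1 r2] t1; apply: cprimP => //; apply: circ_fun_cont; first exact: le_trans (ltW a0) r1.
  by move=> z zr; apply: cQ; rewrite zr r1.
have cl_gt0 t : 0 < cl t by have /andP[h _] := cl_in t; exact: lt_le_trans h.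
have BP th t : a <= t <= b -> cder (B (ei th)) t (Q (t%:C%C * ei th) * (t^-1)%:C%C).
  move=> tab; have -> : Q (t%:C%C * ei th) * (t^-1)%:C%C = bf (ei th) t by rewrite /bf clE.
  apply: cprimP; last by case/andP: tab => h _; rewrite (lt_le_trans _ h)// ltrBlDr ltrDl.
  apply: ccontM.
  - apply: cont_at_ccont; first by move=> s; apply: cQ; rewrite nc_polar// ltW.
    apply: ccontM; last exact: ccont_cst.
    move=> s e e0; exists e => // s' /ltW; rewrite -rmorphB nc_real; exact: le_trans.
  - move=> s e e0; exists (e * a ^+ 2); first by rewrite mulr_gt0// exprn_gt0.
    move=> s' ss; rewrite -rmorphB nc_real.
    have -> : (cl s')^-1 - (cl s)^-1 = (cl s - cl s') / (cl s * cl s').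
      by field; rewrite !gt_eqF.
    rewrite normrM normfV ler_pdivrMr ?normr_gt0 ?gt_eqF ?mulr_gt0//.
    apply: (le_trans (cl_lip _ _)); rewrite distrC; apply: (le_trans (ltW ss)).
    rewrite ler_wpM2l ?(ltW e0)// ger0_norm; last by rewrite ltW// mulr_gt0.
    have /andP[? _] := cl_in s; have /andP[? _] := cl_in s'.
    by rewrite expr2 ler_pM// ltW.
pose II r1 r2 t1 t2 := 'i%C * (A r2 t2 - A r2 t1 - A r1 t2 + A r1 t1)
  - (B (ei t2) r2 - B (ei t2) r1 - B (ei t1) r2 + B (ei t1) r1).
suff I0 : II a b 0 (2 * pi) = 0.
  move: I0; rewrite /II ei2pi ei0 => /eqP.
  rewrite (_ : B 1 b - _ - _ + _ = 0) ?subr0; last by ring.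
  rewrite mulf_eq0 => /orP[/eqP/(congr1 (@complex.Im R))/= /eqP|/eqP h]; first by rewrite oner_eq0.
  by rewrite /circ -/(A a) -/(A b); apply/eqP; rewrite eq_sym -subr_eq0 -h; apply/eqP; ring.
apply/eqP; rewrite -nc_eq0 eq_le nc_ge0 andbT; apply/ler_addgt0Pr => e e0; rewrite add0r.
pose L := b - a; pose T : R := 2 * pi.
have L0 : 0 <= L by rewrite subr_ge0.
have T0 : 0 <= T by rewrite mulr_ge0// pi_ge0.
pose P x y s : Prop := nc (II x (x + s * L) y (y + s * T)) <= e * s ^+ 2.
suff : P a 0 1 by rewrite /P !mul1r expr1n mulr1 add0r /L addrC subrK.
apply: (@bisection_ind _ L T) => //.
  move=> x y s s0; rewrite /P => h1 h2 h3 h4.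
  have E1 : x + s / 2 * L + s / 2 * L = x + s * L by field.
  have E2 : y + s / 2 * T + s / 2 * T = y + s * T by field.
  rewrite E1 E2 in h2 h3 h4.
  set I1 := II _ _ _ _ in h1; set I2 := II _ _ _ _ in h2.
  set I3 := II _ _ _ _ in h3; set I4 := II _ _ _ _ in h4.
  have -> : II x (x + s * L) y (y + s * T) = (I1 + I2) + (I3 + I4).
    by rewrite /I1 /I2 /I3 /I4 /II; ring.
  apply: (le_trans (ncD _ _)); apply: (le_trans (lerD (ncD _ _) (ncD _ _))).
  apply: (le_trans (lerD (lerD h1 h2) (lerD h3 h4))).
  by rewrite le_eqVlt; apply/orP; left; apply/eqP; field.
rewrite add0r => r0 t0 hr0 ht0.
have hab : a + L = b by rewrite /L addrC subrK.
rewrite hab in hr0.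
pose z0 := r0%:C%C * ei t0.
have [D hD] : cdiff Q z0 by apply: dQ; rewrite nc_polar//; case/andP: hr0 => h _; rewrite (le_trans (ltW a0)).
pose W := L + 2 * b * T + 1.
have b0 : 0 < b by exact: lt_le_trans ab.
have W0 : 0 < W by rewrite ltr_wpDl// addr_ge0// mulr_ge0// mulr_ge0// ltW.
pose K := 4 * W * (T + L / a) + 1.
have La : 0 <= L / a by rewrite divr_ge0// ltW.
have K0 : 0 < K by rewrite ltr_wpDl// mulr_ge0 ?addr_ge0// mulr_ge0 ?(ltW W0).
pose e' := e / K.
have e'0 : 0 < e' by rewrite divr_gt0.
have [d0 d00 hd0] := hD _ e'0.
exists (d0 / W); first by rewrite divr_gt0.
move=> x y s /andP[s0 sd] ax xr xb y0 yt yT.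
rewrite hab in xb; rewrite ltr_pdivlMr// in sd.
set x2 := x + s * L; set y2 := y + s * T.
pose r z := Q z - Q z0 - D * (z - z0).
have sL : 0 <= s * L by rewrite mulr_ge0// ltW.
have sT : 0 <= s * T by rewrite mulr_ge0// ltW.
have rP rho t : x <= rho <= x2 -> y <= t <= y2 -> nc (r (rho%:C%C * ei t)) <= e' * (s * W).
  move=> hrho ht; set z := _ * _.
  have zz : nc (z - z0) <= s * (L + 2 * b * T).
    have -> : z - z0 = (rho - r0)%:C%C * ei t + r0%:C%C * (ei t - ei t0).
      by rewrite rmorphB /z /z0; ring.
    rewrite [leRHS]mulrDr; apply: (le_trans (ncD _ _)); rewrite !ncM nc_ei mulr1 !nc_real.
    apply: lerD; first by rewrite ler_norml; apply/andP; split; rewrite /x2 in hrho; lra.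
    have -> : s * (2 * b * T) = b * (2 * (s * T)) by ring.
    apply: ler_pM => //; rewrite ?nc_ge0//; first by rewrite ger0_norm; lra.
    apply: (le_trans (nc_ei_sub _ _)); rewrite ler_wpM2l// ler_norml.
    by apply/andP; split; rewrite /y2 in ht; lra.
  have zzW : nc (z - z0) <= s * W by rewrite (le_trans zz)// ler_wpM2l ?(ltW s0)// /W lerDl.
  have := hD _ e'0; rewrite /r => _.
  have := hd0 (z - z0); rewrite [z0 + _]addrC subrK => /(_ (le_lt_trans zzW sd)) /le_trans; apply.
  by rewrite ler_wpM2l// ltW.
have rQ z : Q z = Q z0 + D * (z - z0) + r z by rewrite /r; ring.
pose H1 t := A x2 t - A x t - D * (x2 - x)%:C%C * (- 'i%C) * ei t.
pose H2 rho := B (ei y2) rho - B (ei y) rho - D * (ei y2 - ei y) * rho%:C%C.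
have i2 : 'i%C * 'i%C = -1 :> C by rewrite -expr2 sqr_i.
rewrite /P -/x2 -/y2.
have -> : II x x2 y y2 = 'i%C * (H1 y2 - H1 y) - (H2 x2 - H2 x).
  rewrite /II /H1 /H2 rmorphB /=.
  have i2' : ('i%C : C) * (- 'i%C) = 1 by rewrite mulrN i2 opprK.
  set ai := ei y; set aj := ei y2; set p := x%:C%C; set q := x2%:C%C.
  transitivity ('i%C * (A x2 y2 - A x2 y - A x y2 + A x y)
    - D * (q - p) * ('i%C * - 'i%C) * (aj - ai)
    - (B aj x2 - B aj x - B ai x2 + B ai x) + D * (q - p) * (aj - ai)).
    by rewrite i2'; ring.
  by ring.
have xx2 : a <= x2 <= b by rewrite /x2; lra.
have xx : a <= x <= b by rewrite /x2; lra.
have b1 : nc (H1 y2 - H1 y) <= 2 * (2 * (e' * (s * W))) * (y2 - y).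
  apply: (@cder_mvt _ _ (fun t => Q (x2%:C%C * ei t) - Q (x%:C%C * ei t)
     - D * (x2 - x)%:C%C * (- 'i%C) * ('i%C * ei t))); first by rewrite /y2; lra.
    move=> t ht; apply: cderB; last by apply: cderZ; exact: cder_ei.
    by apply: cderB; apply: AP => //; lra.
  move=> t ht.
  rewrite (_ : _ - _ = r (x2%:C%C * ei t) - r (x%:C%C * ei t)); last first.
    rewrite (rQ (x2%:C%C * ei t)) (rQ (x%:C%C * ei t)) rmorphB /=.
    rewrite (_ : D * _ * - 'i%C * ('i%C * ei t) = - ('i%C * 'i%C) * (D * (x2%:C%C - x%:C%C) * ei t)); last by ring.
    by rewrite i2; ring.
  apply: (le_trans (ncB _ _)); rewrite mulr_natl mulr2n; apply: lerD; apply: rP => //.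
    by rewrite /x2; lra.
  by rewrite /x2; lra.
have b2 : nc (H2 x2 - H2 x) <= 2 * (2 * (e' * (s * W)) / a) * (x2 - x).
  apply: (@cder_mvt _ _ (fun t => Q (t%:C%C * ei y2) * (t^-1)%:C%C - Q (t%:C%C * ei y) * (t^-1)%:C%C
     - D * (ei y2 - ei y) * 1)); first by rewrite /x2; lra.
    move=> t ht; apply: cderB; last by apply: cderZ; exact: cder_id.
    by apply: cderB; apply: BP => //; lra.
  move=> t ht.
  have t0' : t != 0 by rewrite gt_eqF//; lra.
  have tC : (t^-1)%:C%C * t%:C%C = 1 :> C by rewrite -rmorphM mulVf.
  rewrite (_ : _ - _ = (r (t%:C%C * ei y2) - r (t%:C%C * ei y)) * (t^-1)%:C%C); last first.
    rewrite (rQ (t%:C%C * ei y2)) (rQ (t%:C%C * ei y)).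
    set u := r _; set v := r _.
    rewrite mulr1 (_ : (D * (ei y2 - ei y)) = D * (ei y2 - ei y) * ((t^-1)%:C%C * t%:C%C)); first by ring.
    by rewrite tC mulr1.
  rewrite ncM nc_real ger0_norm ?invr_ge0; last by lra.
  apply: ler_pM; rewrite ?nc_ge0 ?invr_ge0//; first lra.
    apply: (le_trans (ncB _ _)); rewrite mulr_natl mulr2n; apply: lerD; apply: rP => //.
      by rewrite /y2; lra.
    by rewrite /y2; lra.
  by rewrite lef_pV2 ?posrE//; lra.
apply: (le_trans (ncB _ _)); rewrite ncM.
have -> : nc ('i%C : C) = 1 by rewrite nc_def /= expr0n expr1n add0r sqrtr1.
rewrite mul1r; apply: (le_trans (lerD b1 b2)).
have -> : y2 - y = s * T by rewrite /y2; lra.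
have -> : x2 - x = s * L by rewrite /x2; lra.
have -> : 2 * (2 * (e' * (s * W))) * (s * T) + 2 * (2 * (e' * (s * W)) / a) * (s * L)
  = e' * s ^+ 2 * (4 * W * (T + L / a)) by field; rewrite gt_eqF.
have -> : e * s ^+ 2 = e' * s ^+ 2 * K by rewrite /e'; field; rewrite gt_eqF.
rewrite ler_wpM2l; first by [].
  by rewrite mulr_ge0 ?sqr_ge0// ltW.
by rewrite /K lerDl.
Qed.

End goursat.
Section cauchy_taylor.
Context {R : realType}.
Local Notation C := R[i].
Implicit Types (Q f : C -> C) (z h : C).

Lemma pi2_gt0 : 0 < 2 * pi :> R.
Proof. by rewrite mulr_gt0// pi_gt0. Qed.

Lemma cder_eq (G H g : R -> C) a b : a <= b ->
  (forall t, a <= t <= b -> cder G t (g t)) ->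
  (forall t, a <= t <= b -> cder H t (g t)) -> G b - G a = H b - H a.
Proof.
move=> ab hG hH; apply/eqP; rewrite -subr_eq0 -nc_eq0 eq_le nc_ge0 andbT.
have -> : G b - G a - (H b - H a) = (G b - H b) - (G a - H a) by ring.
have := @cder_mvt _ (fun t => G t - H t) (fun t => g t - g t) a b 0 ab.
rewrite mulr0 mul0r; apply; first by move=> t tab; apply: cderB; [exact: hG|exact: hH].
by move=> t _; rewrite subrr nc0.
Qed.

Lemma cder_eiM (c t : R) : cder (fun t => ei (c * t)) t ((c%:C%C : C) * 'i%C * ei (c * t)).
Proof.
have dc : is_derive t 1 (fun s : R => c * s) c.
  by have := is_deriveZ c (is_derive_id t 1); rewrite [c *: 1]mulr1.
split.
- rewrite (_ : Re _ = - sin (c * t) * c); last by rewrite /ei /=; ring.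
  exact: (is_derive1_comp (is_derive_cos (c * t)) dc).
- rewrite (_ : Im _ = cos (c * t) * c); last by rewrite /ei /=; ring.
  exact: (is_derive1_comp (is_derive_sin (c * t)) dc).
Qed.

Lemma eiXn (t : R) k : ei t ^+ k = ei (k%:R * t) :> C.
Proof.
elim: k => [|k IH]; first by rewrite expr0 mul0r ei0.
by rewrite exprS IH -eiD -{1}(mul1r t) -mulrDl nat1r.
Qed.

Lemma ei_inv (t : R) : (ei t)^-1 = ei (- t) :> C.
Proof.
by apply: (mulfI (ei_neq0 t)); rewrite divff ?ei_neq0// -eiD subrr ei0.
Qed.

Definition cont_circle Q rho := forall z, nc z = rho -> cont_at Q z.

Lemma circE Q rho G : 0 <= rho -> cont_circle Q rho ->
  (forall t, 0 <= t <= 2 * pi -> cder G t (Q (rho%:C%C * ei t))) ->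
  circ Q rho = G (2 * pi) - G 0.
Proof.
move=> r0 cQ hG; rewrite /circ; apply: cder_eq hG; first exact: ltW pi2_gt0.
move=> t /andP[t0 _]; apply: cprimP; first exact: circ_fun_cont.
by rewrite (lt_le_trans _ t0)// ltrN10.
Qed.

Lemma circ_cprim Q rho t : 0 <= rho -> cont_circle Q rho -> 0 <= t ->
  cder (cprim (-1) (circ_fun Q rho)) t (Q (rho%:C%C * ei t)).
Proof.
move=> r0 cQ t0; apply: cprimP; first exact: circ_fun_cont.
by rewrite (lt_le_trans _ t0)// ltrN10.
Qed.

Lemma circ_bound Q rho M : 0 <= rho -> cont_circle Q rho ->
  (forall t, 0 <= t <= 2 * pi -> nc (Q (rho%:C%C * ei t)) <= M) ->
  nc (circ Q rho) <= 2 * M * (2 * pi).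
Proof.
move=> r0 cQ bQ; rewrite /circ -[X in _ <= _ * X]subr0.
apply: cder_mvt; [exact: ltW pi2_gt0| |exact: bQ].
by move=> t /andP[t0 _]; exact: circ_cprim.
Qed.

Lemma circ_sub Q1 Q2 r1 r2 M : 0 <= r1 -> 0 <= r2 -> cont_circle Q1 r1 ->
  cont_circle Q2 r2 ->
  (forall t, 0 <= t <= 2 * pi -> nc (Q1 (r1%:C%C * ei t) - Q2 (r2%:C%C * ei t)) <= M) ->
  nc (circ Q1 r1 - circ Q2 r2) <= 2 * M * (2 * pi).
Proof.
move=> r10 r20 c1 c2 bM.
rewrite /circ -[X in _ <= _ * X]subr0.
set A := cprim _ _; set B := cprim _ _.
have -> : A (2 * pi) - A 0 - (B (2 * pi) - B 0) = (A (2 * pi) - B (2 * pi)) - (A 0 - B 0) by ring.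
apply: (@cder_mvt _ (fun t => A t - B t)); first exact: ltW pi2_gt0.
  by move=> t /andP[t0 _]; apply: cderB; exact: circ_cprim.
exact: bM.
Qed.

Lemma circ0 Q : cont_at Q 0 -> circ Q 0 = (2 * pi)%:C%C * Q 0.
Proof.
move=> cQ; rewrite (@circE _ _ (fun t => Q 0 * t%:C%C)) //.
- by rewrite rmorph0 mulr0 subr0 mulrC.
- by move=> z /eqP; rewrite nc_eq0 => /eqP->.
move=> t _; rewrite rmorph0 mul0r -[Q 0 in X in cder _ _ X]mulr1; apply: cderZ; exact: cder_id.
Qed.

Lemma circle_ind (P : R -> R -> Prop) :
  (forall a b c, a <= b <= c -> P a b -> P b c -> P a c) ->
  (forall t, exists2 d, 0 < d & forall a b, a <= t <= b -> b - a < d -> P a b) ->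
  P 0 (2 * pi).
Proof.
move=> sub loc.
suff : P 0 (0 + 1 * (2 * pi)) by rewrite mul1r add0r.
apply: (@bisection_ind R 0 (2 * pi) 0 0 (fun _ y s => P y (y + s * (2 * pi))) (lexx 0) (ltW pi2_gt0)).
- move=> x y s s0 h1 _ h2 _; apply: sub h1 _.
    have := pi2_gt0; set T := 2 * pi => T0; have := mulr_gt0 s0 T0 => sT; lra.
  by rewrite (_ : y + s * _ = y + s / 2 * (2 * pi) + s / 2 * (2 * pi))//; field.
- move=> u t _ _; have [d d0 hd] := loc t; exists (d / (2 * pi)); first by rewrite divr_gt0// pi2_gt0.
  move=> x y s /andP[s0 sd] _ _ _ _ ty _; apply: hd => //.
  by rewrite addrAC subrr add0r -ltr_pdivlMr// pi2_gt0.
Qed.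

Lemma circle_unif Q rho e : 0 <= rho -> cont_circle Q rho -> 0 < e ->
  exists2 d, 0 < d & forall rho', `|rho' - rho| < d -> forall t, 0 <= t <= 2 * pi ->
    nc (Q (rho'%:C%C * ei t) - Q (rho%:C%C * ei t)) <= e.
Proof.
move=> r0 cQ e0.
apply: (@circle_ind (fun a b => exists2 d, 0 < d & forall rho', `|rho' - rho| < d ->
  forall t, a <= t <= b -> nc (Q (rho'%:C%C * ei t) - Q (rho%:C%C * ei t)) <= e)).
- move=> a b c /andP[ab bc] [d1 d10 h1] [d2 d20 h2].
  exists (Num.min d1 d2); first by rewrite lt_min d10.
  move=> rho'; rewrite lt_min => /andP[/h1 {}h1 /h2 {}h2] t /andP[at_ tc].
  by case: (leP t b) => tb; [apply: h1; rewrite at_|apply: h2; rewrite ltW].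
- move=> t; have e20 : 0 < e / 2 by rewrite divr_gt0.
  have [d d0 hd] := cQ (rho%:C%C * ei t) (nc_polar _ r0) _ e20.
  pose k := 2 * (rho + 1).
  have k0 : 0 < k by rewrite /k; lra.
  exists (d / k / 2); first by rewrite !divr_gt0.
  move=> a b /andP[at_ tb] ab; exists (d / 2); first by rewrite divr_gt0.
  move=> rho' hrho s /andP[as_ sb].
  have st : `|s - t| < d / k / 2 by rewrite ltr_norml; apply/andP; split; lra.
  have key rho1 : `|rho1 - rho| < d / 2 -> nc (Q (rho1%:C%C * ei s) - Q (rho%:C%C * ei t)) <= e / 2.
    move=> h; have := hd (rho1%:C%C * ei s - rho%:C%C * ei t).
    rewrite [rho%:C%C * ei t + _]addrC subrK; apply.
    have -> : rho1%:C%C * ei s - rho%:C%C * ei t =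
      (rho1 - rho)%:C%C * ei s + rho%:C%C * (ei s - ei t) by rewrite rmorphB; ring.
    apply: (le_lt_trans (ncD _ _)); rewrite !ncM nc_ei !nc_real mulr1 (ger0_norm r0).
    have h2 := nc_ei_sub s t.
    have : rho * nc (ei s - ei t) <= k * `|s - t|.
      rewrite /k -mulrA (mulrC (rho + 1)) mulrA mulrC.
      by apply: ler_pM; rewrite ?nc_ge0//; lra.
    rewrite -!mulrA in st; rewrite mulrA -[d / k / 2]mulrAC ltr_pdivlMr// in st.
    by move: st; rewrite mulrC => st; lra.
  have -> : Q (rho'%:C%C * ei s) - Q (rho%:C%C * ei s) =
    (Q (rho'%:C%C * ei s) - Q (rho%:C%C * ei t)) - (Q (rho%:C%C * ei s) - Q (rho%:C%C * ei t)) by ring.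
  rewrite [e]splitr; apply: (le_trans (ncB _ _)); apply: lerD; apply: key => //.
  by rewrite subrr normr0 divr_gt0.
Qed.

(** The mean value property survives one exceptional point of continuity, since
    the means on either side of its circle are constant and agree in the limit. *)
Lemma circ_mean Q z0 R0 r : (forall z, nc z < R0 -> cont_at Q z) ->
  (forall z, nc z < R0 -> z != z0 -> cdiff Q z) -> 0 <= r < R0 ->
  circ Q r = (2 * pi)%:C%C * Q 0.
Proof.
move=> cQ dQ /andP[r0 rR].
have R00 : 0 < R0 by exact: le_lt_trans rR.
rewrite -circ0; last by apply: cQ; rewrite nc0.
have cc rho : rho < R0 -> cont_circle Q rho by move=> h z zr; apply: cQ; rewrite zr.
have lim x v : 0 <= x < R0 -> (forall d, 0 < d -> exists2 x', 0 <= x' < R0 & `|x' - x| < d /\ circ Q x' = v) ->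
    circ Q x = v.
  move=> /andP[x0 xR] h; apply/eqP; rewrite -subr_eq0 -nc_eq0 eq_le nc_ge0 andbT.
  apply/ler_addgt0Pr => e e0; rewrite add0r.
  have k0 : 0 < 2 * (2 * pi) :> R by rewrite mulr_gt0// pi2_gt0.
  have [d d0 hd] := circle_unif x0 (cc _ xR) (divr_gt0 e0 k0).
  have [x' /andP[x'0 x'R] [x'x <-]] := h d d0; rewrite ncC.
  have := circ_sub x'0 x0 (cc _ x'R) (cc _ xR) (hd _ x'x).
  by rewrite mulrAC mulrCA mulfV ?mulr1// gt_eqF.
have const a b : 0 < a -> a <= b -> b < R0 -> ~~ (a <= nc z0 <= b) -> circ Q a = circ Q b.
  move=> a0 ab bR nz; apply: circ_const => // z /andP[az zb]; apply: dQ.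
    exact: le_lt_trans bR.
  by apply: contraNneq nz => <-; rewrite az.
have low rho : 0 < rho -> rho < R0 -> rho < nc z0 -> circ Q rho = circ Q 0.
  move=> p0 pR pz; apply/esym/lim; first by rewrite lexx.
  move=> d d0; have m0 : 0 < Num.min rho (d / 2) by rewrite lt_min p0 divr_gt0.
  exists (Num.min rho (d / 2)); first by rewrite (ltW m0)/= gt_min pR.
  rewrite subr0 ger0_norm ?(ltW m0)//; split; first by rewrite gt_min; apply/orP; right; lra.
  by apply: const => //; rewrite ?ge_min ?lexx// negb_and -!ltNge pz orbT.
have mid : nc z0 < R0 -> circ Q (nc z0) = circ Q 0.
  move=> zR; have := nc_ge0 z0; rewrite le_eqVlt => /orP[/eqP<-//|z0_gt0].
  apply: lim; first by rewrite nc_ge0.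
  move=> d d0; have m0 : 0 < Num.min (nc z0 / 2) (d / 2) by rewrite lt_min !divr_gt0.
  set m := Num.min _ _ in m0.
  have m1 : m <= nc z0 / 2 by rewrite ge_min lexx.
  have m2 : m <= d / 2 by rewrite ge_min lexx orbT.
  exists (nc z0 - m); first by apply/andP; split; lra.
  split; first by rewrite ltr_norml; apply/andP; split; lra.
  by apply: low; lra.
case: (ltgtP r (nc z0)) => [rz|zr|rz].
- by move: r0; rewrite le_eqVlt => /orP[/eqP<-//|r0]; exact: low.
- rewrite -mid ?(lt_trans zr)//; apply/esym/lim; first by rewrite nc_ge0 (lt_trans zr).
  move=> d d0; have m0 : 0 < Num.min (r - nc z0) (d / 2) by rewrite lt_min subr_gt0 zr divr_gt0.
  set m := Num.min _ _ in m0.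
  have m1 : m <= r - nc z0 by rewrite ge_min lexx.
  have m2 : m <= d / 2 by rewrite ge_min lexx orbT.
  have z00 := nc_ge0 z0.
  exists (nc z0 + m); first by apply/andP; split; lra.
  split; first by rewrite ltr_norml; apply/andP; split; lra.
  by apply: const; [lra|lra|by []|rewrite negb_and -!ltNge; apply/orP; left; lra].
- by rewrite rz in rR *; exact: mid.
Qed.

Lemma cdiff_with_mul f g z a b : cdiff_with f z a -> cdiff_with g z b ->
  cdiff_with (fun z => f z * g z) z (a * g z + f z * b).
Proof.
move=> df dg e e0.
have cg : cont_at g z by apply: cdiff_cont; exists b.
pose k := nc (g z) + 1 + nc a + nc (f z).
have k0 : 0 < k by have := nc_ge0 (g z); have := nc_ge0 a; have := nc_ge0 (f z); rewrite /k; lra.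
have ek : 0 < e / k by rewrite divr_gt0.
have [d1 d10 h1] := df _ ek; have [d2 d20 h2] := dg _ ek.
have mk : 0 < Num.min 1 (e / k) by rewrite lt_min ltr01.
have [d3 d30 h3] := cg _ mk.
exists (Num.min d1 (Num.min d2 d3)); first by rewrite !lt_min d10 d20.
move=> h; rewrite !lt_min => /and3P[/h1 {}h1 /h2 {}h2 /h3]; rewrite le_min => /andP[h3' {}h3].
have -> : f (z + h) * g (z + h) - f z * g z - (a * g z + f z * b) * h =
  (f (z + h) - f z - a * h) * g (z + h) + a * h * (g (z + h) - g z)
  + f z * (g (z + h) - g z - b * h) by ring.
apply: (le_trans (ncD _ _)); apply: (le_trans (lerD (ncD _ _) (lexx _))).
rewrite !ncM.
have gz : nc (g (z + h)) <= nc (g z) + 1.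
  by rewrite -(subrK (g z) (g (z + h))) (le_trans (ncD _ _))// addrC lerD2l.
have -> : e * nc h = e / k * nc h * (nc (g z) + 1) + nc a * nc h * (e / k) + nc (f z) * (e / k * nc h).
  have ek' : e = e / k * k by rewrite divfK// gt_eqF.
  by rewrite {1}ek' {2}/k; ring.
apply: lerD; first apply: lerD.
- by apply: ler_pM; rewrite ?nc_ge0.
- by apply: ler_wpM2l; rewrite ?mulr_ge0 ?nc_ge0.
- by apply: ler_wpM2l; rewrite ?nc_ge0.
Qed.

Lemma cdiffM f g z : cdiff f z -> cdiff g z -> cdiff (fun z => f z * g z) z.
Proof. by move=> [a ha] [b hb]; eexists; exact: cdiff_with_mul ha hb. Qed.

Lemma cdiff_subV z0 z : z != z0 -> cdiff (fun z => (z - z0)^-1) z.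
Proof.
rewrite -subr_eq0 => w0; exists (- (z - z0) ^- 2) => e e0.
set w := z - z0 in w0 *; have nw : 0 < nc w by rewrite nc_gt0.
exists (Num.min (nc w / 2) (e * nc w ^+ 3 / 2)).
  by rewrite lt_min !divr_gt0// mulr_gt0// exprn_gt0.
move=> h; rewrite lt_min => /andP[h1 h2].
have wh : nc w / 2 <= nc (w + h).
  have : nc w <= nc (w + h) + nc h by have := ncB (w + h) h; rewrite addrK.
  by move=> ?; lra.
have wh0 : w + h != 0 by rewrite -nc_gt0 (lt_le_trans _ wh)// divr_gt0.
have -> : z + h - z0 = w + h by rewrite /w; ring.
have -> : (w + h)^-1 - w^-1 - - w ^- 2 * h = h * h / (w ^+ 2 * (w + h)).
  move: (w) w0 wh0 => v v0 vh0; by field; rewrite ?v0 ?vh0.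
rewrite !ncM ncV ncM ncX -!mulrA mulrC ler_wpM2r ?nc_ge0//.
have v0 : 0 < nc (w + h) by rewrite nc_gt0.
rewrite ler_pdivrMr; last by rewrite !mulr_gt0.
have : e * (nc w * (nc w * (nc w / 2))) <= e * (nc w * (nc w * nc (w + h))).
  by do 3!(apply: ler_wpM2l; first exact: ltW).
apply: le_trans; apply: (le_trans (ltW h2)).
by rewrite le_eqVlt; apply/orP; left; apply/eqP; field.
Qed.

Lemma cdiff_id z : cdiff (fun z => z) z.
Proof.
exists 1 => e e0; exists 1 => // h _.
by rewrite mul1r [z + h]addrC addrK subrr nc0 mulr_ge0 ?nc_ge0// ltW.
Qed.

Lemma cdiff_subc f z c : cdiff f z -> cdiff (fun z => f z - c) z.
Proof.
move=> [D hD]; exists D => e /hD[d d0 hd]; exists d => // h /hd.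
by rewrite opprB addrA subrK.
Qed.

Lemma cdiff_local f g z d : 0 < d -> (forall h, nc h < d -> f (z + h) = g (z + h)) ->
  cdiff g z -> cdiff f z.
Proof.
move=> d0 fg [D hD]; exists D => e /hD[d' d'0 hd]; exists (Num.min d d'); first by rewrite lt_min d0.
move=> h; rewrite lt_min => /andP[/fg -> /hd].
by have := fg 0; rewrite nc0 !addr0 => ->.
Qed.

End cauchy_taylor.
Section taylor.
Context {R : realType}.
Local Notation C := R[i].
Implicit Types (Q f : C -> C) (z h : C).

Lemma cdiff_invX z k : z != 0 -> cdiff (fun z => z^-1 ^+ k) z.
Proof.
move=> z0; elim: k => [|k IH].
  by exists 0 => e e0; exists 1 => // h _; rewrite !expr0 subrr mul0r subr0 nc0 mulr_ge0 ?nc_ge0 ?ltW.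
under eq_fun do rewrite exprS.
apply: cdiffM IH; have := cdiff_subV z0.
by under eq_fun do rewrite subr0.
Qed.

Definition taylor_coef f r k : C :=
  ((2 * pi)^-1)%:C%C * circ (fun z => f z * z^-1 ^+ k) r.

Lemma taylor_cont f r k : 0 < r -> (forall z, nc z = r -> cdiff f z) ->
  cont_circle (fun z => f z * z^-1 ^+ k) r.
Proof.
move=> r0 df z zr; apply: cdiff_cont; apply: cdiffM; first exact: df.
by apply: cdiff_invX; rewrite -nc_gt0 zr.
Qed.

Lemma taylor_coef_le f r B k : 0 < r -> (forall z, nc z = r -> cdiff f z) ->
  (forall t, 0 <= t <= 2 * pi -> nc (f (r%:C%C * ei t)) <= B) ->
  nc (taylor_coef f r k) <= 2 * B / r ^+ k.
Proof.
move=> r0 df hB; rewrite ncM nc_real ger0_norm ?invr_ge0 ?(ltW pi2_gt0)//.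
rewrite mulrC ler_pdivrMr ?pi2_gt0// -[2 * B / _]mulrA.
apply: circ_bound; [exact: ltW|exact: taylor_cont|move=> t ht].
rewrite ncM ncX ncV nc_polar ?(ltW r0)// exprVn ler_pM2r ?invr_gt0 ?exprn_gt0//.
exact: hB.
Qed.

Lemma i_neq0 : ('i%C : C) != 0.
Proof. by rewrite -nc_gt0 nc_def /= expr0n expr1n add0r sqrtr1. Qed.

(** The Cauchy kernel is expanded as a geometric series; the means of the negative
    powers over the circle vanish. *)
Lemma taylor_remainder f R0 r M : (forall z, nc z < R0 -> cdiff f z) -> 0 < r < R0 ->
  (forall t, 0 <= t <= 2 * pi -> nc (f (r%:C%C * ei t)) <= M) ->
  forall z N, nc z < r ->
  nc (f z - \sum_(k < N.+1) taylor_coef f r k * z ^+ k) <=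
    2 * ((nc z / r) ^+ N.+1 * ((M + nc (f z)) * (r / (r - nc z)))).
Proof.
move=> df /andP[r0 rR] fM z0 N zr.
have [D hD] : cdiff f z0 by apply: df; exact: lt_trans rR.
pose Q z := if z == z0 then z0 * D else z * (f z - f z0) * (z - z0)^-1.
have dQ z : nc z < R0 -> z != z0 -> cdiff Q z.
  move=> zR zz0.
  apply: (@cdiff_local _ _ (fun z => z * (f z - f z0) * (z - z0)^-1) _ (nc (z - z0))).
  - by rewrite nc_gt0 subr_eq0.
  - move=> h hh; rewrite /Q; case: eqP => // E; move: hh.
    by rewrite -E opprD addrA subrr sub0r ncN ltxx.
  - apply: cdiffM; last exact: cdiff_subV.
    apply: cdiffM; first exact: cdiff_id.
    by apply: cdiff_subc; exact: df.
have cQ z : nc z < R0 -> cont_at Q z.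
  move=> zR; have [->|] := eqVneq z z0; last by move=> /(dQ _ zR); exact: cdiff_cont.
  move=> e e0.
  pose k := nc z0 + nc D + 1.
  have k0 : 0 < k by have := nc_ge0 z0; have := nc_ge0 D; rewrite /k; lra.
  have mk : 0 < Num.min 1 (e / k) by rewrite lt_min ltr01 divr_gt0.
  have [d d0 hd] := hD _ mk.
  exists (Num.min d (e / k)); first by rewrite lt_min d0 divr_gt0.
  move=> h; rewrite lt_min => /andP[/hd {}hd hk].
  rewrite /Q eqxx; case: eqP => [_|/eqP]; first by rewrite subrr nc0 ltW.
  rewrite -subr_eq0 addrAC subrr add0r => h0.

  set q := (f (z0 + h) - f z0) * h^-1.
  have -> : (z0 + h) * (f (z0 + h) - f z0) / h - z0 * D = z0 * (q - D) + h * (q - D) + h * D.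
    by rewrite /q; ring.
  have qD : nc (q - D) <= Num.min 1 (e / k).
    have -> : q - D = (f (z0 + h) - f z0 - D * h) / h by rewrite /q; field.
    by rewrite ncM ncV ler_pdivrMr ?nc_gt0.
  move: qD; rewrite le_min => /andP[qD1 qD2].
  apply: (le_trans (ncD _ _)); apply: (le_trans (lerD (ncD _ _) (lexx _))); rewrite !ncM.
  have ek : e = e / k * nc z0 + e / k * 1 + e / k * nc D.
    by rewrite -!mulrDr addrAC -/k divfK// gt_eqF.
  rewrite [leRHS]ek; apply: lerD; first apply: lerD.
  - by rewrite mulrC ler_wpM2r// nc_ge0.
  - by apply: ler_pM; rewrite ?nc_ge0// ltW.
  - by rewrite ler_wpM2r ?nc_ge0// ltW.
have Q0 : Q 0 = 0 by rewrite /Q; case: eqP => [<-|_]; rewrite !mul0r.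
have mQ : circ Q r = 0.
  by rewrite (@circ_mean _ Q z0 R0) ?Q0 ?mulr0// ltW.
have rC : (r%:C%C : C) != 0 by rewrite -nc_gt0 nc_real normr_gt0 gt_eqF.
pose E k t : C := if k is 0%N then t%:C%C else
  (r^-1 ^+ k)%:C%C * - ((k%:R)%:C%C * 'i%C)^-1 * ei (- k%:R * t).
have EP k t : cder (E k) t ((r%:C%C * ei t)^-1 ^+ k).
  case: k => [|k]; first by rewrite expr0; exact: cder_id.
  have k0 : ((k.+1%:R)%:C%C : C) != 0 by rewrite -nc_gt0 nc_real normr_gt0 pnatr_eq0.
  have := cderZ ((r^-1 ^+ k.+1)%:C%C * - ((k.+1%:R)%:C%C * 'i%C)^-1) (cder_eiM (- k.+1%:R) t).
  congr cder.
  set K := (k.+1%:R)%:C%C in k0 *.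
  have hh : - (K * 'i%C)^-1 * ((- k.+1%:R)%:C%C * 'i%C) = 1.
    by rewrite rmorphN /= -/K [- K * _]mulNr mulrNN mulVf// mulf_neq0// i_neq0.
  have -> : (r%:C%C * ei t)^-1 ^+ k.+1 = (r^-1 ^+ k.+1)%:C%C * ei (- k.+1%:R * t).
    rewrite invfM exprMn ei_inv eiXn rmorphXn /= rmorphV ?unitfE ?gt_eqF//.
    by rewrite mulrN mulNr.
  set u := (_ ^+ _)%:C%C; set v := ei _; transitivity (u * 1 * v); last by rewrite mulr1.
  by rewrite -hh !mulrA.
pose A k := cprim (-1) (circ_fun (fun z => f z * z^-1 ^+ k) r).
have dfr z : nc z = r -> cdiff f z by move=> zr'; apply: df; rewrite zr'.
have AP k t : 0 <= t -> cder (A k) t (f (r%:C%C * ei t) * (r%:C%C * ei t)^-1 ^+ k).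
  by move=> t0; apply: circ_cprim => //; [exact: ltW|exact: taylor_cont].
pose G t := \sum_(k < N.+1) z0 ^+ k * (A k t - f z0 * E k t).
have cdersum (I : Type) (s : seq I) (F : I -> R -> C) (g : I -> C) t :
    (forall i, cder (F i) t (g i)) -> cder (fun t => \sum_(i <- s) F i t) t (\sum_(i <- s) g i).
  move=> hF; elim: s => [|i s IH].
    by under eq_fun do rewrite big_nil; rewrite big_nil; exact: cder_cst.
  by under eq_fun do rewrite big_cons; rewrite big_cons; apply: cderD.
have GP t : 0 <= t -> cder G t (\sum_(k < N.+1) z0 ^+ k *
    (f (r%:C%C * ei t) * (r%:C%C * ei t)^-1 ^+ k - f z0 * (r%:C%C * ei t)^-1 ^+ k)).
  move=> t0; apply: cdersum => i; apply: cderZ; apply: cderB; first exact: AP.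
  by apply: cderZ; exact: EP.
have piC : ((2 * pi)%:C%C : C) != 0 by rewrite -nc_gt0 nc_real normr_gt0 gt_eqF// pi2_gt0.
have GE : G (2 * pi) - G 0 =
    (2 * pi)%:C%C * ((\sum_(k < N.+1) taylor_coef f r k * z0 ^+ k) - f z0).
  rewrite /G -sumrB.
  transitivity (\sum_(k < N.+1) (z0 ^+ k * (A k (2 * pi) - A k 0)) -
     f z0 * \sum_(k < N.+1) (z0 ^+ k * (E k (2 * pi) - E k 0))).
    by rewrite mulr_sumr -sumrB; apply: eq_bigr => k _; ring.
  rewrite mulrBr; congr (_ - _).
    rewrite mulr_sumr; apply: eq_bigr => k _; rewrite /taylor_coef.
    rewrite rmorphV ?unitfE ?gt_eqF ?pi2_gt0//= /circ -/(A k) mulrA mulrA mulfV//.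
    by rewrite mul1r mulrC.
  rewrite big_ord_recl /= expr0 mul1r big1 ?addr0 ?rmorph0 ?subr0 1?[f z0 * _]mulrC//.
  move=> k _; rewrite /bump /= add1n /= mulr0 ei0.
  rewrite (_ : - k.+1%:R * (2 * pi) = - (k.+1%:R * (2 * pi))) ?mulNr// -ei_inv -eiXn ei2pi expr1n invr1.
  by rewrite subrr mulr0.
set x := (M + nc (f z0)) * (r / (r - nc z0)).
suff h : nc ((2 * pi)%:C%C * (f z0 - \sum_(k < N.+1) taylor_coef f r k * z0 ^+ k)) <=
    2 * ((nc z0 / r) ^+ N.+1 * x) * (2 * pi).
  move: h; rewrite ncM nc_real ger0_norm ?(ltW pi2_gt0)// mulrC ler_pM2r ?pi2_gt0//.
pose B := cprim (-1) (circ_fun Q r).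
have cQr : cont_circle Q r by move=> z zr'; apply: cQ; rewrite zr'.
have -> : (2 * pi)%:C%C * (f z0 - \sum_(k < N.+1) taylor_coef f r k * z0 ^+ k) =
   (B (2 * pi) - G (2 * pi)) - (B 0 - G 0).
  transitivity (circ Q r - (G (2 * pi) - G 0)); first by rewrite mQ GE; ring.
  by rewrite /circ -/B; ring.
rewrite -[X in _ <= _ * X]subr0.
apply: (@cder_mvt _ (fun t => B t - G t)); first exact: ltW pi2_gt0.
  by move=> t /andP[t0 _]; apply: cderB; [exact: circ_cprim (ltW r0) cQr t0|exact: GP].
move=> t t02; set w := r%:C%C * ei t.
have w0 : w != 0 by rewrite mulf_neq0// ei_neq0.
have nw : nc w = r by rewrite nc_polar// ltW.
have wz0 : w != z0 by apply: contraTneq zr => <-; rewrite nw ltxx.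
have wz0' : w - z0 != 0 by rewrite subr_eq0.
pose y := z0 * w^-1.
have -> : \sum_(k < N.+1) z0 ^+ k * (f w * w^-1 ^+ k - f z0 * w^-1 ^+ k) =
  (f w - f z0) * \sum_(k < N.+1) y ^+ k.
  by rewrite mulr_sumr; apply: eq_bigr => k _; rewrite exprMn; ring.
have geo : \sum_(k < N.+1) y ^+ k = (1 - y ^+ N.+1) * (w * (w - z0)^-1).
  have y1 : 1 - y != 0 by rewrite -(inj_eq (mulIf w0)) mulrBl mul1r /y divfK// mul0r.
  have -> : w * (w - z0)^-1 = (1 - y)^-1.
    by apply: (mulIf y1); rewrite mulVf// /y; field; rewrite w0.
  have := subrX1 y N.+1; rewrite -[y ^+ _ - 1]opprB -[y - 1]opprB mulNr => /oppr_inj ->.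
  by rewrite mulrAC mulfV// mul1r.
rewrite geo /Q (negbTE wz0).
have -> : w * (f w - f z0) / (w - z0) - (f w - f z0) * ((1 - y ^+ N.+1) * (w / (w - z0))) =
  y ^+ N.+1 * ((f w - f z0) * (w / (w - z0))) by ring.
rewrite ncM ncX [nc y]ncM ncV nw; apply: ler_wpM2l.
  by rewrite exprn_ge0// mulr_ge0 ?nc_ge0// invr_ge0 ltW.
rewrite 2!ncM ncV nw; apply: ler_pM; rewrite ?nc_ge0//.
- by rewrite mulr_ge0 ?invr_ge0 ?nc_ge0 ?(ltW r0).
- by apply: (le_trans (ncB _ _)); rewrite lerD2r; exact: fM.
- rewrite ler_wpM2l ?(ltW r0)// lef_pV2 ?posrE ?nc_gt0 ?subr_gt0//.
  by rewrite lerBlDr -nw -{1}(subrK z0 w); exact: ncD.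
Qed.

End taylor.

(** * Differentiability in several variables *)

Section row_differentiability.
Context {R : realType} (m : nat).
Local Notation C := R[i].
Implicit Types (z h : 'rV[C]_m) (F G : 'rV[C]_m -> C).

Lemma row_norm_le h s : 0 <= s -> (`|h| <= s%:C%C) = [forall k, nc (h 0 k) <= s].
Proof.
move=> s0; have sC : 0 <= (s%:C%C : C) by rewrite -[0]/(0%:C)%C lecR.
rewrite /Num.norm /= mx_normE.
have -> : s%:C%C = (NngNum sC)%:num by [].
rewrite num_le; apply/bigmax_leP/forallP => /=.
- by move=> [_ hb] k; have := hb (0, k) isT; rewrite -num_le /= normC_nc lecR.
- move=> hb; split; first by rewrite -num_le /=.
  by move=> [i k] _ /=; rewrite -num_le /= normC_nc lecR ord1.
Qed.

Definition rnorm h : R := Re `|h|.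

Lemma rnormE h : `|h| = (rnorm h)%:C%C.
Proof. by rewrite /rnorm RRe_real// ger0_real. Qed.

Lemma rnorm_ge0 h : 0 <= rnorm h.
Proof. by have := normr_ge0 h; rewrite rnormE -[0]/(0%:C)%C lecR. Qed.

Lemma rnorm_le h s : 0 <= s -> rnorm h <= s <-> forall k, nc (h 0 k) <= s.
Proof.
move=> s0; rewrite -lecR -rnormE row_norm_le//.
by split => [/forallP//|hk]; apply/forallP.
Qed.

Lemma nc_coord_le h k : nc (h 0 k) <= rnorm h.
Proof. by have /(rnorm_le h (rnorm_ge0 h)) := lexx (rnorm h); apply. Qed.

(** Fréchet differentiability in terms of real moduli. *)
Definition has_diff F z (l : 'I_m -> C) := forall e : R, 0 < e ->
  exists2 d : R, 0 < d & forall h, rnorm h < d ->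
    nc (F (z + h) - F z - \sum_k h 0 k * l k) <= e * rnorm h.

Definition rowlin (l : 'I_m -> C) h : C := \sum_k h 0 k * l k.

Fact rowlin_linear l : linear (rowlin l).
Proof.
move=> a u v; rewrite /rowlin scaler_sumr -big_split /=; apply: eq_bigr => k _.
by rewrite !mxE mulrDl -mulrA.
Qed.

HB.instance Definition _ l := @GRing.isLinear.Build C 'rV[C]_m C _ (rowlin l) (rowlin_linear l).

Lemma nc_rowlin l h s : (forall k, nc (h 0 k) <= s) -> nc (rowlin l h) <= s * \sum_k nc (l k).
Proof.
move=> hs; apply: (le_trans (nc_sum _ _ _)); rewrite mulr_sumr; apply: ler_sum => k _.
by rewrite ncM ler_wpM2r ?nc_ge0.
Qed.

Lemma rowlin_continuous l : continuous (rowlin l).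
Proof.
apply/linear_bounded_continuous/bounded_funP => r.
exists (r * (\sum_k nc (l k))%:C%C) => h hr; have r0 : 0 <= r by exact: le_trans hr.
rewrite -(RRe_real (ger0_real r0)) in hr *.
have r0' : 0 <= Re r by rewrite -ler0c RRe_real ?ger0_real.
rewrite normC_nc -rmorphM /= lecR; apply: nc_rowlin => k.
by move: hr; rewrite rnormE lecR => /(rnorm_le _ r0'); apply.
Qed.

Lemma gt0_real_complex (e : C) : 0 < e -> exists2 r : R, 0 < r & e = r%:C%C.
Proof.
by case: e => a b; rewrite ltcE /= => /andP[/eqP -> a0]; exists a.
Qed.

Lemma nbhs0_row (A : set 'rV[C]_m) : nbhs (0 : 'rV[C]_m) A <->
  exists2 d : R, 0 < d & forall h, rnorm h < d -> A h.
Proof.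
split.
- move=> /nbhs_ballP[e /= /gt0_real_complex[d d0 ->] hA]; exists d => // h hd.
  by apply: hA; rewrite mx_norm_ball /ball_ /= sub0r normrN rnormE ltcR.
- move=> [d d0 hA]; apply/nbhs_ballP; exists d%:C%C => /=; first by rewrite ltcR.
  by move=> h; rewrite mx_norm_ball /ball_ /= sub0r normrN rnormE ltcR; exact: hA.
Qed.

Lemma has_diffP F z : differentiable F z <-> exists l, has_diff F z l.
Proof.
split.
- move=> dF; exists (fun k => 'd F z (delta_mx 0 k)) => e e0.
  have /eqaddoP := diff_locally dF => /(_ e%:C%C); rewrite ltcR => /(_ e0)/nbhs0_row[d d0 hd].
  exists d => // h /hd; rewrite !fctE /= normC_nc rnormE -rmorphM /= lecR.
  rewrite [h + z]addrC opprD addrA; congr (nc (_ - _) <= _).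
  rewrite {1}(row_sum_delta h) linear_sum; apply: eq_bigr => k _; exact: linearZ.
- move=> [l hl].
  have E : F \o shift z = cst (F z) + rowlin l +o_ (0 : 'rV[C]_m) id.
    apply/eqaddoP => e /gt0_real_complex[r r0 ->]; apply/nbhs0_row.
    have [d d0 hd] := hl _ r0; exists d => // h /hd.
    by rewrite !fctE /= normC_nc rnormE -rmorphM /= lecR [h + z]addrC opprD addrA.
  have dE := diff_unique (@rowlin_continuous l) E.
  by apply/diff_locallyP; rewrite dE; split => //; exact: rowlin_continuous.
Qed.

(** On complex lines the one-variable theory applies. *)
Lemma line_cdiff F z h w : differentiable F (z + w *: h) ->
  cdiff (fun w => F (z + w *: h)) w.
Proof.
move=> /has_diffP[l hl]; exists (rowlin l h) => e e0.
pose k := rnorm h + 1; have k0 : 0 < k by rewrite ltr_wpDl ?rnorm_ge0.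
have [d d0 hd] := hl _ (divr_gt0 e0 k0).
exists (d / k); first by rewrite divr_gt0.
move=> v; rewrite ltr_pdivlMr// => vd.
have vh : rnorm (v *: h) <= nc v * k.
  apply/rnorm_le; first by rewrite mulr_ge0 ?nc_ge0 ?ltW.
  move=> i; rewrite mxE ncM ler_wpM2l ?nc_ge0//.
  by rewrite (le_trans (nc_coord_le _ _))// lerDl.
rewrite scalerDl addrA; have := hd (v *: h) (le_lt_trans vh vd).
rewrite -/(rowlin l (v *: h)) linearZ /=.
have -> : v *: rowlin l h = rowlin l h * v by exact: mulrC.
move=> /le_trans; apply.
apply: (le_trans (ler_wpM2l _ vh)); first by rewrite ltW// divr_gt0.
by rewrite mulrCA divfK ?gt_eqF// mulrC.
Qed.

Lemma differentiable_near F G z d : 0 < d ->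
  (forall h, rnorm h < d -> F (z + h) = G (z + h)) -> differentiable G z -> differentiable F z.
Proof.
move=> d0 FG /has_diffP[l hl]; apply/has_diffP; exists l => e /hl[d' d'0 hd].
exists (Num.min d d'); first by rewrite lt_min d0.
move=> h; rewrite lt_min => /andP[/FG -> /hd].
have := FG 0; rewrite addr0 => -> //.
by rewrite (le_lt_trans _ d0)//; apply/rnorm_le => // k; rewrite mxE nc0.
Qed.

Lemma rnorm_lt h s : 0 < s -> (forall k, nc (h 0 k) < s) -> rnorm h < s.
Proof.
move=> s0 hs.
suff [t [t0 ts] ht] : exists2 t, 0 <= t /\ t < s & forall k, nc (h 0 k) <= t.
  by apply: le_lt_trans ts; apply/rnorm_le.
exists (\big[Num.max/0]_k nc (h 0 k)); last by move=> k; apply/bigmax_geP; right; exists k.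
split; first by apply/bigmax_geP; left.
by apply/bigmax_ltP.
Qed.

End row_differentiability.

(** * Limits and the Cauchy estimates *)

Section weierstrass.
Context {R : realType}.
Local Notation C := R[i].

(** Convergence of a complex sequence in terms of real moduli. *)
Definition clim (u : nat -> C) (l : C) := forall e : R, 0 < e ->
  exists N : nat, forall n, (N <= n)%N -> nc (u n - l) <= e.

Definition ccauchy (u : nat -> C) := forall e : R, 0 < e ->
  exists N : nat, forall n p, (N <= n)%N -> (N <= p)%N -> nc (u n - u p) <= e.

Lemma real_cauchy (u : nat -> R) : (forall e : R, 0 < e ->
    exists N : nat, forall n p, (N <= n)%N -> (N <= p)%N -> `|u n - u p| <= e) ->
  exists l, forall e : R, 0 < e -> exists N : nat, forall n, (N <= n)%N -> `|u n - l| <= e.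
Proof.
move=> cu; have /cauchy_cvgP cvgu : cauchy (u @ \oo).
  apply: cauchy_exP => e /= e0; have e2 : 0 < e / 2 by rewrite divr_gt0.
  have [N hN] := cu _ e2; exists (u N); exists N => // n /= Nn.
  by rewrite /ball /= (le_lt_trans (hN _ _ _ _))//; lra.
exists (lim (u @ \oo)) => e e0; have /cvgrPdist_le /(_ e e0)[N _ hN] := cvgu.
by exists N => n Nn; rewrite distrC; apply: hN.
Qed.

Lemma ccauchy_lim u : ccauchy u -> exists l, clim u l.
Proof.
move=> cu; have [a ha] : exists l, forall e : R, 0 < e -> exists N : nat,
    forall n, (N <= n)%N -> `|Re (u n) - l| <= e.
  apply: real_cauchy => e /cu[N hN]; exists N => n p Nn Np.
  by rewrite -ReN -ReD; apply: (le_trans (nc_ge_Re _)); exact: hN.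
have [b hb] : exists l, forall e : R, 0 < e -> exists N : nat,
    forall n, (N <= n)%N -> `|Im (u n) - l| <= e.
  apply: real_cauchy => e /cu[N hN]; exists N => n p Nn Np.
  by rewrite -ImN -ImD; apply: (le_trans (nc_ge_Im _)); exact: hN.
exists (a +i* b)%C => e e0; have e2 : 0 < e / 2 by rewrite divr_gt0.
have [N1 h1] := ha _ e2; have [N2 h2] := hb _ e2.
exists (maxn N1 N2) => n; rewrite geq_max => /andP[/h1 {}h1 /h2 {}h2].
apply: (le_trans (nc_le_ReIm _)); rewrite ReD ImD ReN ImN /= [e]splitr.
exact: lerD.
Qed.

Lemma le_forall_eps (a b : R) : (forall e, 0 < e -> a <= b + e) -> a <= b.
Proof. by move=> h; apply/ler_addgt0Pr. Qed.

Lemma nc_forall_eps (a b : C) : (forall e, 0 < e -> nc (a - b) <= e) -> a = b.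
Proof.
move=> h; apply/eqP; rewrite -subr_eq0 -nc_eq0 eq_le nc_ge0 andbT.
by apply: le_forall_eps => e /h; rewrite add0r.
Qed.

Lemma clim_unique u a b : clim u a -> clim u b -> a = b.
Proof.
move=> ha hb; apply: nc_forall_eps => e e0; have e2 : 0 < e / 2 by rewrite divr_gt0.
have [N1 h1] := ha _ e2; have [N2 h2] := hb _ e2.
pose n := maxn N1 N2; rewrite [e]splitr.
apply: (le_trans (nc_tri _ (u n) _)); apply: lerD.
  by rewrite ncC; apply: h1; rewrite leq_maxl.
by apply: h2; rewrite leq_maxr.
Qed.

Lemma clim_le u a b (M : R) : clim u a -> (exists N, forall n, (N <= n)%N -> nc (u n - b) <= M) ->
  nc (a - b) <= M.
Proof.
move=> ha [N1 h1]; apply: le_forall_eps => e /ha[N2 h2]; pose n := maxn N1 N2.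
apply: (le_trans (nc_tri _ (u n) _)); rewrite addrC; apply: lerD.
  by apply: h1; rewrite leq_maxl.
by rewrite ncC; apply: h2; rewrite leq_maxr.
Qed.

Lemma climD u v a b : clim u a -> clim v b -> clim (fun n => u n + v n) (a + b).
Proof.
move=> ha hb e e0; have e2 : 0 < e / 2 by rewrite divr_gt0.
have [N1 h1] := ha _ e2; have [N2 h2] := hb _ e2.
exists (maxn N1 N2) => n; rewrite geq_max => /andP[/h1 {}h1 /h2 {}h2].
by rewrite opprD addrACA [e]splitr; apply: (le_trans (ncD _ _)); exact: lerD.
Qed.

Lemma clim_cst a : clim (fun=> a) a.
Proof. by move=> e e0; exists 0%N => n _; rewrite subrr nc0 ltW. Qed.

Lemma climZ c u a : clim u a -> clim (fun n => c * u n) (c * a).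
Proof.
move=> ha e e0; have k0 : 0 < nc c + 1 by rewrite ltr_wpDl ?nc_ge0.
have [N h] := ha _ (divr_gt0 e0 k0); exists N => n /h {}h.
rewrite -mulrBr ncM; apply: (@le_trans _ _ ((nc c + 1) * (e / (nc c + 1)))).
  by apply: ler_pM; rewrite ?nc_ge0// lerDl.
by rewrite mulrC divfK// gt_eqF.
Qed.

Lemma clim_sum (I : Type) (s : seq I) (P : pred I) (u : I -> nat -> C) (a : I -> C) :
  (forall i, P i -> clim (u i) (a i)) ->
  clim (fun n => \sum_(i <- s | P i) u i n) (\sum_(i <- s | P i) a i).
Proof.
move=> h; elim: s => [|i s IH].
  rewrite big_nil; under eq_fun do rewrite big_nil; exact: clim_cst.
rewrite big_cons; under eq_fun do rewrite big_cons.
by case: ifP => // Pi; apply: climD => //; exact: h.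
Qed.

Lemma clim_eq u v a : (forall n, u n = v n) -> clim u a -> clim v a.
Proof. by move=> uv h e /h[N hN]; exists N => n /hN; rewrite uv. Qed.

Lemma climN u a : clim u a -> clim (fun n => - u n) (- a).
Proof. by move=> ha e /ha[N hN]; exists N => n /hN; rewrite -opprD ncN. Qed.

Lemma climB u v a b : clim u a -> clim v b -> clim (fun n => u n - v n) (a - b).
Proof. by move=> ha hb; apply: climD ha _; exact: climN. Qed.

(** The derivative is the first Taylor coefficient, and the remainder follows
    from the bounds on the others. *)
Lemma schwarz_bounds (f : C -> C) R0 r M D : (forall w, nc w < R0 -> cdiff f w) -> 0 < r < R0 ->
  (forall w, nc w < R0 -> nc (f w) <= M) -> cdiff_with f 0 D ->
  nc D <= 2 * M / r /\
  forall w, nc w <= r / 2 -> nc (f w - f 0 - D * w) <= 8 * M * (nc w / r) ^+ 2.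
Proof.
move=> df /[dup] rR /andP[r0 rR'] fM hD.
have M0 : 0 <= M by rewrite (le_trans (nc_ge0 (f 0)))// fM// nc0 (lt_trans r0).
have fr t : 0 <= t <= 2 * pi -> nc (f (r%:C%C * ei t)) <= M.
  by move=> _; apply: fM; rewrite nc_polar// ltW.
have dfr z : nc z = r -> cdiff f z by move=> zr; apply: df; rewrite zr.
have rem := taylor_remainder df rR fr.
have a0 : taylor_coef f r 0 = f 0.
  apply/eqP; rewrite eq_sym -subr_eq0 -nc_eq0 eq_le nc_ge0 andbT.
  have := rem 0 0%N; rewrite nc0 => /(_ r0).
  by rewrite big_ord1 expr0 mulr1 mul0r expr1 mul0r mulr0.
have rem1 w : nc w <= r / 2 -> nc (f w - f 0 - taylor_coef f r 1 * w) <= 8 * M * (nc w / r) ^+ 2.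
  move=> wr; have wr' : nc w < r by rewrite (le_lt_trans wr)// ltr_pdivrMr// ltr_pMr// ltr1n.
  have := rem w 1%N wr'; rewrite big_ord_recr big_ord1 /= a0 expr0 mulr1 expr1 opprD addrA.
  move=> /le_trans; apply.
  have -> : 8 * M * (nc w / r) ^+ 2 = 2 * ((nc w / r) ^+ 2 * (2 * M * 2)) by ring.
  apply: ler_wpM2l => //; apply: ler_wpM2l.
    by rewrite exprn_ge0// divr_ge0 ?nc_ge0// ltW.
  apply: ler_pM.
  - by rewrite addr_ge0 ?nc_ge0.
  - by rewrite divr_ge0 ?subr_ge0 ?ltW.
  - by rewrite mulr_natl mulr2n lerD2l fM// (lt_trans wr').
  - by rewrite ler_pdivrMr ?subr_gt0//; lra.
have a1 : taylor_coef f r 1 = D.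
  apply: nc_forall_eps => e e0.
  have e2 : 0 < e / 2 by rewrite divr_gt0.
  have [d d0 hd] := hD _ e2.
  pose k := 8 * M / r ^+ 2 + 1.
  have k0 : 0 < k by rewrite ltr_wpDl// divr_ge0 ?exprn_ge0 ?mulr_ge0// ltW.
  pose t := Num.min (d / 2) (Num.min (r / 2) (e / 2 / k)).
  have t0 : 0 < t by rewrite !lt_min !divr_gt0.
  have t1 : t <= d / 2 by rewrite ge_min lexx.
  have t2 : t <= r / 2 by rewrite !ge_min lexx orbT.
  have t3 : t <= e / 2 / k by rewrite !ge_min lexx !orbT.
  have nt : nc t%:C%C = t by rewrite nc_real ger0_norm// ltW.
  have h1 := rem1 t%:C%C; rewrite nt in h1; have {}h1 := h1 t2.
  have h2 := hd t%:C%C; rewrite nt add0r in h2.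
  have {}h2 : nc (f t%:C%C - f 0 - D * t%:C%C) <= e / 2 * t by apply: h2; lra.
  have : nc ((taylor_coef f r 1 - D) * t%:C%C) <= e * t.
    have -> : (taylor_coef f r 1 - D) * t%:C%C = (f t%:C%C - f 0 - D * t%:C%C)
       - (f t%:C%C - f 0 - taylor_coef f r 1 * t%:C%C) by ring.
    apply: (le_trans (ncB _ _)); rewrite [e]splitr mulrDl; apply: lerD => //.
    apply: (le_trans h1); rewrite exprMn exprVn.
    have -> : 8 * M * (t ^+ 2 / r ^+ 2) = (8 * M / r ^+ 2 * t) * t.
      by rewrite expr2; field; rewrite gt_eqF.
    rewrite ler_wpM2r ?(ltW t0)//; apply: (@le_trans _ _ (k * (e / 2 / k))); last first.
      by rewrite mulrC divfK// gt_eqF.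
    apply: ler_pM => //; rewrite ?(ltW t0)//.
      by rewrite divr_ge0 ?exprn_ge0 ?mulr_ge0// ltW.
    by rewrite /k lerDl.
  by rewrite ncM nt ler_pM2r.
split; last by move=> w /rem1; rewrite a1.
by rewrite -a1 -[r in leRHS]expr1; apply: taylor_coef_le.
Qed.

Section several_variables.
Context (m : nat).
Implicit Types (z h : 'rV[C]_m) (F G : 'rV[C]_m -> C).

(** On each complex line the one-variable estimates apply, and they do not
    depend on the line. *)
Lemma cauchy_bounds F z l rho M : 0 < rho ->
  (forall h, rnorm h < rho -> differentiable F (z + h)) ->
  (forall h, rnorm h < rho -> nc (F (z + h)) <= M) -> has_diff F z l ->
  forall h, rnorm h <= rho / 4 ->
    nc (rowlin l h) <= 4 * M / rho * rnorm h /\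
    nc (F (z + h) - F z - rowlin l h) <= 8 * M / rho * rnorm h.
Proof.
move=> rho0 dF bF hl h hr.
have M0 : 0 <= M.
  have := bF 0; rewrite addr0 => bF0; rewrite (le_trans (nc_ge0 (F z)))// bF0//.
  by apply: rnorm_lt => // k; rewrite mxE nc0.
have := rnorm_ge0 h; rewrite le_eqVlt => /orP[/eqP s0|s0].
  have h0 : h = 0.
    apply/rowP => k; rewrite mxE; apply/eqP; rewrite -nc_eq0 eq_le nc_ge0 andbT.
    by have := nc_coord_le h k; rewrite -s0.
  by rewrite h0 linear0 addr0 subrr subrr nc0 !mulr_ge0 ?rnorm_ge0 ?invr_ge0// ?(ltW rho0)// mulr_ge0.
set s := rnorm h in s0 hr *.
have sw w : nc w < rho / s -> rnorm (w *: h) < rho.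
  rewrite ltr_pdivlMr// => ws; apply: le_lt_trans ws; apply/rnorm_le.
    by rewrite mulr_ge0 ?nc_ge0// ltW.
  by move=> k; rewrite mxE ncM ler_wpM2l ?nc_ge0// nc_coord_le.
pose f w := F (z + w *: h).
have r0 : 0 < rho / s by rewrite divr_gt0.
have rr : 0 < rho / s / 2 < rho / s.
  by rewrite divr_gt0//= ltr_pdivrMr// ltr_pMr// ltr1n.
have df : cdiff_with f 0 (rowlin l h).
  move=> e e0; have [d d0 hd] := hl _ (divr_gt0 e0 s0).
  exists (d / s); first by rewrite divr_gt0.
  move=> v; rewrite ltr_pdivlMr// => vd; rewrite /f add0r scale0r addr0.
  have vh : rnorm (v *: h) <= nc v * s.
    apply/rnorm_le; first by rewrite mulr_ge0 ?nc_ge0 ?ltW.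
    by move=> i; rewrite mxE ncM ler_wpM2l ?nc_ge0// nc_coord_le.
  have := hd (v *: h) (le_lt_trans vh vd).
  rewrite -/(rowlin l (v *: h)) linearZ /=.
  have -> : v *: rowlin l h = rowlin l h * v by exact: mulrC.
  move=> /le_trans; apply; apply: (le_trans (ler_wpM2l _ vh)); first by rewrite ltW// divr_gt0.
  by rewrite mulrCA divfK ?gt_eqF// mulrC.
have [] := @schwarz_bounds f (rho / s) (rho / s / 2) M (rowlin l h) _ rr _ df.
- by move=> w /sw /dF; exact: line_cdiff.
- by move=> w /sw /bF.
move=> b1 /(_ 1); rewrite nc1 mulr1 {1 2}/f scale1r scale0r addr0 => b2; split.
  apply: (le_trans b1); rewrite le_eqVlt; apply/orP; left; apply/eqP.
  by field; rewrite !gt_eqF.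
have s4 : 4 <= rho / s by rewrite ler_pdivlMr//; lra.
apply: (le_trans (b2 _)); first by rewrite ler_pdivlMr// ler_pdivlMr//; lra.
rewrite expr2 !mulrA.
have -> : 8 * M * 1 / (rho / s / 2) * 1 / (rho / s / 2) = 8 * M / rho * s * (4 / (rho / s)).
  by field; rewrite !gt_eqF.
rewrite -[leRHS]mulr1; apply: ler_wpM2l; last by rewrite ler_pdivrMr// mul1r.
by rewrite !mulr_ge0 ?invr_ge0 ?mulr_ge0// ltW.
Qed.

Lemma has_diffB F G z l k : has_diff F z l -> has_diff G z k ->
  has_diff (fun z => F z - G z) z (fun i => l i - k i).
Proof.
move=> hF hG e e0; have e2 : 0 < e / 2 by rewrite divr_gt0.
have [d1 d10 h1] := hF _ e2; have [d2 d20 h2] := hG _ e2.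
exists (Num.min d1 d2); first by rewrite lt_min d10.
move=> h; rewrite lt_min => /andP[/h1 {}h1 /h2 {}h2].
have -> : F (z + h) - G (z + h) - (F z - G z) - \sum_k0 h 0 k0 * (l k0 - k k0) =
  (F (z + h) - F z - \sum_k h 0 k * l k) - (G (z + h) - G z - \sum_i h 0 i * k i).
  rewrite (_ : \sum_k0 h 0 k0 * (l k0 - k k0) = \sum_k h 0 k * l k - \sum_i h 0 i * k i).
    by ring.
  by rewrite -sumrB; apply: eq_bigr => i _; rewrite mulrBr.
by apply: (le_trans (ncB _ _)); rewrite [e]splitr mulrDl; apply: lerD.
Qed.

(** Weierstrass: the Cauchy estimates make the differentials a Cauchy sequence. *)
Lemma weierstrass (Fn : nat -> 'rV[C]_m -> C) F z rho : 0 < rho ->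
  (forall n h, rnorm h < rho -> differentiable (Fn n) (z + h)) ->
  (forall e, 0 < e -> exists N : nat, forall n h, (N <= n)%N -> rnorm h < rho ->
     nc (Fn n (z + h) - F (z + h)) <= e) ->
  differentiable F z.
Proof.
move=> rho0 dF cF.
have r00 : rnorm (0 : 'rV[C]_m) < rho by apply: rnorm_lt => // k; rewrite mxE nc0.
have /choice[l hl] : forall n, exists l, has_diff (Fn n) z l.
  by move=> n; apply/has_diffP; have := dF n 0 r00; rewrite addr0.
have bnd n p e : (forall h, rnorm h < rho -> nc (Fn n (z + h) - Fn p (z + h)) <= e) ->
    forall h, rnorm h <= rho / 4 ->
    nc (rowlin (fun k => l n k - l p k) h) <= 4 * e / rho * rnorm h /\
    nc (Fn n (z + h) - Fn p (z + h) - (Fn n z - Fn p z) - rowlin (fun k => l n k - l p k) h)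
      <= 8 * e / rho * rnorm h.
  move=> be h hr.
  have dFnp h' : rnorm h' < rho -> differentiable (fun z => Fn n z - Fn p z) (z + h').
    by move=> hr'; apply: differentiableB; exact: dF.
  exact: (cauchy_bounds rho0 dFnp be (has_diffB (hl n) (hl p)) hr).
have cauchy k : ccauchy (fun n => l n k).
  move=> e e0; have e2 : 0 < e / 8 by rewrite divr_gt0.
  have [N hN] := cF _ (mulr_gt0 e2 rho0).
  exists N => n p Nn Np.
  have be h : rnorm h < rho -> nc (Fn n (z + h) - Fn p (z + h)) <= 2 * (e / 8 * rho).
    move=> hr; apply: (le_trans (nc_tri _ (F (z + h)) _)); rewrite mulr_natl mulr2n.
    by apply: lerD; [exact: hN|rewrite ncC; exact: hN].
  pose t : C := (rho / 4)%:C%C.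
  have nt : nc t = rho / 4 by rewrite nc_real ger0_norm// divr_ge0// ltW.
  pose h : 'rV[C]_m := t *: delta_mx 0 k.
  have hr : rnorm h <= rho / 4.
    apply/rnorm_le; first by rewrite divr_ge0// ltW.
    move=> i; rewrite !mxE; case: (_ && _); first by rewrite mulr1 nt.
    by rewrite mulr0 nc0 divr_ge0// ltW.
  have [+ _] := bnd n p _ be h hr.
  have -> : rowlin (fun k => l n k - l p k) h = t * (l n k - l p k).
    rewrite /rowlin (bigD1 k)//= !mxE !eqxx mulr1 big1 ?addr0// => i ik.
    by rewrite !mxE (negbTE ik) andbF mulr0 mul0r.
  rewrite ncM nt => hh.
  have : rho / 4 * nc (l n k - l p k) <= e * (rho / 4).
    apply: (le_trans hh); apply: (@le_trans _ _ (4 * (2 * (e / 8 * rho)) / rho * (rho / 4))).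
      by rewrite ler_wpM2l// divr_ge0 ?(ltW rho0)// !mulr_ge0// ltW.
    by rewrite le_eqVlt; apply/orP; left; apply/eqP; field; rewrite gt_eqF.
  by rewrite mulrC ler_pM2r// divr_gt0.
have /choice[L hL] : forall k, exists a, clim (fun n => l n k) a.
  by move=> k; exact: ccauchy_lim.
apply/has_diffP; exists L => e e0.
have e2 : 0 < e / 32 * rho by rewrite mulr_gt0// divr_gt0.
have [N hN] := cF _ e2.
have e4 : 0 < e / 2 by rewrite divr_gt0.
have [d d0 hd] := hl N _ e4.
exists (Num.min d (rho / 4)); first by rewrite lt_min d0 divr_gt0.
move=> h; rewrite lt_min => /andP[hd' hr].
rewrite -/(rowlin L h).
have hr4 : rnorm h < rho by rewrite (lt_trans hr)//; lra.
suff key : nc ((F (z + h) - F z - rowlin L h) - (Fn N (z + h) - Fn N z - rowlin (l N) h)) <= e / 2 * rnorm h.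
  rewrite -(subrK (Fn N (z + h) - Fn N z - rowlin (l N) h) (_ - _ - _)).
  by apply: (le_trans (ncD _ _)); rewrite [e]splitr mulrDl; apply: lerD => //; exact: hd.
have Fh h' : rnorm h' < rho -> clim (fun n => Fn n (z + h')) (F (z + h')).
  by move=> hr' a a0; have [N' hN'] := cF _ a0; exists N' => n Nn; exact: hN'.
have F0 : clim (fun n => Fn n z) (F z) by have := Fh 0 r00; rewrite addr0.
have Ll : clim (fun n => rowlin (l n) h) (rowlin L h).
  by apply: clim_sum => k _; apply: climZ; exact: hL.
have cl : clim (fun n => Fn n (z + h) - Fn n z - rowlin (l n) h) (F (z + h) - F z - rowlin L h).
  by apply: climB Ll; apply: climB F0; exact: Fh.
apply: (clim_le cl); exists N => n Nn.
have be h' : rnorm h' < rho -> nc (Fn n (z + h') - Fn N (z + h')) <= 2 * (e / 32 * rho).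
  move=> hr'; apply: (le_trans (nc_tri _ (F (z + h')) _)); rewrite mulr_natl mulr2n.
  by apply: lerD; [exact: hN|rewrite ncC; exact: hN].
have [_] := bnd n N _ be h (ltW hr).
have -> : rowlin (fun k => l n k - l N k) h = rowlin (l n) h - rowlin (l N) h.
  by rewrite /rowlin -sumrB; apply: eq_bigr => k _; rewrite mulrBr.
have -> : Fn n (z + h) - Fn N (z + h) - (Fn n z - Fn N z) - (rowlin (l n) h - rowlin (l N) h) =
  Fn n (z + h) - Fn n z - rowlin (l n) h - (Fn N (z + h) - Fn N z - rowlin (l N) h) by ring.
move=> /le_trans; apply; rewrite le_eqVlt; apply/orP; left; apply/eqP.
by field; rewrite gt_eqF.
Qed.

End several_variables.
End weierstrass.

(** * Compactness *)

Section subsequences.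
Context {R : realType}.
Local Notation C := R[i].

(** Bolzano-Weierstrass for countably many bounded complex sequences at once, from
    a cluster point in a product of segments. *)
Lemma diagonal_subsequence (u : nat -> nat -> C) (M : nat -> R) :
  (forall n k, nc (u n k) <= M k) ->
  exists2 phi : nat -> nat, {homo phi : m n / (m < n)%N} &
    exists l : nat -> C, forall k, clim (fun n => u (phi n) k) (l k).
Proof.
move=> uM.
pose T (i : nat * bool) : topologicalType := R.
pose A (i : nat * bool) : set (T i) := `[- M i.1, M i.1]%classic.
pose v n : prod_topology T := fun i => if i.2 then Im (u n i.1) else Re (u n i.1).
have cA := @tychonoff _ T A (fun i => @segment_compact R (- M i.1) (M i.1)).
have [|p [_ clp]] := cA (v @ \oo) _.
  exists 0%N => // n _ [k b]; rewrite /A /v /= in_itv /= -ler_norml.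
  by case: b; [apply: le_trans (nc_ge_Im _) _|apply: le_trans (nc_ge_Re _) _].
have near k N : exists n : nat, (N < n)%N /\ forall j, (j <= k)%N ->
    forall b, `|v n (j, b) - (p (j, b) : R)| < k.+1%:R^-1.
  pose B j : set (prod_topology T) := [set f | forall b, `|(f (j, b) : R) - (p (j, b) : R)| < k.+1%:R^-1].
  have nB j : nbhs p (B j).
    have e0 : 0 < (k.+1%:R^-1 : R) by rewrite invr_gt0.
    have nb b : nbhs p [set f : prod_topology T | `|(f (j, b) : R) - (p (j, b) : R)| < k.+1%:R^-1].
      have h : nbhs (p (j, b) : R) [set x : R | `|x - (p (j, b) : R)| < k.+1%:R^-1].
        by apply/nbhs_ballP; exists k.+1%:R^-1 => // x; rewrite /ball/= distrC.
      exact: (@proj_continuous _ T (j, b) p _ h).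
    by apply: (filterS _ (filterI (nb true) (nb false))) => f [h1 h2] [].
  have nBk k1 : nbhs p [set f | forall j, (j <= k1)%N -> B j f].
    elim: k1 => [|k' IH].
      by apply: (filterS _ (nB 0%N)) => f h j; rewrite leqn0 => /eqP->.
    apply: (filterS _ (filterI IH (nB k'.+1))) => f [h1 h2] j.
    by rewrite leq_eqVlt => /orP[/eqP->//|]; rewrite ltnS; exact: h1.
  have [] := clp (v @` [set n | (N < n)%N]) _ _ (nBk k).
    by exists N.+1 => // n /= Nn; exists n.
  move=> _ [[n Nn <-] h]; exists n; split => // j jk b; exact: h.
have /choice[next nextP] : forall kN : nat * nat, exists n : nat, (kN.2 < n)%N /\
    forall j, (j <= kN.1)%N -> forall b, `|v n (j, b) - (p (j, b) : R)| < kN.1.+1%:R^-1.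
  by move=> [k N]; exact: near.
pose phi := fix phi n := if n is n'.+1 then next (n, phi n') else next (0%N, 0%N).
have phiS n : (phi n < phi n.+1)%N by have [] := nextP (n.+1, phi n).
have phiP n j : (j <= n)%N -> forall b, `|v (phi n) (j, b) - (p (j, b) : R)| < n.+1%:R^-1.
  by case: n => [|n] jn b; [have [_ ->] := nextP (0%N, 0%N)|have [_ ->] := nextP (n.+1, phi n)].
exists phi; first exact: homo_ltn ltn_trans phiS.
exists (fun k => ((p (k, false) : R) +i* (p (k, true) : R))%C) => k e e0.
have e2 : 0 < e / 2 by rewrite divr_gt0.
have [N _ hN] := near_infty_natSinv_lt (PosNum e2).
exists (maxn k N) => n; rewrite geq_max => /andP[kn Nn].
apply: (le_trans (nc_le_ReIm _)); rewrite ReD ImD ReN ImN /= [e]splitr.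
have := hN n Nn => /= /ltW hn.
by apply: lerD; apply: le_trans hn; apply: ltW; [exact: (phiP n k kn false)|exact: (phiP n k kn true)].
Qed.

End subsequences.

Section polydisc_bounds.
Context {R : realType} (m : nat).
Local Notation C := R[i].
Implicit Types (z : 'rV[C]_m) (F : 'rV[C]_m -> C).

Lemma closed_polydisc_bounded F r :
  (forall z, (forall k, nc (z 0 k) <= r) -> differentiable F z) ->
  exists M, forall z, (forall k, nc (z 0 k) <= r) -> nc (F z) <= M.
Proof.
move=> dF; apply: contrapT => /forallNP nb.
have /choice[z zP] : forall n : nat, exists z, (forall k, nc (z 0 k) <= r) /\ n%:R < nc (F z).
  move=> n; have /existsNP[z /not_implyP[zr /negP]] := nb n%:R.
  by rewrite -ltNge => ?; exists z.
pose u n k := if insub k is Some i then z n 0 (i : 'I_m) else 0.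
have [|phi phi_mono [l lP]] := @diagonal_subsequence R u (fun=> Num.max r 0).
  move=> n k; rewrite /u le_max; case: insubP => [i _ _|_]; last by rewrite nc0 lexx orbT.
  by have [-> _] := zP n.
pose z0 : 'rV[C]_m := \row_i l i.
have zl i : clim (fun n => z (phi n) 0 i) (z0 0 i).
  rewrite mxE; apply: clim_eq (lP i) => n; rewrite /u.
  by rewrite insubT// => lt; congr (_ _ _); exact/val_inj.
have z0r k : nc (z0 0 k) <= r.
  have := clim_le (zl k) (b := 0) (M := r); rewrite subr0; apply; exists 0%N => n _.
  by rewrite subr0; have [-> _] := zP (phi n).
have [L hL] := (has_diffP F z0).1 (dF _ z0r).
have [d d0 hd] := hL 1 ltr01.
have /choice[N hN] : forall i, exists N : nat, forall n, (N <= n)%N -> nc (z (phi n) 0 i - z0 0 i) <= d / 2.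
  by move=> i; apply: zl; rewrite divr_gt0.
pose B := d + d * \sum_i nc (L i) + nc (F z0).
have phin n : (n <= phi n)%N by elim: n => // n IH; rewrite (leq_ltn_trans IH)// phi_mono.
pose n := maxn (Num.truncn B).+1 (\max_i N i).
have [_] := zP (phi n); apply/negP; rewrite -leNgt.
have hr : rnorm (z (phi n) - z0) < d.
  apply: rnorm_lt => // k; rewrite !mxE.
  have h := hN k n _; rewrite mxE in h; apply: (le_lt_trans (h _)); last by rewrite ltr_pdivrMr// ltr_pMr// ltr1n.
  by rewrite (leq_trans (leq_bigmax k))// leq_maxr.
have := hd _ hr; rewrite [z0 + _]addrC subrK mul1r => h1.
apply: (@le_trans _ _ B).
  have -> : F (z (phi n)) = (F (z (phi n)) - F z0 - rowlin L (z (phi n) - z0)) + rowlin L (z (phi n) - z0) + F z0 by ring.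
  apply: (le_trans (ncD _ _)); rewrite /B lerD2r; apply: (le_trans (ncD _ _)); apply: lerD.
    exact: le_trans h1 (ltW hr).
  by apply: nc_rowlin => k; apply: (le_trans (nc_coord_le _ _)); exact: ltW.
have B0 : 0 <= B by rewrite /B !addr_ge0 ?nc_ge0 ?(ltW d0)// mulr_ge0 ?(ltW d0)// sumr_ge0// => i _; exact: nc_ge0.
have /andP[_ /ltW/le_trans] := truncn_itv B0; apply.
by rewrite ler_nat (leq_trans _ (phin n))// leq_maxl.
Qed.

End polydisc_bounds.

(** * Taylor coefficients in one of the variables *)

Section roots_of_unity.
Context {R : realType}.
Local Notation C := R[i].

Lemma prim_root_exists n : (0 < n)%N -> exists w : C, n.-primitive_root w.
Proof.
move=> n0; have [rs prs] := closed_field_poly_normal ('X^n - 1 : {poly C}).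
have mon : ('X^n - 1 : {poly C}) \is monic by exact: monicXnsubC.
rewrite (monicP mon) scale1r in prs.
have urs : uniq rs.
  by rewrite -separable_prod_XsubC -prs separable_Xn_sub_1// pnatr_eq0 -lt0n.
have srs : size rs = n.
  by have := size_prod_XsubC rs id; rewrite -prs size_XnsubC// => -[].
have /hasP[w _ wP] : has n.-primitive_root rs.
  apply: has_prim_root => //; last by rewrite srs.
  by apply/allP => w; rewrite -root_prod_XsubC -prs; rewrite rootE !hornerE subr_eq0 unity_rootE.
by exists w.
Qed.

Lemma nc_prim_root n (w : C) : n.-primitive_root w -> nc w = 1.
Proof.
move=> pw; have n0 := prim_order_gt0 pw.
have := prim_expr_order pw => /(congr1 nc); rewrite ncX nc1 => /eqP.
by rewrite pexpr_eq1 ?nc_ge0// => /eqP.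
Qed.

Lemma sum_prim_root n (w : C) (k l : nat) : n.-primitive_root w -> (k < n)%N -> (l < n)%N ->
  \sum_(j < n) (w ^+ l / w ^+ k) ^+ j = if k == l then n%:R else 0.
Proof.
move=> pw kn ln; have w0 : w != 0 by rewrite -nc_gt0 (nc_prim_root pw).
case: eqP => [->|/eqP kl].
  by under eq_bigr do rewrite divff ?expf_neq0// expr1n; rewrite sumr_const card_ord.
set x := w ^+ l / w ^+ k.
have x1 : x - 1 != 0.
  rewrite subr_eq0; apply: contraNneq kl => xe.
  have : w ^+ k == w ^+ l by rewrite -[w ^+ k]mul1r -xe divfK// expf_neq0.
  by rewrite (eq_prim_root_expr pw) !modn_small.
apply: (mulfI x1); rewrite mulr0 -subrX1 /x exprMn exprVn -!exprM.
by rewrite [(l * n)%N]mulnC [(k * n)%N]mulnC !exprM (prim_expr_order pw) !expr1n invr1 mulr1 subrr.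
Qed.

(** On the powers of a primitive root of unity only the Taylor terms of degree
    congruent to [k] contribute, and those of higher degree are geometrically
    small. *)
Lemma average_error (f : C -> C) (s rho M : R) n k (w : C) :
  (forall z, nc z < 1 -> cdiff f z) -> 0 < s -> s < rho -> rho < 1 ->
  (forall z, nc z <= rho -> nc (f z) <= M) ->
  n.+1.-primitive_root w -> (k < n.+1)%N ->
  nc (n.+1%:R^-1 * \sum_(j < n.+1) f (s%:C%C * w ^+ j) * (s%:C%C * w ^+ j)^-1 ^+ k
      - taylor_coef f rho k)
    <= s^-1 ^+ k * (2 * ((s / rho) ^+ n.+1 * (2 * M * (rho / (rho - s))))).
Proof.
move=> df s0 sr r1 fM pw kn.
have r0 : 0 < rho by exact: lt_trans sr.
have sC : (s%:C%C : C) != 0 by rewrite -nc_gt0 nc_real normr_gt0 gt_eqF.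
have w0 : w != 0 by rewrite -nc_gt0 (nc_prim_root pw).
have nw j : nc (s%:C%C * w ^+ j) = s.
  by rewrite ncM ncX (nc_prim_root pw) expr1n mulr1 nc_real ger0_norm// ltW.
have n0 : (n.+1%:R : C) != 0 by rewrite pnatr_eq0.
pose a := taylor_coef f rho.
pose rem z := f z - \sum_(l < n.+1) a l * z ^+ l.
have fr z : nc z = s -> nc (rem z) <= 2 * ((s / rho) ^+ n.+1 * (2 * M * (rho / (rho - s)))).
  move=> zs; have := @taylor_remainder _ f 1 rho M df _ _ z n.
  rewrite zs => /(_ _ _ sr); rewrite r0 r1 => /(_ isT) h.
  apply: (le_trans (h _)).
    by move=> t _; apply: fM; rewrite nc_polar// ltW.
  rewrite ler_wpM2l// ler_wpM2l ?exprn_ge0 ?divr_ge0 ?(ltW s0) ?(ltW r0)//.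
  rewrite ler_wpM2r ?divr_ge0 ?subr_ge0 ?(ltW r0) ?(ltW sr)//.
  by rewrite mulr_natl mulr2n lerD2l fM// zs ltW.
have -> : n.+1%:R^-1 * \sum_(j < n.+1) f (s%:C%C * w ^+ j) * (s%:C%C * w ^+ j)^-1 ^+ k - a k
  = n.+1%:R^-1 * \sum_(j < n.+1) rem (s%:C%C * w ^+ j) * (s%:C%C * w ^+ j)^-1 ^+ k.
  have -> : a k = n.+1%:R^-1 * \sum_(j < n.+1)
      (\sum_(l < n.+1) a l * (s%:C%C * w ^+ j) ^+ l) * (s%:C%C * w ^+ j)^-1 ^+ k.
    under eq_bigr do rewrite mulr_suml.
    rewrite exchange_big /=.
    have E (l : 'I_n.+1) : \sum_(j < n.+1) a l * (s%:C%C * w ^+ j) ^+ l * (s%:C%C * w ^+ j)^-1 ^+ k =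
       a l * (s%:C%C ^+ l / s%:C%C ^+ k) * (if k == l then n.+1%:R else 0).
      rewrite -(sum_prim_root pw kn (ltn_ord l)) mulr_sumr; apply: eq_bigr => j _.
      rewrite !(exprVn, exprMn) -!exprM invfM -[(j * l)%N]mulnC -[(j * k)%N]mulnC.
      by ring.
    under eq_bigr do rewrite E.
    rewrite (bigD1 (Ordinal kn))//= eqxx big1 ?addr0; last first.
      move=> l lk; rewrite ifN ?mulr0//; apply: contraNneq lk => kl.
      by apply/eqP/val_inj.
    by rewrite divff ?expf_neq0// mulr1 mulrCA mulVf ?mulr1.
  by rewrite -mulrBr -sumrB; congr (_ * _); apply: eq_bigr => j _; rewrite -mulrBl.
rewrite ncM ncV.
have -> : nc (n.+1%:R : C) = n.+1%:R :> R.
  by rewrite -(rmorph_nat (real_complex R)) nc_real ger0_norm.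
rewrite ler_pdivrMl ?ltr0n//; apply: (le_trans (nc_sum _ _ _)).
set X := s^-1 ^+ k * _.
have -> : n.+1%:R * X = \sum_(j < n.+1) X by rewrite sumr_const card_ord mulr_natl.
apply: ler_sum => j _.
by rewrite ncM ncX ncV nw mulrC ler_wpM2l ?exprn_ge0 ?invr_ge0 ?(ltW s0)// fr.
Qed.

End roots_of_unity.

Section coefficient_functions.
Context {R : realType} (m : nat).
Local Notation C := R[i].
Implicit Types (z h : 'rV[C]_m) (F G : 'rV[C]_m -> C).

Definition in_polydisc (r : R) z := forall k, nc (z 0 k) <= r.

Definition hol F := forall z, (forall k, nc (z 0 k) < 1) -> differentiable F z.

(** A point of the open polydisc lies in a smaller closed one, which leaves
    room for a geometric domination. *)
Lemma polydisc_room z : (forall k, nc (z 0 k) < 1) -> exists2 r : R, 0 < r < 1 & in_polydisc r z.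
Proof.
move=> hz; have h1 : rnorm z < 1 by exact: rnorm_lt.
have h0 := rnorm_ge0 z; exists ((1 + rnorm z) / 2); first by apply/andP; split; lra.
by move=> k; apply: (le_trans (nc_coord_le _ _)); lra.
Qed.

Definition upd z i w : 'rV[C]_m := \row_j (if j == i then w else z 0 j).

Lemma updE z i w : upd z i w = upd z i 0 + w *: delta_mx 0 i.
Proof.
apply/rowP => j; rewrite !mxE eqxx; case: eqP => _; first by rewrite add0r mulr1.
by rewrite mulr0 addr0.
Qed.

Lemma upd_id z i : upd z i (z 0 i) = z.
Proof. by apply/rowP => j; rewrite mxE; case: eqP => [->|]. Qed.

Lemma upd_upd z i v w : upd (upd z i v) i w = upd z i w.
Proof. by apply/rowP => j; rewrite !mxE; case: eqP. Qed.

Lemma updC z i j v w : i != j -> upd (upd z i v) j w = upd (upd z j w) i v.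
Proof.
move=> ij; apply/rowP => k; rewrite !mxE; case: (k =P j) => [->|//].
by rewrite eq_sym (negbTE ij).
Qed.

Lemma upd_polydisc z i w r : in_polydisc r z -> nc w <= r -> in_polydisc r (upd z i w).
Proof. by move=> hz hw k; rewrite mxE; case: eqP. Qed.

Lemma upd_lt1 z i w : (forall k, nc (z 0 k) < 1) -> nc w < 1 -> forall k, nc (upd z i w 0 k) < 1.
Proof. by move=> hz hw k; rewrite mxE; case: eqP. Qed.

Lemma slice_cdiff F z i w : hol F -> (forall k, nc (z 0 k) < 1) -> nc w < 1 ->
  cdiff (fun w => F (upd z i w)) w.
Proof.
move=> hF hz hw; under eq_fun do rewrite updE; apply: line_cdiff.
by rewrite -updE; apply: hF; exact: upd_lt1.
Qed.

Lemma upd_differentiable F z i w : differentiable F (upd z i w) ->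
  differentiable (fun z => F (upd z i w)) z.
Proof.
move=> /has_diffP[l hl]; apply/has_diffP.
exists (fun k => if k == i then 0 else l k) => e e0.
have [d d0 hd] := hl e e0; exists d => // h hr.
have E : upd (z + h) i w = upd z i w + upd h i 0.
  by apply/rowP => j; rewrite !mxE; case: eqP => // _; rewrite addr0.
have hu : rnorm (upd h i 0) <= rnorm h.
  apply/rnorm_le; first exact: rnorm_ge0.
  by move=> k; rewrite mxE; case: eqP => _; rewrite ?nc0 ?rnorm_ge0// nc_coord_le.
have := hd _ (le_lt_trans hu hr); rewrite E.
rewrite (eq_bigr (fun k => h 0 k * (if k == i then 0 else l k))).
  by move=> /le_trans; apply; rewrite ler_wpM2l// ltW.
by move=> k _; rewrite mxE; case: eqP; rewrite ?mul0r ?mulr0.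
Qed.

(** The [k]-th Taylor coefficient in the variable of index [i], as a function of
    the other variables. *)
Definition coefA i k F z : C := taylor_coef (fun w => F (upd z i w)) (1 / 2) k.

Lemma taylor_coef_indep (f : C -> C) k r1 r2 : (forall w, nc w < 1 -> cdiff f w) ->
  0 < r1 < 1 -> 0 < r2 < 1 -> taylor_coef f r1 k = taylor_coef f r2 k.
Proof.
move=> df; wlog r12 : r1 r2 / r1 <= r2.
  by move=> H h1 h2; case: (leP r1 r2) => [/H->//|/ltW /H->].
move=> /andP[r10 _] /andP[r20 r21]; rewrite /taylor_coef (@circ_const _ _ r1 r2)// => z /andP[z1 z2]; apply: cdiffM.
  by apply: df; exact: le_lt_trans r21.
by apply: cdiff_invX; rewrite -nc_gt0; exact: lt_le_trans z1.
Qed.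

Lemma coefAE i k F z r : hol F -> (forall j, nc (z 0 j) < 1) -> 0 < r < 1 ->
  coefA i k F z = taylor_coef (fun w => F (upd z i w)) r k.
Proof.
move=> hF hz hr; apply: taylor_coef_indep => //; first by move=> w; exact: slice_cdiff.
by rewrite divr_gt0//= ltr_pdivrMr// mul1r ltr1n.
Qed.

Lemma polydisc_lt1 z r : r < 1 -> in_polydisc r z -> forall k, nc (z 0 k) < 1.
Proof. by move=> r1 hz k; exact: le_lt_trans r1. Qed.

Lemma coefA_le i k F z (r M : R) : hol F -> 0 < r < 1 ->
  (forall z, in_polydisc r z -> nc (F z) <= M) -> in_polydisc r z ->
  nc (coefA i k F z) <= 2 * M / r ^+ k.
Proof.
move=> hF /[dup] rr /andP[r0 r1] hM hz; have hz1 := polydisc_lt1 r1 hz.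
rewrite (coefAE _ _ hF hz1 rr); apply: taylor_coef_le => //.
  by move=> w wr; apply: slice_cdiff => //; rewrite wr.
by move=> t _; apply: hM; apply: upd_polydisc => //; rewrite nc_polar// ltW.
Qed.

Lemma coefA_remainder i F z (r rho M : R) N : hol F -> 0 < r -> r < rho -> rho < 1 ->
  (forall z, in_polydisc rho z -> nc (F z) <= M) -> in_polydisc r z ->
  nc (F z - \sum_(k < N.+1) coefA i k F z * z 0 i ^+ k) <=
    (r / rho) ^+ N.+1 * (4 * M * (rho / (rho - r))).
Proof.
move=> hF r0 rr r1 hM hz.
have rho0 : 0 < rho by exact: lt_trans rr.
have hz1 := polydisc_lt1 (lt_trans rr r1) hz.
have hzr : in_polydisc rho z by move=> k; apply: (le_trans (hz k)); exact: ltW.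
have rr1 : 0 < rho < 1 by rewrite rho0.
have df w : nc w < 1 -> cdiff (fun w => F (upd z i w)) w by exact: slice_cdiff.
have zr : nc (z 0 i) < rho by exact: le_lt_trans rr.
have bt t : 0 <= t <= 2 * pi -> nc (F (upd z i (rho%:C%C * ei t))) <= M.
  by move=> _; apply: hM; apply: upd_polydisc => //; rewrite nc_polar// ltW.
have -> : \sum_(k < N.+1) coefA i k F z * z 0 i ^+ k =
    \sum_(k < N.+1) taylor_coef (fun w => F (upd z i w)) rho k * z 0 i ^+ k.
  by apply: eq_bigr => k _; rewrite (coefAE i k hF hz1 rr1).
have := taylor_remainder df rr1 bt N zr; rewrite upd_id => /le_trans; apply.
have -> : (r / rho) ^+ N.+1 * (4 * M * (rho / (rho - r))) =
  2 * ((r / rho) ^+ N.+1 * ((2 * M) * (rho / (rho - r)))) by ring.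
have M0 : 0 <= M by exact: le_trans (nc_ge0 _) (hM z hzr).
apply: ler_wpM2l => //; apply: ler_pM.
- by rewrite exprn_ge0// divr_ge0 ?nc_ge0// ltW.
- by rewrite mulr_ge0 ?addr_ge0 ?nc_ge0// divr_ge0 ?subr_ge0// ltW.
- rewrite ler_pXn2r// ?nnegrE ?divr_ge0 ?nc_ge0 ?(ltW rho0) ?(ltW r0)//.
  by rewrite ler_pM2r ?invr_gt0.
- apply: ler_pM.
  + by rewrite addr_ge0 ?nc_ge0.
  + by rewrite divr_ge0 ?subr_ge0// ltW.
  + by rewrite mulr_natl mulr2n lerD2l hM.
  + rewrite ler_pM2l// lef_pV2 ?posrE ?subr_gt0//.
    by rewrite lerD2l lerN2.
Qed.

Lemma hol_bounded F r : r < 1 -> hol F ->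
  exists2 M : R, 0 <= M & forall z, in_polydisc r z -> nc (F z) <= M.
Proof.
move=> r1 hF; have [M hM] := @closed_polydisc_bounded R m F r (fun z hz => hF z (polydisc_lt1 r1 hz)).
exists (Num.max M 0); first by rewrite le_max lexx orbT.
by move=> z /hM h; rewrite le_max h.
Qed.

(** Averages over roots of unity are finite sums of differentiable functions and
    converge to the coefficient locally uniformly. *)
Lemma hol_coefA i k F : hol F -> hol (coefA i k F).
Proof.
move=> hF z /polydisc_room[r1 /andP[r10 r11] hz].
pose rho := (1 + r1) / 2.
have rho1 : rho < 1 by rewrite /rho; lra.
have rho_r1 : r1 < rho by rewrite /rho; lra.
have rho0 : 0 < rho by rewrite /rho; lra.
pose s := rho / 2.
have s0 : 0 < s by rewrite divr_gt0.
have sr : s < rho by rewrite /s; lra.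
have [M M0 hM] := hol_bounded rho1 hF.
have /choice[w wP] : forall n : nat, exists w : C, n.+1.-primitive_root w.
  by move=> n; exact: prim_root_exists.
pose avg n z := n.+1%:R^-1 * \sum_(j < n.+1) F (upd z i (s%:C%C * w n ^+ j)) * (s%:C%C * w n ^+ j)^-1 ^+ k.
have inr h : rnorm h < rho - r1 -> in_polydisc rho (z + h).
  move=> hr j; rewrite mxE; apply: (le_trans (ncD _ _)).
  by have := nc_coord_le h j; have := hz j; lra.
apply: (@weierstrass _ _ avg _ _ (rho - r1)); first by rewrite subr_gt0.
- move=> n h hr.
  have dj (j : 'I_n.+1) : differentiable (fun z => F (upd z i (s%:C%C * w n ^+ j)) *
      (s%:C%C * w n ^+ j)^-1 ^+ k) (z + h).
    apply: differentiableM; last exact: differentiable_cst.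
    apply: upd_differentiable; apply: hF; apply: upd_lt1.
      exact: polydisc_lt1 (inr _ hr).
    rewrite ncM ncX (nc_prim_root (wP n)) expr1n mulr1 nc_real ger0_norm ?(ltW s0)//.
    by rewrite (lt_trans sr).
  have := differentiable_sum dj; rewrite fct_sumE => /(differentiableZ (n.+1%:R^-1)).
  exact.
- move=> e e0.
  pose K := s^-1 ^+ k * (2 * (2 * M * (rho / (rho - s)))).
  have K0 : 0 <= K.
    apply: mulr_ge0; first by rewrite exprn_ge0 // invr_ge0 ltW.
    apply: mulr_ge0 => //; apply: mulr_ge0; first exact: mulr_ge0.
    by rewrite divr_ge0 ?subr_ge0 ?(ltW rho0) ?(ltW sr).
  have : (1 / 2 : R) ^+ n @[n --> \oo] --> (0 : R).
    by apply: cvg_expr; rewrite ger0_norm ?divr_ge0// ltr_pdivrMr// mul1r ltr1n.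
  have eK : 0 < e / (K + 1) by rewrite divr_gt0// ltr_wpDl.
  move=> /cvgrPdist_le /(_ _ eK)[N _ hN].
  exists (maxn N k) => n h; rewrite geq_max => /andP[Nn kn] hr.
  have hzh := inr _ hr; have hz1 := polydisc_lt1 rho1 hzh.
  rewrite (coefAE i k hF hz1 (_ : 0 < rho < 1)); last by rewrite rho0.
  have bF v : nc v <= rho -> nc (F (upd (z + h) i v)) <= M.
    by move=> vr; apply: hM; exact: upd_polydisc.
  have df v : nc v < 1 -> cdiff (fun v => F (upd (z + h) i v)) v by exact: slice_cdiff.
  have := average_error df s0 sr rho1 bF (wP n) kn.
  move=> /le_trans; apply.
  have -> : s / rho = 1 / 2 by rewrite /s; field; rewrite gt_eqF.
  have := hN n.+1 (leqW Nn); rewrite sub0r normrN ger0_norm ?exprn_ge0 ?divr_ge0// => hn.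
  have -> : s^-1 ^+ k * (2 * ((1 / 2) ^+ n.+1 * (2 * M * (rho / (rho - s))))) = (1 / 2) ^+ n.+1 * K.
    by rewrite /K; ring.
  apply: (@le_trans _ _ (e / (K + 1) * (K + 1))); last by rewrite divfK// gt_eqF// ltr_wpDl.
  by apply: ler_pM => //; rewrite ?exprn_ge0 ?divr_ge0// lerDl.
Qed.

Lemma coefA_upd i k F z w : coefA i k F (upd z i w) = coefA i k F z.
Proof. by rewrite /coefA; under eq_fun do rewrite upd_upd. Qed.

Lemma coefA_indep i j k F : (forall z w, F (upd z i w) = F z) ->
  forall z w, coefA j k F (upd z i w) = coefA j k F z.
Proof.
move=> h z w; have [->|ij] := eqVneq i j; first exact: coefA_upd.
by rewrite /coefA; under eq_fun do rewrite updC// h.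
Qed.

End coefficient_functions.

(** * Sums over boxes of multi-indices *)

Section box_sums.
Context {m : nat}.
Implicit Types (a : 'I_m -> nat).

(** Series over multi-indices are taken as limits over boxes, over which
    products of one-variable families factor. *)
Definition boxsum (V : nmodType) N (g : ('I_m -> nat) -> V) : V :=
  \sum_(b : {ffun 'I_m -> 'I_N.+1}) g (fun i => b i).

Definition degree a := (\sum_i a i)%N.

Lemma boxsum_widen (V : nmodType) N N' (g : ('I_m -> nat) -> V) : (N <= N')%N ->
  boxsum N g = \sum_(b : {ffun 'I_m -> 'I_N'.+1} | [forall i, (b i <= N)%N]) g (fun i => b i).
Proof.
move=> NN; rewrite /boxsum; have NN1 : (N.+1 <= N'.+1)%N by [].
pose h (b : {ffun 'I_m -> 'I_N.+1}) : {ffun 'I_m -> 'I_N'.+1} := [ffun i => widen_ord NN1 (b i)].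
pose k (b : {ffun 'I_m -> 'I_N'.+1}) : {ffun 'I_m -> 'I_N.+1} := [ffun i => inord (b i)].
rewrite [RHS](reindex_onto h k) /=.
  apply: eq_big => [b|b _]; last by congr g; apply/funext => i; rewrite ffunE.
  apply/esym/andP; split; first by apply/forallP => i; rewrite ffunE /= -ltnS.
  by apply/eqP/ffunP => i; rewrite !ffunE; apply/val_inj; rewrite /= inordK.
move=> b /forallP hb; apply/ffunP => i; rewrite !ffunE; apply/val_inj => /=.
by rewrite inordK// ltnS.
Qed.

Lemma boxsum_tail {R : realType} N N' (g : ('I_m -> nat) -> R[i]) (gb : ('I_m -> nat) -> R) :
  (N <= N')%N -> (forall a, nc (g a) <= gb a) ->
  nc (boxsum N' g - boxsum N g) <= boxsum N' gb - boxsum N gb.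
Proof.
move=> NN hg; rewrite !(boxsum_widen _ NN) /boxsum.
rewrite (bigID [pred b : {ffun 'I_m -> 'I_N'.+1} | [forall i, (b i <= N)%N]]) /=.
rewrite [in leRHS](bigID [pred b : {ffun 'I_m -> 'I_N'.+1} | [forall i, (b i <= N)%N]]) /=.
rewrite addrAC subrr add0r addrAC subrr add0r.
by apply: (le_trans (nc_sum _ _ _)); apply: ler_sum.
Qed.

Lemma boxsum_prod (R : comPzRingType) N (f : 'I_m -> nat -> R) :
  boxsum N (fun a => \prod_i f i (a i)) = \prod_i \sum_(k < N.+1) f i k.
Proof. by rewrite bigA_distr_bigA. Qed.

Lemma boxsumZ (R : pzRingType) N (c : R) g : boxsum N (fun a => c * g a) = c * boxsum N g.
Proof. by rewrite /boxsum mulr_sumr. Qed.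

Lemma expr_degree (R : comPzRingType) (x : R) a : x ^+ degree a = \prod_i x ^+ a i.
Proof. by rewrite /degree expr_sum. Qed.

Lemma geometric_le {R : realType} (q : R) N : 0 <= q -> q < 1 ->
  \sum_(k < N) q ^+ k <= (1 - q)^-1.
Proof.
move=> q0 q1; have h : 0 < 1 - q by rewrite subr_gt0.
rewrite -[leRHS]mul1r ler_pdivlMr// mulrC.
have := subrX1 q N; rewrite -[q ^+ N - 1]opprB -[q - 1]opprB mulNr => /oppr_inj <-.
by rewrite gerBl exprn_ge0.
Qed.

(** The box sums factor into one-variable geometric sums. *)
Lemma boxsum_geometric_cauchy {R : realType} (q e : R) : 0 <= q -> q < 1 -> 0 < e ->
  exists N, forall n p, (N <= n)%N -> (n <= p)%N ->
    boxsum p (fun a => q ^+ degree a) - boxsum n (fun a => q ^+ degree a) <= e.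
Proof.
move=> q0 q1 e0; pose G n : R := boxsum n (fun a => q ^+ degree a).
have GE n : G n = (\sum_(k < n.+1) q ^+ k) ^+ m.
  rewrite /G; transitivity (boxsum n (fun a => \prod_i q ^+ a i)); last first.
    by rewrite (boxsum_prod n (fun _ k => q ^+ k)) prodr_const card_ord.
  by apply: eq_bigr => b _; rewrite expr_degree.
have Gm : nondecreasing_seq G.
  move=> n p np; rewrite /G [leLHS](boxsum_widen _ np) [leRHS]/boxsum.
  rewrite [leRHS](bigID [pred b : {ffun 'I_m -> 'I_p.+1} | [forall i, (b i <= n)%N]]) /=.
  by rewrite lerDl sumr_ge0// => b _; rewrite exprn_ge0.
have Gb n : G n <= (1 - q)^-1 ^+ m.
  rewrite GE lerXn2r ?nnegrE ?invr_ge0 ?subr_ge0 ?(ltW q1)//.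
    by apply: sumr_ge0 => k _; rewrite exprn_ge0.
  exact: geometric_le.
have cG : cvgn G.
  by apply: nondecreasing_is_cvgn => //; exists ((1 - q)^-1 ^+ m) => _ [n _ <-].
have /cvgrPdist_le /(_ e e0)[N _ hN] := cG.
exists N => n p Nn np; have := hN n Nn.
have Gl : G p <= limn G by exact: nondecreasing_cvgn_le.
by rewrite /= -/(G p) -/(G n) => /(le_trans (ler_norm _)); lra.
Qed.

End box_sums.

Section box_limits.
Context {R : realType} {m : nat}.
Local Notation C := R[i].
Implicit Types (a : 'I_m -> nat) (g : ('I_m -> nat) -> C).

Definition boxlim g : C := get (clim (fun N => boxsum N g)).

(** The tails are compared with those of the geometric series, so that the
    rank depends only on the domination. *)
Lemma boxlim_unif (K q e : R) : 0 <= q -> q < 1 -> 0 < e -> exists N, forall g,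
  (forall a, nc (g a) <= K * q ^+ degree a) ->
  forall n, (N <= n)%N -> nc (boxsum n g - boxlim g) <= e.
Proof.
move=> q0 q1 e0.
have tail (d : R) : 0 < d -> exists N, forall g, (forall a, nc (g a) <= K * q ^+ degree a) ->
    forall n p, (N <= n)%N -> (N <= p)%N -> nc (boxsum n g - boxsum p g) <= d.
  move=> d0; have k0 : 0 < `|K| + 1 by rewrite ltr_wpDl.
  have [N hN] := @boxsum_geometric_cauchy m R q _ q0 q1 (divr_gt0 d0 k0).
  exists N => g hg.
  suff H n p : (N <= n)%N -> (n <= p)%N -> nc (boxsum p g - boxsum n g) <= d.
    move=> n p Nn Np; case: (leqP n p) => [np|/ltnW pn]; last exact: H.
    by rewrite ncC; exact: H.
  move=> Nn np; apply: (le_trans (boxsum_tail np (gb := fun a => (`|K| + 1) * q ^+ degree a) _)).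
    move=> a; apply: (le_trans (hg a)); rewrite ler_wpM2r ?exprn_ge0//.
    by apply: (le_trans (ler_norm K)); rewrite lerDl.
  rewrite !boxsumZ -mulrBr; apply: (le_trans (ler_wpM2l (ltW k0) (hN _ _ Nn np))).
  by rewrite mulrC divfK// gt_eqF.
have [N hN] := tail e e0; exists N => g hg n Nn.
have cg : ccauchy (fun N => boxsum N g).
  by move=> d /tail[N' hN']; exists N' => n' p' *; exact: hN'.
have lg : clim (fun N => boxsum N g) (boxlim g).
  by have [l hl] := ccauchy_lim cg; apply: (@getPex _ (clim (fun N => boxsum N g))); exists l.
rewrite ncC; apply: (clim_le lg); exists N => p Np; exact: hN.
Qed.

Lemma boxlimP g (K q : R) : 0 <= q -> q < 1 -> (forall a, nc (g a) <= K * q ^+ degree a) ->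
  clim (fun N => boxsum N g) (boxlim g).
Proof.
move=> q0 q1 hg e e0; have [N hN] := @boxlim_unif K q e q0 q1 e0.
by exists N => n Nn; exact: hN.
Qed.

(** By [weierstrass], since the box sums converge uniformly near the point. *)
Lemma boxlim_differentiable p (g : ('I_m -> nat) -> 'rV[C]_p -> C) z (rho K q : R) :
  0 < rho -> 0 <= q -> q < 1 ->
  (forall a h, rnorm h < rho -> differentiable (g a) (z + h)) ->
  (forall a h, rnorm h < rho -> nc (g a (z + h)) <= K * q ^+ degree a) ->
  differentiable (fun z => boxlim (fun a => g a z)) z.
Proof.
move=> rho0 q0 q1 dg bg.
apply: (@weierstrass _ _ (fun N z => boxsum N (fun a => g a z)) _ _ rho) => //.
- move=> n h hr.
  have := @differentiable_sum _ _ _ #|{ffun 'I_m -> 'I_n.+1}|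
     (fun k z => g (fun i => (enum_val k : {ffun 'I_m -> 'I_n.+1}) i) z) (z + h).
  rewrite fct_sumE => /(_ (fun k => dg _ _ hr)); congr (differentiable _ _).
  by apply/funext => w; rewrite /boxsum [RHS]big_enum_val.
- move=> e e0; have [N hN] := @boxlim_unif K q e q0 q1 e0.
  by exists N => n h Nn hr; apply: hN => // a; exact: bg.
Qed.

End box_limits.

(** * Taylor expansion on the polydisc *)

Section taylor_expansion.
Context {R : realType} (m : nat).
Local Notation C := R[i].
Implicit Types (z h : 'rV[C]_m) (F G : 'rV[C]_m -> C) (a : 'I_m -> nat).

(** Expansion in the variables listed in [s], one after the other. *)
Fixpoint expand N (s : seq 'I_m) F z : C :=
  if s is i :: s' then \sum_(k < N.+1) expand N s' (coefA i k F) z * z 0 i ^+ k else F z.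

Definition coefs (s : seq 'I_m) a F := foldl (fun G i => coefA i (a i) G) F s.

Definition supp_in N (s : seq 'I_m) (b : {ffun 'I_m -> 'I_N.+1}) :=
  [forall i, (i \in s) || (b i == ord0)].

Lemma coefs_ext s a b F : {in s, a =1 b} -> coefs s a F = coefs s b F.
Proof.
elim: s F => [//|i s IH] F hab /=; rewrite (hab i) ?mem_head//.
by apply: IH => j js; apply: hab; rewrite in_cons js orbT.
Qed.

Lemma expandE N s F z : uniq s -> expand N s F z =
  \sum_(b : {ffun 'I_m -> 'I_N.+1} | supp_in s b)
     coefs s (fun i => b i) F z * \prod_(i <- s) z 0 i ^+ b i.
Proof.
elim: s F => [|i s IH] F /=.
  move=> _; rewrite (big_pred1 [ffun=> ord0]) ?big_nil ?mulr1// => b.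
  apply/forallP/eqP => [hb|->] /=; last by move=> i; rewrite ffunE.
  by apply/ffunP => j; rewrite ffunE; apply/eqP; have := hb j.
move=> /andP[is_ us].
rewrite (partition_big (fun b : {ffun 'I_m -> 'I_N.+1} => b i) predT)//=.
apply: eq_bigr => k _; rewrite IH// mulr_suml.
pose h (b : {ffun 'I_m -> 'I_N.+1}) : {ffun 'I_m -> 'I_N.+1} := [ffun j => if j == i then k else b j].
pose h' (b : {ffun 'I_m -> 'I_N.+1}) : {ffun 'I_m -> 'I_N.+1} := [ffun j => if j == i then ord0 else b j].
rewrite [RHS](reindex_onto h h') /=; last first.
  move=> b /andP[_ /eqP bi]; apply/ffunP => j; rewrite !ffunE.
  by case: eqP => [->|//].
have hsE b : supp_in (i :: s) (h b) && (h b i == k) && (h' (h b) == b) = supp_in s b.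
  apply/idP/idP.
    move=> /andP[/andP[/forallP h1 _] /eqP <-]; apply/forallP => j.
    rewrite !ffunE; case: (j =P i) => [_|/eqP ji]; first by rewrite eqxx orbT.
    by have := h1 j; rewrite in_cons (negbTE ji) ffunE (negbTE ji).
  move=> /forallP hb; apply/andP; split; last first.
    apply/eqP/ffunP => j; rewrite !ffunE; case: eqP => // ->.
    by apply/esym/eqP; have := hb i; rewrite (negbTE is_).
  rewrite ffunE !eqxx andbT; apply/forallP => j; rewrite in_cons ffunE.
  by case: (j =P i) => //= _; exact: hb.
apply: eq_big => [b|b hb]; first by rewrite hsE.
have hbi : h b i = k by rewrite ffunE eqxx.
rewrite hbi big_cons hbi.
have -> : coefs s (fun j => h b j) (coefA i k F) z = coefs s (fun j => b j) (coefA i k F) z.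
  rewrite (@coefs_ext _ _ (fun j => b j))// => j js; rewrite ffunE ifN//.
  by apply: contraNneq is_ => <-.
have -> : \prod_(j <- s) z 0 j ^+ h b j = \prod_(j <- s) z 0 j ^+ b j.
  rewrite [in LHS]big_seq [in RHS]big_seq; apply: eq_bigr => j js; rewrite ffunE ifN//.
  by apply: contraNneq is_ => <-.
by rewrite [RHS]mulrCA mulrC.
Qed.

Lemma coefs_le s a F (r M : R) : hol F -> 0 < r < 1 ->
  (forall z, in_polydisc r z -> nc (F z) <= M) ->
  forall z, in_polydisc r z -> nc (coefs s a F z) <= 2 ^+ size s * M / \prod_(i <- s) r ^+ a i.
Proof.
elim: s F M => [|i s IH] F M hF hr hM z hz /=.
  by rewrite big_nil divr1 expr0 mul1r; exact: hM.
have := IH (coefA i (a i) F) (2 * M / r ^+ a i) (hol_coefA i (a i) hF) hr _ z hz.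
move=> /(_ (fun z hz => coefA_le i (a i) hF hr hM hz)) /le_trans; apply.
by rewrite big_cons invfM exprS le_eqVlt; apply/orP; left; apply/eqP; ring.
Qed.

(** Each expansion in one more variable adds a geometrically small error,
    uniformly in the remaining variables. *)
Lemma expand_error s (r rho : R) : 0 < r -> r < rho -> rho < 1 ->
  exists2 K : R, 0 <= K & forall F M N, hol F ->
    (forall z, in_polydisc rho z -> nc (F z) <= M) ->
    forall z, in_polydisc r z -> nc (F z - expand N s F z) <= K * (r / rho) ^+ N.+1 * M.
Proof.
move=> r0 rr r1; have rho0 : 0 < rho by exact: lt_trans rr.
have rr1 : 0 < rho < 1 by rewrite rho0.
pose q := r / rho.
have q0 : 0 <= q by rewrite divr_ge0// ltW.
have q1 : q < 1 by rewrite ltr_pdivrMr// mul1r.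
elim: s => [|i s [K K0 IH]].
  by exists 0 => // F M N hF hM z hz; rewrite subrr nc0 !mul0r.
exists (4 * (rho / (rho - r)) + K * 2 * (1 - q)^-1).
  by rewrite addr_ge0// mulr_ge0// ?divr_ge0 ?invr_ge0 ?subr_ge0// ?mulr_ge0// ltW.
move=> F M N hF hM z hz /=.
have M0 : 0 <= M.
  by apply: le_trans (nc_ge0 _) (hM 0 _) => k; rewrite mxE nc0 ltW.
apply: (le_trans (nc_tri _ (\sum_(k < N.+1) coefA i k F z * z 0 i ^+ k) _)).
rewrite mulrDl [leRHS]mulrDl; apply: lerD.
  apply: (le_trans (coefA_remainder _ _ hF r0 rr r1 hM hz)).
  by rewrite le_eqVlt; apply/orP; left; apply/eqP; ring.
rewrite -sumrB; apply: (le_trans (nc_sum _ _ _)).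
apply: (@le_trans _ _ (\sum_(k < N.+1) K * 2 * q ^+ N.+1 * M * q ^+ k)).
  apply: ler_sum => k _; rewrite -mulrBl ncM ncX.
  have h1 := IH (coefA i k F) (2 * M / rho ^+ k) N (hol_coefA i k hF)
    (fun z hz => coefA_le i k hF rr1 hM hz) z hz.
  have -> : K * 2 * q ^+ N.+1 * M * q ^+ k = (K * q ^+ N.+1 * (2 * M / rho ^+ k)) * r ^+ k.
    have -> : q ^+ k = r ^+ k / rho ^+ k by rewrite /q exprMn exprVn.
    by ring.
  apply: ler_pM; rewrite ?nc_ge0 ?exprn_ge0 ?nc_ge0//.
  by rewrite lerXn2r ?nnegrE ?nc_ge0 ?(ltW r0)// hz.
rewrite -mulr_sumr.
have -> : K * 2 * (1 - q)^-1 * q ^+ N.+1 * M = K * 2 * q ^+ N.+1 * M * (1 - q)^-1 by ring.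
apply: ler_wpM2l; first by rewrite !mulr_ge0// exprn_ge0.
exact: geometric_le.
Qed.

Definition mono a z : C := \prod_i z 0 i ^+ a i.

(** The coefficient of the monomial [a]: one-variable coefficients taken in
    all variables in turn. *)
Definition taylor F a : C := coefs (enum 'I_m) a F 0.

Lemma coefs_indep s a G i : (forall z w, G (upd z i w) = G z) ->
  forall z w, coefs s a G (upd z i w) = coefs s a G z.
Proof.
elim: s G => [//|k s IH] G hG z w /=.
by apply: IH => z' w'; exact: coefA_indep.
Qed.

Lemma coefs_upd s a F z w i : i \in s -> coefs s a F (upd z i w) = coefs s a F z.
Proof.
elim: s F z w => [//|j s IH] F z w; rewrite in_cons => /orP[/eqP->|/IH]; last exact.
exact: (@coefs_indep s a (coefA j (a j) F) j (coefA_upd j (a j) F)).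
Qed.

Lemma coefs_enum a F z : coefs (enum 'I_m) a F z = taylor F a.
Proof.
pose u (s : seq 'I_m) : 'rV[C]_m := \row_j (if j \in s then 0 else z 0 j).
have hu s : coefs (enum 'I_m) a F (u s) = coefs (enum 'I_m) a F z.
  elim: s => [|i s IH].
    by congr (coefs _ _ _ _); apply/rowP => j; rewrite mxE.
  rewrite -IH -[RHS](@coefs_upd _ _ _ _ 0 i) ?mem_enum//.
  congr (coefs _ _ _ _); apply/rowP => j; rewrite !mxE in_cons.
  by case: (j == i).
rewrite -(hu (enum 'I_m)) /taylor; congr (coefs _ _ _ _).
by apply/rowP => j; rewrite !mxE mem_enum.
Qed.

Lemma prod_enum (V : comPzRingType) (f : 'I_m -> V) : \prod_(i <- enum 'I_m) f i = \prod_i f i.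
Proof. by rewrite big_enum. Qed.

Lemma expand_boxsum N F z :
  expand N (enum 'I_m) F z = boxsum N (fun a => taylor F a * mono a z).
Proof.
rewrite expandE ?enum_uniq// /boxsum; apply: eq_big.
  by move=> b; apply/forallP => i; rewrite mem_enum.
by move=> b _; rewrite coefs_enum prod_enum.
Qed.

Lemma taylor_le F (r M : R) a : hol F -> 0 < r < 1 ->
  (forall z, in_polydisc r z -> nc (F z) <= M) -> nc (taylor F a) <= 2 ^+ m * M / r ^+ degree a.
Proof.
move=> hF /[dup] hr /andP[r0 _] hM; have := coefs_le (enum 'I_m) a hF hr hM (z := 0).
rewrite prod_enum size_enum_ord expr_degree; apply => k.
by rewrite mxE nc0 ltW.
Qed.

(** Expanding up to degree [N] in all variables leaves an error that is
    geometrically small in [N]. *)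
Theorem taylor_series F z : hol F -> (forall k, nc (z 0 k) < 1) ->
  clim (fun N => boxsum N (fun a => taylor F a * mono a z)) (F z).
Proof.
move=> hF /polydisc_room[r /andP[r0 r1] hz] e e0.
pose rho := (1 + r) / 2.
have rr : r < rho by rewrite /rho; lra.
have rho1 : rho < 1 by rewrite /rho; lra.
have [M M0 hM] := hol_bounded rho1 hF.
have [K K0 hK] := expand_error (enum 'I_m) r0 rr rho1.
have rho0 : 0 < rho by exact: lt_trans rr.
have q1 : `|r / rho| < 1.
  rewrite ger0_norm; last by rewrite divr_ge0// ltW.
  by rewrite ltr_pdivrMr// mul1r.
have eK : 0 < e / (K * M + 1) by rewrite divr_gt0// ltr_wpDl// mulr_ge0.
have /cvgrPdist_le /(_ _ eK)[N _ hN] := cvg_expr q1.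
exists N => n Nn; rewrite ncC -expand_boxsum.
apply: (le_trans (hK F M n hF hM z hz)).
have := hN n.+1 (leqW Nn); rewrite /= sub0r normrN ger0_norm; last first.
  by rewrite exprn_ge0// divr_ge0// ltW.
rewrite mulrAC => hq; apply: (@le_trans _ _ ((K * M + 1) * (e / (K * M + 1)))).
  apply: ler_pM => //; rewrite ?mulr_ge0// ?lerDl//.
  by rewrite exprn_ge0// divr_ge0// ltW.
by rewrite mulrC divfK// gt_eqF// ltr_wpDl// mulr_ge0.
Qed.

Lemma mono_le a z r : in_polydisc r z -> nc (mono a z) <= r ^+ degree a.
Proof.
move=> hz; rewrite /mono nc_prod expr_degree; apply: ler_prod => i _.
by rewrite ncX exprn_ge0 ?nc_ge0//= lerXn2r ?nnegrE ?nc_ge0// (le_trans (nc_ge0 _) (hz i)).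
Qed.

Lemma differentiable_prodr (I : Type) (s : seq I) (f : I -> 'rV[C]_m -> C) z :
  (forall i, differentiable (f i) z) -> differentiable (fun z => \prod_(i <- s) f i z) z.
Proof.
move=> df; elim: s => [|i s IH].
  by under eq_fun do rewrite big_nil; exact: differentiable_cst.
by under eq_fun do rewrite big_cons; apply: differentiableM.
Qed.

Lemma differentiable_expr (f : 'rV[C]_m -> C) n z :
  differentiable f z -> differentiable (fun z => f z ^+ n) z.
Proof.
move=> df; elim: n => [|n IH].
  by under eq_fun do rewrite expr0; exact: differentiable_cst.
by under eq_fun do rewrite exprS; apply: differentiableM.
Qed.

Lemma mono_differentiable a z : differentiable (mono a) z.
Proof.
apply: differentiable_prodr => i; apply: differentiable_expr.
exact: differentiable_coord.
Qed.

Definition psum (c : ('I_m -> nat) -> C) z : C := boxlim (fun a => c a * mono a z).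

Lemma psum_clim c (M : R) z : (forall a, nc (c a) <= M) -> (forall k, nc (z 0 k) < 1) ->
  clim (fun N => boxsum N (fun a => c a * mono a z)) (psum c z).
Proof.
move=> hc /polydisc_room[r /andP[r0 r1] hz].
apply: (@boxlimP _ _ _ M r) => //; first exact: ltW.
by move=> a; rewrite ncM; apply: ler_pM; rewrite ?nc_ge0//; exact: mono_le.
Qed.

(** Near each point the terms are dominated by a geometric family. *)
Lemma psum_hol c (M : R) : (forall a, nc (c a) <= M) -> hol (psum c).
Proof.
move=> hc z /polydisc_room[r /andP[r0 r1] hz].
pose rho := (1 + r) / 2.
have rr : 0 < rho - r by rewrite /rho; lra.
have rho1 : rho < 1 by rewrite /rho; lra.
apply: (@boxlim_differentiable _ _ _ (fun a z => c a * mono a z) z (rho - r) M rho) => //.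
- by rewrite /rho; lra.
- move=> a h _; apply: differentiableM; first exact: differentiable_cst.
  exact: mono_differentiable.
- move=> a h hr; rewrite ncM; apply: ler_pM; rewrite ?nc_ge0//.
  apply: mono_le => k; rewrite mxE; apply: (le_trans (ncD _ _)).
  by have := nc_coord_le h k; have := hz k; lra.
Qed.

End taylor_expansion.

(** * Trigonometric integrals on the torus *)

Section circle_orthogonality.
Context {R : realType}.
Local Notation C := R[i].
Local Notation mu := (@lebesgue_measure R).
Local Notation dom := (`[0%R, (2 * pi)%R]%classic : set R).

Definition primitive_ei (k : int) (t : R) : C :=
  if k == 0 then t%:C%C else ((k%:~R)%:C%C * 'i%C)^-1 * ei (k%:~R * t).

Lemma primitive_eiP k t : cder (primitive_ei k) t (ei (k%:~R * t)).
Proof.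
rewrite /primitive_ei; case: eqP => [->|/eqP k0].
  by rewrite mul0r ei0; exact: cder_id.
have kC : ((k%:~R)%:C%C : C) != 0 by rewrite -nc_gt0 nc_real normr_gt0 intr_eq0.
have := cderZ ((k%:~R)%:C%C * 'i%C)^-1 (cder_eiM k%:~R t).
by rewrite mulrA mulVf ?mul1r// mulf_neq0// i_neq0.
Qed.

Lemma ei_int k : ei (k%:~R * (2 * pi)) = 1 :> C.
Proof.
case: k => n; first by rewrite -pmulrn -eiXn ei2pi expr1n.
by rewrite NegzE mulrNz mulNr -ei_inv -pmulrn -eiXn ei2pi expr1n invr1.
Qed.

Lemma primitive_ei_period k : primitive_ei k (2 * pi) - primitive_ei k 0 =
  if k == 0 then (2 * pi)%:C%C else 0.
Proof.
rewrite /primitive_ei; case: ifP => _; first by rewrite rmorph0 subr0.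
by rewrite ei_int mulr0 ei0 subrr.
Qed.

Lemma cder_sum (J : Type) (s : seq J) (Q : pred J) (F : J -> R -> C) (g : J -> C) t :
  (forall j, Q j -> cder (F j) t (g j)) ->
  cder (fun t => \sum_(j <- s | Q j) F j t) t (\sum_(j <- s | Q j) g j).
Proof.
move=> hF; elim: s => [|i s IH].
  by under eq_fun do rewrite big_nil; rewrite big_nil; exact: cder_cst.
under eq_fun do rewrite big_cons.
by rewrite big_cons; case: ifP => // Qi; apply: cderD => //; exact: hF.
Qed.

Lemma cder_continuous_Re (G g : R -> C) : (forall t, cder G t (g t)) ->
  continuous (fun t => Re (G t)).
Proof.
move=> h t; apply: differentiable_continuous; apply/derivable1_diffP.
by have [[]] := h t.
Qed.

Variables (J : finType) (k : J -> int).

Definition trig1 (Q : pred J) (c : J -> C) (t : R) : C := \sum_(j | Q j) c j * ei ((k j)%:~R * t).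

Lemma trig1_continuous Q c : continuous (fun t => Re (trig1 Q c t)).
Proof.
apply: (@cder_continuous_Re _ (fun t => \sum_(j | Q j) c j * (((k j)%:~R)%:C%C * 'i%C * ei ((k j)%:~R * t)))).
by move=> t; apply: cder_sum => j _; apply: cderZ; exact: cder_eiM.
Qed.

Lemma integral_trig1 Q c :
  (((2 * pi)^-1)%:E * \int[mu]_(t in dom) (Re (trig1 Q c t))%:E)%E =
  (Re (\sum_(j | Q j && (k j == 0)) c j))%:E.
Proof.
pose F t := \sum_(j | Q j) c j * primitive_ei (k j) t.
have dF t : cder F t (trig1 Q c t).
  by apply: cder_sum => j _; apply: cderZ; exact: primitive_eiP.
have cF := cder_continuous_Re dF.
rewrite (@continuous_FTC2 R _ (fun t => Re (F t))).
- rewrite -EFinB -EFinM -ReN -ReD /F -sumrB.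
  rewrite (eq_bigr (fun j => c j * (if k j == 0 then (2 * pi)%:C%C else 0))); last first.
    by move=> j _; rewrite -mulrBr primitive_ei_period.
  rewrite (bigID (fun j => k j == 0)) /= addrC big1; last first.
    by move=> j /andP[_ /negbTE ->]; rewrite mulr0.
  rewrite add0r (eq_bigr (fun j => c j * (2 * pi)%:C%C)); last by move=> j /andP[_ ->].
  rewrite -mulr_suml; set S := \sum_(_ | _) _.
  have -> : Re (S * (2 * pi)%:C%C) = Re S * (2 * pi).
    by case: S => x y /=; rewrite mulr0 subr0.
  by rewrite mulrCA mulVf ?mulr1// gt_eqF// pi2_gt0.
- exact: pi2_gt0.
- by apply: continuous_subspaceT; exact: trig1_continuous.
- split.
  + by move=> t _; have [[]] := dF t.
  + exact/cvg_at_right_filter/cF.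
  + exact/cvg_at_left_filter/cF.
- by move=> t _; rewrite derive1E; have [[]] := dF t.
Qed.

End circle_orthogonality.

Section torus.
Context {R : realType}.
Local Notation C := R[i].
Local Notation mu := (@lebesgue_measure R).
Local Notation dom := (`[0%R, (2 * pi)%R]%classic : set R).

Definition tint m (g : 'rV[R]_m -> R) : \bar R := torus_integral (fun t => (g t)%:E).

Definition fiber m (g : 'rV[R]_m.+1 -> R) (t : R) : 'rV[R]_m -> R :=
  fun u => g (row_mx t%:M u : 'rV[R]_(1 + m)).

Lemma tintS m (g : 'rV[R]_m.+1 -> R) :
  tint g = (((2 * pi)^-1)%:E * \int[mu]_(t in dom) tint (fiber g t))%E.
Proof. by []. Qed.

(** Measurability at each stage of the iterated integral. *)
Fixpoint nice m : ('rV[R]_m -> R) -> Prop :=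
  if m is m'.+1 then fun g => (forall t, nice (fiber g t)) /\
     measurable_fun dom ((fun t => tint (fiber g t)) : R -> \bar R)
  else fun=> True.

Section trigonometric.
Variable J : finType.

Definition trig m (k : J -> 'I_m -> int) (Q : pred J) (c : J -> C) (t : 'rV[R]_m) : R :=
  Re (\sum_(j | Q j) c j * \prod_i ei ((k j i)%:~R * t 0 i)).

Lemma row_mx_head m t (u : 'rV[R]_m) : (row_mx t%:M u : 'rV[R]_(1 + m)) 0 (ord0 : 'I_m.+1) = t.
Proof. by rewrite mxE; case: splitP => // j _; rewrite mxE ord1. Qed.

Lemma row_mx_tail m t (u : 'rV[R]_m) i :
  (row_mx t%:M u : 'rV[R]_(1 + m)) 0 (lift ord0 i : 'I_m.+1) = u 0 i.
Proof.
rewrite mxE; case: splitP => [j /= ij|j /= ij]; first by have := ltn_ord j; rewrite -ij.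
by congr (u 0 _); apply/val_inj; case: ij.
Qed.

Lemma fiber_trig m k Q c t : fiber (@trig m.+1 k Q c) t =
  trig (fun j i => k j (lift ord0 i)) Q (fun j => c j * ei ((k j ord0)%:~R * t)).
Proof.
apply/funext => u; rewrite /fiber /trig; congr Re; apply: eq_bigr => j _.
rewrite big_ord_recl -mulrA; congr (_ * (_ * _)).
  by rewrite row_mx_head.
by apply: eq_bigr => i _; rewrite row_mx_tail.
Qed.

(** By Fubini all but the constant term integrate to zero; the induction on
    the dimension also yields the measurability at each stage of the iterated
    integral. *)
Lemma trig_integral m k Q c : nice (@trig m k Q c) /\
  tint (@trig m k Q c) = (Re (\sum_(j | Q j && [forall i, k j i == 0]) c j))%:E.
Proof.
elim: m k c => [|m IH] k c.
  split=> //; rewrite /tint /= /trig; congr (Re _)%:E.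
  apply: eq_big => [j|j _]; last by rewrite big_ord0 mulr1.
  by rewrite (_ : [forall i, _]) ?andbT//; apply/forallP => -[].
have tE t : tint (fiber (trig k Q c) t) =
    (Re (trig1 (fun j => k j ord0) [pred j | Q j && [forall i, k j (lift ord0 i) == 0]] c t))%:E.
  by rewrite fiber_trig (IH _ _).2.
split.
  split; first by move=> t; rewrite fiber_trig; exact: (IH _ _).1.
  apply: (eq_measurable_fun (fun t => (Re (trig1 (fun j => k j ord0)
    [pred j | Q j && [forall i, k j (lift ord0 i) == 0]] c t))%:E)) => [t _|]; first by rewrite -tE.
  apply: measurableT_comp => //.
  by apply: measurable_funTS; apply: continuous_measurable_fun; exact: trig1_continuous.
rewrite tintS.
have -> : (\int[mu]_(t in dom) tint (fiber (trig k Q c) t) = \int[mu]_(t in dom)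
    (Re (trig1 (fun j => k j ord0) [pred j | Q j && [forall i, k j (lift ord0 i) == 0]] c t))%:E)%E.
  by apply: eq_integral => t _; exact: tE.
rewrite integral_trig1; congr (Re _)%:E; apply: eq_bigl => j /=; rewrite -andbA; congr (_ && _).
apply/andP/forallP => [[/forallP h /eqP h0] i|h].
  by case: (unliftP ord0 i) => [i'|] ->; [exact: h|rewrite h0].
by split; [apply/forallP => i; exact: h|exact: h].
Qed.

End trigonometric.

Lemma mu_dom : mu dom = (2 * pi)%:E.
Proof. by rewrite lebesgue_measure_itv /= lte_fin pi2_gt0 -EFinB subr0. Qed.

Lemma tint_le m (g : 'rV[R]_m -> R) (M : R) : nice g -> (forall t, `|g t| <= M) ->
  (`|tint g| <= M%:E)%E.
Proof.
elim: m g => [|m IH] g; first by move=> _ hM; rewrite /tint /= lee_fin.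
move=> [n1 n2] hM; rewrite tintS.
have p0 : 0 <= (2 * pi)^-1 :> R by rewrite invr_ge0 ltW// pi2_gt0.
rewrite abseM [X in (X * _)%E]gee0_abs ?lee_fin//.
rewrite lee_pdivrMl ?pi2_gt0//.
apply: (le_trans (le_abse_integral _ _ _)) => //.
have -> : ((2 * pi)%:E * M%:E = \int[mu]_(t in dom) cst M%:E t)%E.
  by rewrite integral_cst// muleC; congr (_ * _)%E; exact/esym/mu_dom.
have M0 : 0 <= M by exact: le_trans (hM 0).
apply: ge0_le_integral => //.
- exact: measurableT_comp.
- by move=> t _; apply: IH; [exact: n1|move=> u; exact: hM].
Qed.

(** Dominated convergence, one variable of the iterated integral at a time. *)
Lemma tint_lim m (gn : nat -> 'rV[R]_m -> R) g (M : R) :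
  (forall n, nice (gn n)) -> (forall n t, `|gn n t| <= M) ->
  (forall t, gn n t @[n --> \oo] --> g t) ->
  nice g /\ tint (gn n) @[n --> \oo] --> tint g.
Proof.
elim: m gn g => [|m IH] gn g hn hM hl.
  split=> //; rewrite /tint /=; apply: cvg_EFin; [exact: nearW|exact: (hl 0)].
have H t : nice (fiber g t) /\ tint (fiber (gn n) t) @[n --> \oo] --> tint (fiber g t).
  apply: IH => [n|n u|u]; [by have [+ _] := hn n; apply|exact: hM|exact: hl].
have mg : measurable_fun dom ((fun t => tint (fiber g t)) : R -> \bar R).
  apply: (@emeasurable_fun_cvg _ _ _ _ (fun n t => tint (fiber (gn n) t))).
    by move=> n; have [] := hn n.
  by move=> t _; have [] := H t.
split; first by split => // t; have [] := H t.
rewrite tintS; under eq_fun do rewrite tintS.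
apply: cvgeZl => //.
have [] // := @dominated_convergence _ _ R mu dom _ (fun n t => tint (fiber (gn n) t))
  (fun t => tint (fiber g t)) (cst M%:E).
- by move=> n; have [] := hn n.
- by apply: aeW => t _; have [] := H t.
- apply/integrableP; split; first exact: measurable_cst.
  have -> : (\int[mu]_(t in dom) `|cst M%:E t| = `|M|%:E * (2 * pi)%:E)%E.
    rewrite -[X in (_ * X)%E]mu_dom; exact: integral_cst.
  by rewrite -EFinM ltry.
- apply: aeW => t n _; apply: tint_le; first by have [+ _] := hn n; apply.
  by move=> u; exact: hM.
Qed.

End torus.

(** * Parseval's formula and the Hardy norm *)

Section parseval.
Context {R : realType} (m : nat).
Local Notation C := R[i].
Implicit Types (a : 'I_m -> nat) (c : ('I_m -> nat) -> C) (t : 'rV[R]_m).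

Definition cpt (r : R) t : 'rV[C]_m := \row_k (r%:C%C * ei (t 0 k)).

Lemma cpt_polydisc r t : 0 <= r -> in_polydisc r (cpt r t).
Proof. by move=> r0 k; rewrite mxE nc_polar. Qed.

Lemma nc_sqr (x : C) : nc x ^+ 2 = Re (x * conjc x).
Proof.
rewrite nc_def sqr_sqrtr ?addr_ge0 ?sqr_ge0//.
by case: x => x y /=; rewrite mulrN opprK !expr2.
Qed.

Lemma conjc_eiX s n : conjc (ei s ^+ n) = ei (- s) ^+ n :> C.
Proof. by rewrite rmorphXn /= /ei cosN sinN. Qed.

Lemma mono_cpt r t a : mono a (cpt r t) = (r ^+ degree a)%:C%C * \prod_i ei (t 0 i) ^+ a i.
Proof.
rewrite /mono expr_degree rmorph_prod /= -big_split /=; apply: eq_bigr => i _.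
by rewrite mxE exprMn rmorphXn.
Qed.

Lemma Re_sum (J : Type) (s : seq J) (P : pred J) (f : J -> C) :
  Re (\sum_(j <- s | P j) f j) = \sum_(j <- s | P j) Re (f j).
Proof. by elim/big_rec2: _ => // j x y _ <-; exact: ReD. Qed.

(** Parseval for polynomials: the squared modulus is a trigonometric polynomial whose
    constant term is the sum of the squared moduli of the coefficients. *)
Lemma parseval_box N c r : 0 <= r ->
  let g t := nc (boxsum N (fun a => c a * mono a (cpt r t))) ^+ 2 in
  nice g /\ tint g = (boxsum N (fun a => (nc (c a) * r ^+ degree a) ^+ 2))%:E.
Proof.
move=> r0; pose I := {ffun 'I_m -> 'I_N.+1}; pose J := (I * I)%type.
pose w (b : I) : C := c (fun i => b i) * (r ^+ degree (fun i => b i))%:C%C.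
pose k (j : J) i : int := (j.1 i : nat)%:Z - (j.2 i : nat)%:Z.
move=> g; have -> : g = trig k predT (fun j => w j.1 * conjc (w j.2)).
  apply/funext => t; rewrite /g nc_sqr /trig; congr Re.
  have -> : boxsum N (fun a => c a * mono a (cpt r t)) =
      \sum_(b : I) w b * \prod_i ei (t 0 i) ^+ b i.
    by apply: eq_bigr => b _; rewrite mono_cpt mulrA.
  rewrite rmorph_sum big_distrlr /= pair_bigA /=; apply: eq_bigr => -[b b'] _ /=.
  rewrite rmorphM rmorph_prod mulrACA; congr (_ * _); rewrite -big_split /=.
  apply: eq_bigr => i _; rewrite conjc_eiX !eiXn -eiD; congr ei.
  by rewrite /k /= intrB -!pmulrn mulrBl mulrN.
have [h1 h2] := trig_integral k predT (fun j => w j.1 * conjc (w j.2)).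
split=> //; rewrite h2; congr _%:E.
have -> : \sum_(j : J | predT j && [forall i, k j i == 0]) w j.1 * conjc (w j.2) =
    \sum_(b : I) w b * conjc (w b).
  rewrite (reindex_onto (fun b : I => (b, b)) (fun j => j.1)) /=.
    apply: eq_bigl => b; rewrite eqxx andbT; apply/forallP => i.
    by rewrite /k /= subrr.
  move=> [b b'] /forallP h /=; congr pair; apply/ffunP => i.
  by have := h i; rewrite /k /= subr_eq0 => /eqP[/val_inj].
rewrite Re_sum; apply: eq_bigr => b _.
by rewrite -nc_sqr /w ncM nc_real ger0_norm// exprn_ge0.
Qed.

Lemma sqr_lim (u : nat -> C) l : clim u l -> nc (u n) ^+ 2 @[n --> \oo] --> nc l ^+ 2.
Proof.
move=> h; suff hn : nc (u n) @[n --> \oo] --> nc l.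
  by rewrite expr2; under eq_fun do rewrite expr2; exact: cvgM.
apply/cvgrPdist_le => e /h[N hN]; exists N => // n /= /hN; rewrite ncC => hh.
have h1 := ncD (l - u n) (u n); have h2 := ncD (u n - l) l.
rewrite !subrK in h1 h2; rewrite ncC in h2.
by rewrite ler_norml; apply/andP; split; lra.
Qed.

Lemma parseval_series c F (M q r : R) : 0 <= r -> 0 <= q -> q < 1 ->
  (forall a, nc (c a) * r ^+ degree a <= M * q ^+ degree a) ->
  (forall t, clim (fun N => boxsum N (fun a => c a * mono a (cpt r t))) (F (cpt r t))) ->
  (boxsum N (fun a => (nc (c a) * r ^+ degree a) ^+ 2))%:E @[N --> \oo] -->
    tint (fun t => nc (F (cpt r t)) ^+ 2).
Proof.
move=> r0 q0 q1 hc hF.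
pose g N t := nc (boxsum N (fun a => c a * mono a (cpt r t))) ^+ 2.
have M0 : 0 <= M.
  have := hc (fun=> 0%N).
  have -> : degree (fun _ : 'I_m => 0%N) = 0%N by rewrite /degree big1.
  by rewrite !expr0 !mulr1; apply: le_trans (nc_ge0 _).
have gb N t : `|g N t| <= (M * (1 - q)^-1 ^+ m) ^+ 2.
  rewrite /g ger0_norm ?exprn_ge0 ?nc_ge0// lerXn2r ?nnegrE ?nc_ge0//.
    by rewrite mulr_ge0// exprn_ge0// invr_ge0 subr_ge0 ltW.
  apply: (le_trans (nc_sum _ _ _)).
  apply: (@le_trans _ _ (M * boxsum N (fun a => \prod_i q ^+ a i))).
    rewrite /boxsum mulr_sumr; apply: ler_sum => b _; rewrite ncM -expr_degree.
    apply: le_trans (hc _); rewrite ler_wpM2l ?nc_ge0//; apply: mono_le.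
    exact: cpt_polydisc.
  rewrite ler_wpM2l// (boxsum_prod N (fun _ k => q ^+ k)) prodr_const card_ord.
  rewrite lerXn2r ?nnegrE ?invr_ge0 ?subr_ge0 ?(ltW q1)//.
    by apply: sumr_ge0 => k _; rewrite exprn_ge0.
  exact: geometric_le.
have [_] := tint_lim (fun N => (parseval_box N c r0).1) gb (fun t => sqr_lim (hF t)).
apply: cvg_trans; apply: near_eq_cvg; apply: nearW => N.
by rewrite (parseval_box N c r0).2.
Qed.

End parseval.

Section square_summable.
Context {R : realType} {I : choiceType}.
Local Notation C := R[i].
Implicit Types (x y : I -> C).

(** Sums of squares over arbitrary index sets are taken in the extended reals,
    so that no summability has to be carried along. *)
Definition sqsum x : \bar R := \esum_(i in [set: I]) (nc (x i) ^+ 2)%:E.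

Lemma sqsum_ge0 x : (0 <= sqsum x)%E.
Proof. by apply: esum_ge0 => i _; rewrite lee_fin sqr_ge0. Qed.

Lemma sqsum_ge x (s : seq I) : uniq s -> ((\sum_(i <- s) nc (x i) ^+ 2)%:E <= sqsum x)%E.
Proof.
move=> us; apply: esum_ge; exists [set` s].
  by split => //; exact: finite_seq.
by rewrite -fsbig_seq// sumEFin.
Qed.

Lemma ler_sum_sub (f : I -> R) (s s' : seq I) : uniq s -> uniq s' -> {subset s <= s'} ->
  (forall i, 0 <= f i) -> \sum_(i <- s) f i <= \sum_(i <- s') f i.
Proof.
move=> us us' ss' f0; rewrite [leRHS](bigID (mem s)) /=.
rewrite -[X in _ <= X + _]big_filter.
rewrite (perm_big [seq i <- s' | i \in s]) ?lerDl ?sumr_ge0//.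
apply: uniq_perm; rewrite ?filter_uniq// => i; rewrite !mem_filter.
by case: (boolP (i \in s)) => //= /ss' ->.
Qed.

Lemma sqsum_le x (M : \bar R) :
  (forall s, uniq s -> ((\sum_(i <- s) nc (x i) ^+ 2)%:E <= M)%E) -> (sqsum x <= M)%E.
Proof.
move=> h; apply: ge_ereal_sup => _ [A [finA _] <-].
rewrite fsbig_finite//= sumEFin; apply: h; exact: finmap.fset_uniq.
Qed.

End square_summable.

Section hardy_norm.
Context {R : realType} (m : nat).
Local Notation C := R[i].
Implicit Types (a : 'I_m -> nat) (c : ('I_m -> nat) -> C) (t : 'rV[R]_m).

Lemma boxsum_seq N (f : ('I_m -> nat) -> R) :
  boxsum N f = \sum_(a <- [seq (fun i => (b : {ffun 'I_m -> 'I_N.+1}) i : nat) | b <- enum {ffun 'I_m -> 'I_N.+1}]) f a.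
Proof. by rewrite big_map /boxsum big_enum. Qed.

Lemma box_uniq N : uniq [seq (fun i => (b : {ffun 'I_m -> 'I_N.+1}) i : nat) | b <- enum {ffun 'I_m -> 'I_N.+1}].
Proof.
rewrite map_inj_uniq ?enum_uniq// => b b' h; apply/ffunP => i; apply/val_inj.
exact: (congr1 (fun f => f i) h).
Qed.

Lemma mem_box N a : (forall i, (a i <= N)%N) ->
  a \in [seq (fun i => (b : {ffun 'I_m -> 'I_N.+1}) i : nat) | b <- enum {ffun 'I_m -> 'I_N.+1}].
Proof.
move=> ha; apply/mapP; exists [ffun i => inord (a i)]; first by rewrite mem_enum.
by apply/funext => i; rewrite ffunE inordK// ltnS.
Qed.

Lemma sqsum_box c N : ((boxsum N (fun a => nc (c a) ^+ 2))%:E <= sqsum c)%E.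
Proof. by rewrite boxsum_seq; apply: sqsum_ge; exact: box_uniq. Qed.

Lemma sqsum_box_le c (M : \bar R) :
  (forall N, ((boxsum N (fun a => nc (c a) ^+ 2))%:E <= M)%E) -> (sqsum c <= M)%E.
Proof.
move=> h; apply: sqsum_le => s us.
pose N := (\max_(a <- s) \max_i a i)%N.
apply: le_trans (h N); rewrite lee_fin boxsum_seq.
apply: ler_sum_sub => //; first exact: box_uniq.
  move=> a as_; apply: mem_box => i; rewrite /N.
  apply: (@leq_trans (\max_i a i)%N); first exact: leq_bigmax.
  exact: (@leq_bigmax_seq _ s xpredT (fun a : 'I_m -> nat => \max_i a i)%N a).
by move=> a; rewrite sqr_ge0.
Qed.

(** The norm of the Hardy space is the square sum of the Taylor coefficients; the
    factor [r ^+ D] is removed by letting [r] tend to [1]. *)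
Lemma hardy_norm F : hol F ->
  ereal_sup [set tint (fun t => nc (F (cpt r t)) ^+ 2) | r in `]0%R, 1%R[ ] = sqsum (taylor F).
Proof.
move=> hF; pose a := taylor F.
have pars (r : R) : 0 < r -> r < 1 -> (boxsum N (fun b => (nc (a b) * r ^+ degree b) ^+ 2))%:E @[N --> \oo] -->
    tint (fun t => nc (F (cpt r t)) ^+ 2).
  move=> r0 r1; pose rho := (1 + r) / 2.
  have rr : r < rho by rewrite /rho; lra.
  have rho1 : rho < 1 by rewrite /rho; lra.
  have rho0 : 0 < rho by exact: lt_trans rr.
  have [M M0 hM] := hol_bounded rho1 hF.
  apply: (@parseval_series _ _ a F (2 ^+ m * M) (r / rho)).
  - exact: ltW.
  - by rewrite divr_ge0// ltW.
  - by rewrite ltr_pdivrMr// mul1r.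
  - move=> b; have := @taylor_le _ _ F rho M b hF; rewrite rho0 rho1 => /(_ isT hM) h.
    rewrite exprMn exprVn mulrA mulrAC; apply: ler_wpM2r => //; first by rewrite exprn_ge0// ltW.
  - move=> t; apply: taylor_series => // k.
    by apply: le_lt_trans r1; apply: cpt_polydisc; exact: ltW.
apply/eqP; rewrite eq_le; apply/andP; split.
- apply: ge_ereal_sup => y [r]; rewrite /= in_itv /= => /andP[r0 r1] <-.
  have /cvg_lim <- // := pars r r0 r1; apply: lime_le; first by apply: cvgP; exact: pars.
  apply: nearW => N; apply: le_trans (sqsum_box a N); rewrite lee_fin; apply: ler_sum => b _.
  rewrite lerXn2r ?nnegrE ?mulr_ge0 ?nc_ge0 ?exprn_ge0 ?(ltW r0)//.
  by rewrite ler_piMr ?nc_ge0// exprn_ile1// ltW.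
- apply: sqsum_box_le => N; set S := ereal_sup _.
  pose B := boxsum N (fun b => nc (a b) ^+ 2).
  have key (r : R) : 0 < r -> r < 1 -> ((r ^+ (2 * (m * N)) * B)%:E <= S)%E.
    move=> r0 r1; apply: (@le_trans _ _ (tint (fun t => nc (F (cpt r t)) ^+ 2))); last first.
      by apply: ereal_sup_ubound; exists r => //=; rewrite in_itv/= r0.
    have /cvg_lim <- // := pars r r0 r1.
    apply: lime_ge; first by apply: cvgP; exact: pars.
    exists N => // p /= Np; rewrite lee_fin.
    apply: (@le_trans _ _ (boxsum N (fun b => (nc (a b) * r ^+ degree b) ^+ 2))).
      rewrite /B /boxsum mulr_sumr; apply: ler_sum => b _.
      rewrite mulrC exprMn exprM exprAC ler_wpM2l ?sqr_ge0//.
      rewrite -!exprM; apply: ler_wiXn2l; rewrite ?(ltW r0) ?(ltW r1)//.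
      rewrite leq_mul2r /degree; apply/orP; right; apply: (@leq_trans (\sum_(i < m) N)%N).
        by apply: leq_sum => i _; rewrite -ltnS.
      by rewrite sum_nat_const card_ord.
    rewrite [leLHS](boxsum_widen _ Np) [leRHS]/boxsum.
    rewrite [leRHS](bigID [pred b : {ffun 'I_m -> 'I_p.+1} | [forall i, (b i <= N)%N]]) /=.
    by rewrite lerDl sumr_ge0// => b _; rewrite sqr_ge0.
  have B0 : 0 <= B by apply: sumr_ge0 => b _; rewrite sqr_ge0.
  have cv : ((1 - n.+2%:R^-1) ^+ (2 * (m * N)) * B)%:E @[n --> \oo] --> B%:E.
    have h1 : (1 - n.+2%:R^-1 : R) @[n --> \oo] --> (1 : R).
      rewrite -[X in _ --> X]subr0; apply: cvgB; first exact: cvg_cst.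
      by have := @cvg_harmonic R; rewrite -(cvg_shiftS _ (nbhs (0 : R))).
    have h2 : (1 - n.+2%:R^-1 : R) ^+ (2 * (m * N)) @[n --> \oo] --> (1 : R) ^+ (2 * (m * N)).
      exact: (cvg_comp _ _ h1 (@exprn_continuous R (2 * (m * N)) 1)).
    have h3 := cvgM h2 (cvg_cst B); rewrite expr1n mul1r in h3.
    by apply: cvg_EFin; [exact: nearW|exact: h3].
  apply: cvge_le cv; apply: nearW => n; apply: key.
    by rewrite subr_gt0 invf_lt1// ltr1n.
  by rewrite gtrBl invr_gt0.
Qed.

End hardy_norm.

(** * Square summable families *)

Section square_sums.
Context {R : realType} {I : choiceType}.
Local Notation C := R[i].
Implicit Types (x y : I -> C).

Lemma sqsum_eq x y : (forall i, nc (x i) = nc (y i)) -> sqsum x = sqsum y.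
Proof. by move=> xy; apply: eq_esum => i _; rewrite xy. Qed.

Lemma sqsum_mono x y : (forall i, nc (x i) <= nc (y i)) -> (sqsum x <= sqsum y)%E.
Proof. by move=> xy; apply: le_esum => i _; rewrite lee_fin lerXn2r ?nnegrE ?nc_ge0. Qed.

Lemma nc_sqD (u v : C) : nc (u + v) ^+ 2 <= 2 * nc u ^+ 2 + 2 * nc v ^+ 2.
Proof.
apply: (@le_trans _ _ ((nc u + nc v) ^+ 2)).
  by rewrite lerXn2r ?nnegrE ?nc_ge0 ?addr_ge0 ?nc_ge0// ncD.
by have := sqr_ge0 (nc u - nc v); rewrite !expr2; nra.
Qed.

Lemma sqsumD x y :
  (sqsum (fun i => x i + y i)%R <= (sqsum x + sqsum x) + (sqsum y + sqsum y))%E.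
Proof.
have E (z : I -> C) : (sqsum z + sqsum z = \esum_(i in [set: I]) ((nc (z i) ^+ 2)%:E + (nc (z i) ^+ 2)%:E))%E.
  by rewrite esumD// => i _; rewrite lee_fin sqr_ge0.
rewrite (E x) (E y) -esumD; last 2 first.
- by move=> i _; rewrite -EFinD lee_fin addr_ge0// sqr_ge0.
- by move=> i _; rewrite -EFinD lee_fin addr_ge0// sqr_ge0.
apply: le_esum => i _; rewrite -!EFinD lee_fin.
by apply: le_trans (nc_sqD _ _) _; rewrite !mulr_natl !mulr2n.
Qed.

Lemma sqsum_lty_D x y : (sqsum x < +oo)%E -> (sqsum y < +oo)%E ->
  (sqsum (fun i => x i + y i)%R < +oo)%E.
Proof.
move=> hx hy; apply: le_lt_trans (sqsumD x y) _.
by apply: lte_add_pinfty; apply: lte_add_pinfty.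
Qed.

Lemma sqsumZ_lty (a : C) x : (sqsum x < +oo)%E -> (sqsum (fun i => a * x i)%R < +oo)%E.
Proof.
move=> hx; apply: (@le_lt_trans _ _ ((nc a ^+ 2)%:E * sqsum x)%E); last first.
  by apply: lte_mul_pinfty => //; rewrite lee_fin sqr_ge0.
apply: sqsum_le => s us; apply: (@le_trans _ _ ((nc a ^+ 2)%:E * (\sum_(i <- s) nc (x i) ^+ 2)%:E)%E).
  by rewrite -EFinM lee_fin mulr_sumr; apply: ler_sum => i _; rewrite ncM exprMn.
by apply: lee_wpmul2l; [rewrite lee_fin sqr_ge0|exact: sqsum_ge].
Qed.

Definition restr (A : pred I) x i : C := if A i then x i else 0.

Lemma nc_restr (A : pred I) x i : nc (restr A x i) = if A i then nc (x i) else 0.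
Proof. by rewrite /restr; case: ifP => // _; exact: nc0. Qed.

Lemma sqsum_split (A : pred I) x :
  sqsum x = (sqsum (restr A x) + sqsum (restr (predC A) x))%E.
Proof.
rewrite /sqsum -esumD; last 2 first.
  by move=> i _; rewrite lee_fin sqr_ge0.
  by move=> i _; rewrite lee_fin sqr_ge0.
apply: eq_esum => i _; rewrite -EFinD !nc_restr /=.
by case: (A i); rewrite expr0n ?addr0 ?add0r.
Qed.

Lemma sqsum_restr (A : pred I) x : (sqsum (restr A x) <= sqsum x)%E.
Proof. by apply: sqsum_mono => i; rewrite nc_restr; case: ifP => // _; exact: nc_ge0. Qed.

Lemma sqsum_inj_le (e : I -> I) x : injective e -> (sqsum (fun i => x (e i)) <= sqsum x)%E.
Proof.
move=> ie; apply: sqsum_le => s us.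
by have := @sqsum_ge _ _ x [seq e i | i <- s]; rewrite map_inj_uniq// big_map; apply.
Qed.

Lemma sqsum_image (e : I -> I) x : injective e -> (forall j, (forall i, j <> e i) -> x j = 0) ->
  sqsum x = sqsum (fun i => x (e i)).
Proof.
move=> ie x0; have ii : set_inj [set: I] e by move=> i j _ _; exact: ie.
have E := @esum_image R I I [set: I] e (fun j => (nc (x j) ^+ 2)%:E) ii.
rewrite /sqsum -E.
rewrite (esumID (e @` setT)) ?setTI; last by move=> i _; rewrite lee_fin sqr_ge0.
rewrite [X in (_ + X)%E]esum1 ?adde0// => j hj.
by rewrite x0 ?nc0 ?expr0n// => i ji; apply: hj; exists i; rewrite ?ji.
Qed.

Lemma sqsum_support (s0 : seq I) x : uniq s0 -> (forall i, i \notin s0 -> x i = 0) ->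
  (sqsum x <= (\sum_(i <- s0) nc (x i) ^+ 2)%:E)%E.
Proof.
move=> us0 x0; apply: sqsum_le => s us; rewrite lee_fin.
rewrite (bigID (mem s0)) /= [X in _ + X]big1 ?addr0; last first.
  by move=> i /x0 ->; rewrite nc0 expr0n.
rewrite -big_filter; apply: ler_sum_sub => //; rewrite ?filter_uniq//.
  by move=> i; rewrite mem_filter => /andP[].
by move=> i; rewrite sqr_ge0.
Qed.

Lemma sqsum_coord x i : ((nc (x i) ^+ 2)%:E <= sqsum x)%E.
Proof. by have := @sqsum_ge _ _ x [:: i] isT; rewrite big_seq1. Qed.

(** Some finite set carries the whole sum up to [e]. *)
Lemma sqsum_tail x (e : R) : (sqsum x < +oo)%E -> 0 < e -> exists2 s : seq I, uniq s &
  (sqsum (restr (fun i => i \notin s) x) <= e%:E)%E.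
Proof.
move=> hx e0.
have fx : sqsum x \is a fin_num by rewrite ge0_fin_numE// sqsum_ge0.
have [s us hs] : exists2 s : seq I, uniq s & (sqsum x - e%:E <= (\sum_(i <- s) nc (x i) ^+ 2)%:E)%E.
  apply: contrapT => /forall2NP H.
  have : (sqsum x <= sqsum x - e%:E)%E.
    apply: sqsum_le => s us; have [//|/negP] := H s.
    by rewrite -ltNge => /ltW.
  by rewrite -(fineK fx) -EFinB lee_fin lerBrDr gerDl leNgt e0.
exists s => //.
have := sqsum_split (fun i => i \in s) x.
have h1 : ((\sum_(i <- s) nc (x i) ^+ 2)%:E <= sqsum (restr (fun i => i \in s) x))%E.
  apply: le_trans (sqsum_ge _ us); rewrite lee_fin big_seq [leRHS]big_seq.
  by apply: ler_sum => i is_; rewrite /restr is_.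
move=> E; have f2 : sqsum (restr (fun i => i \in s) x) \is a fin_num.
  by rewrite ge0_fin_numE ?sqsum_ge0// (le_lt_trans (sqsum_restr _ _)).
have f3 : sqsum (restr (fun i => i \notin s) x) \is a fin_num.
  by rewrite ge0_fin_numE ?sqsum_ge0// (le_lt_trans (sqsum_restr _ _)).
move: E hs h1; rewrite -(fineK fx) -(fineK f2).
rewrite (_ : restr (predC (fun i => i \in s)) x = restr (fun i => i \notin s) x)//.
rewrite -(fineK f3) -!EFinD => -[->]; rewrite !lee_fin.
by move: (fine _) (fine _) (\sum_(_ <- _) _) => p1 p2 p3; clear => h1 h2; lra.
Qed.

(** Fatou's lemma for square sums. *)
Lemma sqsum_fatou (xn : nat -> I -> C) x (M : R) : (forall i, clim (fun n => xn n i) (x i)) ->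
  (exists N, forall n, (N <= n)%N -> (sqsum (xn n) <= M%:E)%E) -> (sqsum x <= M%:E)%E.
Proof.
move=> hx [N hN]; apply: sqsum_le => s us; rewrite lee_fin.
have h : \sum_(i <- s) nc (xn n i) ^+ 2 @[n --> \oo] --> \sum_(i <- s) nc (x i) ^+ 2.
  elim: s {us} => [|i s IH]; first by rewrite big_nil; under eq_fun do rewrite big_nil; exact: cvg_cst.
  rewrite big_cons; under eq_fun do rewrite big_cons.
  by apply: cvgD => //; exact: sqr_lim.
apply: cvgr_to_le h _; exists N => // n /= /hN hn; rewrite -lee_fin.
exact: le_trans (sqsum_ge _ us) hn.
Qed.

End square_sums.

(** * Hilbert spaces with coordinates *)

Section coordinates.
Context {R : realType}.
Local Notation C := R[i].

(** Coordinates identifying a Hilbert space with the space of square summable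
    families. *)
Record l2_coords (V : lmodType C) (H : hspace V) (I : choiceType) (c : V -> I -> C) : Prop :=
  L2Coords {
    coords_closed : forall (a : C) f g, hcar H f -> hcar H g -> hcar H (a *: f + g);
    coords_linear : forall (a : C) f g i, hcar H f -> hcar H g ->
      c (a *: f + g) i = a * c f i + c g i;
    coords_lty : forall f, hcar H f -> (sqsum (c f) < +oo)%E;
    coords_norm : forall f, hcar H f -> hnorm H f = Num.sqrt (fine (sqsum (c f)));
    coords_surj : forall x, (sqsum x < +oo)%E -> exists2 f, hcar H f & forall i, c f i = x i;
    coords_inj : forall f g, hcar H f -> hcar H g -> (forall i, c f i = c g i) -> f = g }.

Section one_space.
Context {V : lmodType C} {H : hspace V} {I : choiceType} {c : V -> I -> C}.
Hypothesis L : l2_coords H c.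

Lemma hnorm_sq f : hcar H f -> ((hnorm H f ^+ 2)%:E = sqsum (c f))%E.
Proof.
move=> hf; have h0 := sqsum_ge0 (c f); rewrite (coords_norm L hf) sqr_sqrtr; last exact: fine_ge0.
by rewrite fineK// ge0_fin_numE// (coords_lty L hf).
Qed.

Lemma hnorm_ge0 f : hcar H f -> 0 <= hnorm H f.
Proof. by move=> hf; rewrite (coords_norm L hf) sqrtr_ge0. Qed.

Lemma hcar0 : hcar H 0.
Proof.
have [|f hf _] := coords_surj L (x := fun=> 0).
  by rewrite /sqsum esum1 ?ltry// => i _; rewrite nc0 expr0n.
by have := coords_closed L (-1) hf hf; rewrite scaleN1r addNr.
Qed.

Lemma coords0 i : c 0 i = 0.
Proof.
have := coords_linear L (-1) i hcar0 hcar0.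
by rewrite scaler0 addr0 mulN1r addNr.
Qed.

Lemma hcarZ a f : hcar H f -> hcar H (a *: f).
Proof. by move=> hf; have := coords_closed L a hf hcar0; rewrite addr0. Qed.

Lemma coordsZ a f i : hcar H f -> c (a *: f) i = a * c f i.
Proof. by move=> hf; have := coords_linear L a i hf hcar0; rewrite addr0 coords0 addr0. Qed.

Lemma hcarD f g : hcar H f -> hcar H g -> hcar H (f + g).
Proof. by move=> hf hg; have := coords_closed L 1 hf hg; rewrite scale1r. Qed.

Lemma coordsD f g i : hcar H f -> hcar H g -> c (f + g) i = c f i + c g i.
Proof. by move=> hf hg; have := coords_linear L 1 i hf hg; rewrite scale1r mul1r. Qed.

Lemma hcarB f g : hcar H f -> hcar H g -> hcar H (f - g).
Proof. by move=> hf hg; rewrite -scaleN1r; apply: hcarD => //; exact: hcarZ. Qed.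

Lemma coordsB f g i : hcar H f -> hcar H g -> c (f - g) i = c f i - c g i.
Proof.
move=> hf hg; rewrite -scaleN1r coordsD//; last exact: hcarZ.
by rewrite coordsZ// mulN1r.
Qed.

Lemma hcar_sum (J : Type) (s : seq J) (F : J -> V) :
  (forall j, hcar H (F j)) -> hcar H (\sum_(j <- s) F j).
Proof.
by move=> hF; elim: s => [|j s IH]; rewrite ?big_nil ?big_cons; [exact: hcar0|exact: hcarD].
Qed.

Lemma coords_sum (J : Type) (s : seq J) (F : J -> V) i : (forall j, hcar H (F j)) ->
  c (\sum_(j <- s) F j) i = \sum_(j <- s) c (F j) i.
Proof.
move=> hF; elim: s => [|j s IH]; first by rewrite !big_nil coords0.
by rewrite !big_cons coordsD ?IH//; exact: hcar_sum.
Qed.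

Lemma coord_le f i : hcar H f -> nc (c f i) <= hnorm H f.
Proof.
move=> hf; rewrite -(ler_pXn2r (_ : (0 < 2)%N)) ?nnegrE ?nc_ge0 ?hnorm_ge0//.
by rewrite -lee_fin hnorm_sq//; exact: sqsum_coord.
Qed.

Lemma hnorm_sqD f g : hcar H f -> hcar H g ->
  hnorm H (f + g) ^+ 2 <= 2 * hnorm H f ^+ 2 + 2 * hnorm H g ^+ 2.
Proof.
move=> hf hg; rewrite -lee_fin (hnorm_sq (hcarD hf hg)).
rewrite (sqsum_eq (y := fun i => c f i + c g i)); last by move=> i; rewrite coordsD.
by apply: le_trans (sqsumD _ _) _; rewrite -!hnorm_sq// -!EFinD lee_fin !mulr_natl !mulr2n.
Qed.

Lemma hnormZ a f : hcar H f -> hnorm H (a *: f) = nc a * hnorm H f.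
Proof.
move=> hf; apply/eqP; rewrite -(eqrXn2 (_ : (0 < 2)%N)) ?mulr_ge0 ?nc_ge0 ?hnorm_ge0//; last exact: hcarZ.
have key b g : hcar H g -> hnorm H (b *: g) ^+ 2 <= (nc b * hnorm H g) ^+ 2.
  move=> hg; rewrite -lee_fin (hnorm_sq (hcarZ b hg)); apply: sqsum_le => s us.
  rewrite exprMn lee_fin (eq_bigr (fun i => nc b ^+ 2 * nc (c g i) ^+ 2)); last first.
    by move=> i _; rewrite coordsZ// ncM exprMn.
  rewrite -mulr_sumr ler_wpM2l ?sqr_ge0// -lee_fin hnorm_sq//; exact: sqsum_ge.
apply/eqP/le_anti; rewrite key//=.
have [->|a0] := eqVneq a 0; first by rewrite nc0 mul0r expr0n sqr_ge0.
have := key a^-1 (a *: f) (hcarZ a hf); rewrite scalerA mulVf// scale1r ncV.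
have na : 0 < nc a by rewrite nc_gt0.
rewrite [leRHS]exprMn exprVn mulrC ler_pdivlMr ?exprn_gt0//.
by rewrite exprMn mulrC.
Qed.

Lemma basis_exists i : exists2 e, hcar H e & forall j, c e j = (j == i)%:R.
Proof.
apply: (coords_surj L); apply: (@le_lt_trans _ _ (\sum_(j <- [:: i]) nc ((j == i)%:R : C) ^+ 2)%:E).
  by apply: sqsum_support => // j; rewrite inE => /negbTE ->.
by rewrite ltry.
Qed.

Lemma polarization4 (F : C -> C) : \sum_(k < 4) ('i%C : C) ^+ k * F ('i%C ^+ k) =
  F 1 + 'i%C * F 'i%C - F (-1) - 'i%C * F (- 'i%C).
Proof.
have i2 : ('i%C : C) ^+ 2 = -1 by exact: sqr_i.
have i3 : ('i%C : C) ^+ 3 = - 'i%C by rewrite exprS i2 mulrN1.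
rewrite !big_ord_recl big_ord0 /= !expr0 mul1r /bump /=.
by rewrite !addn0 !add1n !expr1 i2 i3 mulN1r mulNr addr0 !addrA.
Qed.

(** The fourth roots of unity in the polarization formula cancel whatever does not
    depend on them. *)
Lemma polarization_shift (F G : C -> R) (K : R) : (forall u, nc u = 1 -> F u = G u + K) ->
  \sum_(k < 4) ('i%C : C) ^+ k * (F ('i%C ^+ k))%:C%C =
  \sum_(k < 4) ('i%C : C) ^+ k * (G ('i%C ^+ k))%:C%C.
Proof.
move=> FG; rewrite (polarization4 (fun u => (F u)%:C%C)) (polarization4 (fun u => (G u)%:C%C)).
have ni : nc ('i%C : C) = 1 by rewrite nc_def /= expr0n expr1n add0r sqrtr1.
by rewrite !FG ?ncN ?nc1 ?ni// !rmorphD /=; ring.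
Qed.

Lemma hdot_basis i e h : hcar H e -> (forall j, c e j = (j == i)%:R) -> hcar H h ->
  hdot H e h = conjc (c h i).
Proof.
move=> he ei hh; rewrite /hdot.
pose K := fine (sqsum (restr (predC (pred1 i)) (c h))).
pose G (u : C) : R := nc (1 + u * c h i) ^+ 2.
rewrite (@polarization_shift (fun u => hnorm H (e + u *: h) ^+ 2) G K); last first.
  move=> u u1; apply: EFin_inj; rewrite hnorm_sq; last by apply: hcarD => //; exact: hcarZ.
  rewrite (sqsum_split (pred1 i)) EFinD; congr (_ + _)%E.
    apply/eqP; rewrite eq_le; apply/andP; split.
      apply: le_trans (sqsum_support (s0 := [:: i]) _ _) _ => //.
        by move=> j; rewrite inE /restr /= => /negbTE ->.
      by rewrite big_seq1 nc_restr /= eqxx coordsD ?coordsZ ?ei ?eqxx//; exact: hcarZ.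
    apply: le_trans (sqsum_coord _ i).
    by rewrite nc_restr /= eqxx coordsD ?coordsZ ?ei ?eqxx//; exact: hcarZ.
  rewrite fineK; last first.
    by rewrite ge0_fin_numE ?sqsum_ge0// (le_lt_trans (sqsum_restr _ _))// (coords_lty L hh).
  apply: sqsum_eq => j; rewrite !nc_restr /=; case: eqP => //= /eqP ji.
  by rewrite coordsD ?coordsZ ?ei ?(negbTE ji) ?add0r ?ncM ?u1 ?mul1r//; exact: hcarZ.
rewrite (polarization4 (fun u => (G u)%:C%C)) /G.
have Gx (a b : R) : nc (a +i* b)%C ^+ 2 = a ^+ 2 + b ^+ 2.
  by rewrite nc_def /= sqr_sqrtr// addr_ge0 ?sqr_ge0.
case: (c h i) => a b.
have -> : 1 + 1 * (a +i* b)%C = ((1 + a) +i* b)%C by rewrite mul1r; congr Complex; rewrite add0r.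
have -> : 1 + 'i%C * (a +i* b)%C = ((1 - b) +i* a)%C.
  by apply/eqP; rewrite eq_complex /=; apply/andP; split; apply/eqP; ring.
have -> : 1 + -1 * (a +i* b)%C = ((1 - a) +i* - b)%C.
  by apply/eqP; rewrite eq_complex /=; apply/andP; split; apply/eqP; ring.
have -> : 1 + - 'i%C * (a +i* b)%C = ((1 + b) +i* - a)%C.
  by apply/eqP; rewrite eq_complex /=; apply/andP; split; apply/eqP; ring.
rewrite !Gx.
have four : (4 : C) != 0 by rewrite pnatr_eq0.
apply: (mulfI four); rewrite mulrA mulfV// mul1r.
have -> : (4 : C) = ((4 : R)%:C)%C by rewrite rmorph_nat.
by apply/eqP; rewrite eq_complex /=; apply/andP; split; apply/eqP; ring.
Qed.

Lemma adjoint_unique (W : lmodType C) (K : hspace W) (A : V -> W) (B B' : W -> V) :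
  (forall g, hcar K g -> hcar H (B g)) -> (forall g, hcar K g -> hcar H (B' g)) ->
  is_adjoint H K A B -> is_adjoint H K A B' -> forall g, hcar K g -> B g = B' g.
Proof.
move=> hB hB' aB aB' g hg; apply: (coords_inj L); [exact: hB|exact: hB'|move=> i].
have [e he ei] := basis_exists i.
have := aB e g he hg; rewrite (aB' e g he hg).
rewrite (hdot_basis he ei (hB g hg)) (hdot_basis he ei (hB' g hg)).
by move=> /(congr1 conjc); rewrite !conjcK.
Qed.

(** Adjoints are chosen by the description operator; coordinates make them
    unique on the space, so any bounded adjoint computes them. *)
Lemma adjointE (W : lmodType C) (K : hspace W) (A : V -> W) (B : W -> V) :
  bounded_op K H B -> is_adjoint H K A B ->
  forall g, hcar K g -> adjoint H K A g = B g.
Proof.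
move=> bB aB; rewrite /adjoint.
have [] := @xgetPex _ (fun=> 0) [set B | bounded_op K H B /\ is_adjoint H K A B] (ex_intro _ B (conj bB aB)).
set B' := xget _ _ => bB' aB' g hg; apply: adjoint_unique aB' aB g hg.
  by case: bB'.
by case: bB.
Qed.

(** Polarization expresses the scalar product by norms, which an isometry
    preserves. *)
Lemma hdot_isometry (W : lmodType C) (K : hspace W) (A : V -> W) :
  (forall (a : C) f g, hcar H f -> hcar H g -> A (a *: f + g) = a *: A f + A g) ->
  (forall f, hcar H f -> hnorm K (A f) = hnorm H f) ->
  forall f g, hcar H f -> hcar H g -> hdot K (A f) (A g) = hdot H f g.
Proof.
move=> lA nA f g hf hg; rewrite /hdot; congr (_ * _); apply: eq_bigr => k _.
by rewrite addrC -lA// nA ?[_ *: g + f]addrC//; apply: hcarD => //; exact: hcarZ.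
Qed.

Section shift.
Variables (e : I -> I) (S : V -> V).
Hypothesis einj : injective e.
Hypothesis S_hcar : forall f, hcar H f -> hcar H (S f).
Hypothesis S_coords : forall f i, hcar H f -> c (S f) (e i) = c f i.
Hypothesis S_zero : forall f j, hcar H f -> (forall i, j <> e i) -> c (S f) j = 0.

Definition back (g : V) : V := xget 0 [set f | hcar H f /\ forall i, c f i = c g (e i)].

Lemma backP g : hcar H g -> hcar H (back g) /\ forall i, c (back g) i = c g (e i).
Proof.
move=> hg; apply: (@xgetPex _ 0 [set f | hcar H f /\ forall i, c f i = c g (e i)]).
have [|f hf fE] := coords_surj L (x := fun i => c g (e i)); last by exists f.
by apply: le_lt_trans (coords_lty L hg); exact: sqsum_inj_le.
Qed.

Lemma back_bounded : bounded_op H H back.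
Proof.
split.
- by move=> g /backP[].
- move=> a f g hf hg.
  have [hBf Bf] := backP hf; have [hBg Bg] := backP hg.
  have [hBfg Bfg] := backP (coords_closed L a hf hg).
  apply: (coords_inj L) => // [|i]; first exact: (coords_closed L a hBf hBg).
  by rewrite Bfg !(coords_linear L)// Bf Bg.
- exists 1 => g hg; have [hBg Bg] := backP hg; rewrite mul1r.
  rewrite -(ler_pXn2r (_ : (0 < 2)%N)) ?nnegrE ?hnorm_ge0//.
  rewrite -lee_fin !hnorm_sq// (sqsum_eq (y := fun i => c g (e i))) ?sqsum_inj_le//.
  by move=> i; rewrite Bg.
Qed.

Lemma back_adjoint : is_adjoint H H S back.
Proof.
move=> f g hf hg; have [hBg Bg] := backP hg; rewrite /hdot; congr (_ * _).
pose A j := `[< exists i, j = e i >].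
have Ae i : A (e i) by apply/asboolP; exists i.
pose K := fine (sqsum (restr (predC A) (c g))).
apply: (@polarization_shift (fun u => hnorm H (S f + u *: g) ^+ 2)
  (fun u => hnorm H (f + u *: back g) ^+ 2) K) => u u1.
have hSf := S_hcar hf.
have h1 : hcar H (S f + u *: g) by apply: hcarD => //; exact: hcarZ.
have h2 : hcar H (f + u *: back g) by apply: hcarD => //; exact: hcarZ.
apply: EFin_inj; rewrite EFinD !hnorm_sq// (sqsum_split A); congr (_ + _)%E.
  rewrite (sqsum_image (e := e))//; last first.
    move=> j hj; rewrite /restr ifN//; apply/asboolPn => -[i ji]; exact: hj ji.
  apply: sqsum_eq => i; rewrite /restr Ae !coordsD ?coordsZ//; try exact: hcarZ.
  by rewrite S_coords// Bg.
rewrite fineK; last first.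
  by rewrite ge0_fin_numE ?sqsum_ge0// (le_lt_trans (sqsum_restr _ _))// (coords_lty L hg).
apply: sqsum_eq => j; rewrite !nc_restr /=; case: (boolP (A j)) => //= /asboolPn hj.
rewrite coordsD ?coordsZ//; last exact: hcarZ.
by rewrite S_zero ?add0r ?ncM ?u1 ?mul1r// => i ji; apply: hj; exists i.
Qed.

(** The adjoint of the isometry sending the basis vector [i] to the basis
    vector [e i] reads off the coordinates at [e i]. *)
Lemma shift_adjoint g : hcar H g ->
  hcar H (adjoint H H S g) /\ forall i, c (adjoint H H S g) i = c g (e i).
Proof. by move=> hg; rewrite (adjointE back_bounded back_adjoint hg); exact: backP. Qed.

End shift.

End one_space.
End coordinates.

(** * Compactness and backward shifts *)

Section compactness_criterion.
Context {R : realType} {d : nat}.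
Local Notation C := R[i].
Local Notation I := ('I_d -> nat).
Context {V : lmodType C} {H : hspace V} {c : V -> I -> C}.
Hypothesis L : l2_coords H c.
Implicit Types (a : I) (f g : V).

Definition raise j (k : 'I_d) a : I := fun i => (a i + (if i == k then j else 0))%N.

Lemma raise0 k a : raise 0 k a = a.
Proof. by apply/funext => i; rewrite /raise; case: ifP; rewrite addn0. Qed.

Lemma raiseD j l k a : raise j k (raise l k a) = raise (j + l) k a.
Proof.
by apply/funext => i; rewrite /raise; case: (i == k); rewrite ?addn0// addnAC addnA.
Qed.

Lemma raise_inj j k : injective (raise j k).
Proof. by move=> a b ab; apply/funext => i; move: (congr1 (fun h => h i) ab); rewrite /raise => /addIn. Qed.

Lemma unraise j k a : (j <= a k)%N -> exists b, a = raise j k b.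
Proof.
move=> jk; exists (fun i => a i - (if i == k then j else 0))%N.
by apply/funext => i; rewrite /raise; case: eqP => [->|_]; rewrite ?subnK// subn0 addn0.
Qed.

Variable E : 'I_d -> V -> V.
Hypothesis E_hcar : forall k f, hcar H f -> hcar H (E k f).
Hypothesis E_bump : forall k f a, hcar H f -> c (E k f) (raise 1 k a) = c f a.
Hypothesis E_zero : forall k f a, hcar H f -> a k = 0%N -> c (E k f) a = 0.

Lemma iter_hcar k j f : hcar H f -> hcar H (iter j (E k) f).
Proof. by move=> hf; elim: j => //= j IH; exact: E_hcar. Qed.

Lemma iter_bump k j f a : hcar H f -> c (iter j (E k) f) (raise j k a) = c f a.
Proof.
move=> hf; elim: j => [|j IH]; first by rewrite raise0.
by rewrite -(add1n j) -raiseD /= E_bump//; exact: iter_hcar.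
Qed.

Lemma iter_zero k j f a : hcar H f -> (a k < j)%N -> c (iter j (E k) f) a = 0.
Proof.
move=> hf; elim: j a => [//|j IH] a; rewrite ltnS => aj /=.
have [a0|a0] := posnP (a k); first by rewrite E_zero//; exact: iter_hcar.
have [b ab] := unraise a0; rewrite ab E_bump; last exact: iter_hcar.
by apply: IH; move: aj; rewrite ab /raise eqxx addn1.
Qed.

Local Notation B k := (adjoint H H (E k)).

Lemma B_coords k g : hcar H g -> hcar H (B k g) /\ forall a, c (B k g) a = c g (raise 1 k a).
Proof.
move=> hg; apply: (shift_adjoint L (@raise_inj 1 k) (E_hcar k)) => //.
  by move=> f a hf; exact: E_bump.
move=> f a hf ha; apply: E_zero => //; apply/eqP; rewrite -leqn0 leqNgt; apply/negP => a0.
by have [b] := unraise a0; exact: ha.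
Qed.

Lemma iterB_coords k j g : hcar H g ->
  hcar H (iter j (B k) g) /\ forall a, c (iter j (B k) g) a = c g (raise j k a).
Proof.
move=> hg; elim: j => [|j [IH1 IH2]] /=; first by split => // a; rewrite raise0.
by have [h1 h2] := B_coords k IH1; split => // a; rewrite h2 IH2 raiseD addn1.
Qed.

(** The shape of [eta] for an arbitrary row of operators. *)
Definition shift_eta j (T : V -> V) : ('I_d -> V) -> ('I_d -> V) :=
  col_op (fun k => iter j (B k)) \o T \o row_op (fun k => iter j (E k)).

Lemma iter_norm k j f : hcar H f -> hnorm H (iter j (E k) f) = hnorm H f.
Proof.
move=> hf; have hi := iter_hcar k j hf.
rewrite !(coords_norm L)//; congr (Num.sqrt (fine _)).
rewrite (sqsum_image (@raise_inj j k)); first by apply: sqsum_eq => a; rewrite iter_bump.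
move=> a ha; apply: iter_zero => //; rewrite ltnNge; apply/negP => aj.
by have [b] := unraise aj; exact: ha.
Qed.

Lemma iterB_norm k j g : hcar H g -> hnorm H (iter j (B k) g) <= hnorm H g.
Proof.
move=> hg; have [h1 h2] := iterB_coords k j hg.
have h2' a : nc (c (iter j (B k) g) a) = nc (c g (raise j k a)) by rewrite h2.
rewrite -(ler_pXn2r (_ : (0 < 2)%N)) ?nnegrE ?(hnorm_ge0 L)// -lee_fin !(hnorm_sq L)//.
rewrite (@sqsum_eq _ _ _ (fun a => c g (raise j k a)) h2').
by apply: sqsum_inj_le; exact: raise_inj.
Qed.

(** A high power of the backward shift only sees indices outside of a finite set
    that carries almost the whole norm of [g]. *)
Lemma iterB_tail k g e : hcar H g -> 0 < e ->
  exists J, forall j, (J <= j)%N -> hnorm H (iter j (B k) g) ^+ 2 <= e.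
Proof.
move=> hg e0; have [s us hs] := sqsum_tail (coords_lty L hg) e0.
exists (\max_(a <- s) a k).+1 => j Jj; have [h1 h2] := iterB_coords k j hg.
rewrite -lee_fin (hnorm_sq L)//; apply: le_trans hs.
rewrite (sqsum_eq (y := fun a => restr (fun i => i \notin s) (c g) (raise j k a))).
  by apply: sqsum_inj_le; exact: raise_inj.
move=> a; rewrite h2 /restr ifT//; apply/negP => bs.
have := @leq_bigmax_seq _ s xpredT (fun a : I => a k) _ bs isT.
rewrite /raise eqxx => h; have := leq_trans Jj (leq_trans (leq_addl (a k) j) h).
by rewrite ltnn.
Qed.

Variable T : V -> V.
Hypothesis hT : bounded_op H H T.

Let T_hcar f : hcar H f -> hcar H (T f). Proof. by case: hT => h _ _; exact: h. Qed.

Let T_lin (a : C) f g : hcar H f -> hcar H g -> T (a *: f + g) = a *: T f + T g.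
Proof. by case: hT => _ h _; exact: h. Qed.

Let T0 : T 0 = 0.
Proof.
have h0 := hcar0 L; have := T_lin (-1) h0 h0.
by rewrite scaler0 addr0 scaleN1r addNr.
Qed.

Let TZ (a : C) f : hcar H f -> T (a *: f) = a *: T f.
Proof. by move=> hf; have := T_lin a hf (hcar0 L); rewrite addr0 T0 addr0. Qed.

Let TD f g : hcar H f -> hcar H g -> T (f + g) = T f + T g.
Proof. by move=> hf hg; have := T_lin 1 hf hg; rewrite !scale1r. Qed.

Let T_bound : exists2 K : R, 0 <= K & forall f, hcar H f -> hnorm H (T f) <= K * hnorm H f.
Proof.
case: hT => _ _ [M hM]; exists (Num.max M 0); first by rewrite le_max lexx orbT.
move=> f hf; apply: (le_trans (hM f hf)); rewrite ler_wpM2r ?(hnorm_ge0 L)//.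
by rewrite le_max lexx.
Qed.

Lemma opnorm_le (W : lmodType C) (K : hspace W) (A : W -> W) (M : R) :
  (forall w, hcar K w -> hnorm K w <= 1 -> hnorm K (A w) <= M) -> (opnorm K K A <= M%:E)%E.
Proof. by move=> h; apply: ge_ereal_sup => y [w [hw nw] <-]; rewrite lee_fin h. Qed.

Lemma opnorm_ge (W : lmodType C) (K : hspace W) (A : W -> W) (M : R) w :
  (opnorm K K A <= M%:E)%E -> hcar K w -> hnorm K w <= 1 -> hnorm K (A w) <= M.
Proof.
move=> h hw nw; rewrite -lee_fin; apply: le_trans h; apply: ereal_sup_ubound.
by exists w.
Qed.

Lemma hsum_norm_sq (h : 'I_d -> V) : hnorm (hsum d H) h ^+ 2 = \sum_k hnorm H (h k) ^+ 2.
Proof. by rewrite sqr_sqrtr// sumr_ge0// => k _; rewrite sqr_ge0. Qed.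

Lemma hsum_norm_ge0 (h : 'I_d -> V) : 0 <= hnorm (hsum d H) h.
Proof. exact: sqrtr_ge0. Qed.

Lemma sum_norm_sq (s : seq 'I_d) (F : 'I_d -> V) : (forall k, hcar H (F k)) ->
  hnorm H (\sum_(k <- s) F k) ^+ 2 <= 2 ^+ size s * \sum_(k <- s) hnorm H (F k) ^+ 2.
Proof.
move=> hF; elim: s => [|k s IH].
  rewrite !big_nil mulr0 -lee_fin (hnorm_sq L (hcar0 L)) /sqsum esum1// => i _.
  by rewrite (coords0 L) nc0 expr0n.
rewrite !big_cons; apply: (le_trans (hnorm_sqD L (hF k) (hcar_sum L s hF))).
rewrite /= [2 ^+ _]exprS -mulrDr -mulrA ler_pM2l// mulrDr; apply: lerD => //.
by rewrite ler_peMl ?sqr_ge0// exprn_ege1// ler1n.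
Qed.

Lemma ereal_squeeze0 (u : nat -> \bar R) : (forall n, (0 <= u n)%E) ->
  (forall e : R, 0 < e -> exists N, forall n, (N <= n)%N -> (u n <= e%:E)%E) ->
  u n @[n --> \oo] --> 0%E.
Proof.
move=> u0 hu; have fu : \forall n \near \oo, u n \is a fin_num.
  have [N hN] := hu 1 ltr01; exists N => // n /= /hN h.
  by rewrite ge0_fin_numE// (le_lt_trans h)// ltry.
apply: cvg_EFin => //; apply/cvgrPdist_le => e /hu[N hN]; exists N => // n /= /hN h.
rewrite sub0r normrN ger0_norm ?fine_ge0//.
have fn : u n \is a fin_num by rewrite ge0_fin_numE// (le_lt_trans h)// ltry.
by rewrite -lee_fin fineK.
Qed.

Lemma opnorm_eta_ge0 j : (0 <= opnorm (hsum d H) (hsum d H) (shift_eta j T))%E.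
Proof.
apply: (@le_trans _ _ (hnorm (hsum d H) (shift_eta j T (fun=> 0)))%:E).
  by rewrite lee_fin hsum_norm_ge0.
apply: ereal_sup_ubound; exists (fun=> 0) => //; split => [k|]; first exact: (hcar0 L).
rewrite -(ler_pXn2r (_ : (0 < 2)%N)) ?nnegrE ?hsum_norm_ge0// hsum_norm_sq big1 ?expr1n// => k _.
apply/eqP; rewrite -eqe (hnorm_sq L (hcar0 L)) /sqsum esum1// => i _.
by rewrite (coords0 L) nc0 expr0n.
Qed.

(** If the convergence were not uniform, a sequence of vectors [x_j] in the
    unit ball with large backward shifts of [T x_j] would contradict the
    strong convergence at a limit point of [T x_j]. *)
Lemma compact_uniform k (D e : R) : compact_op H H T -> 0 < e ->
  exists J, forall j u, (J <= j)%N -> hcar H u -> hnorm H u <= D ->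
    hnorm H (iter j (B k) (T u)) ^+ 2 <= e.
Proof.
move=> [_ cT] e0; apply: contrapT => /forallNP nJ.
have /choice[z zP] : forall J : nat, exists ju : nat * V, [/\ (J <= ju.1)%N, hcar H ju.2,
    hnorm H ju.2 <= D & e < hnorm H (iter ju.1 (B k) (T ju.2)) ^+ 2].
  move=> J; have /existsNP[j /existsNP[u]] := nJ J.
  move=> /not_implyP[h1 /not_implyP[h2 /not_implyP[h3 /negP]]].
  by rewrite -ltNge => h4; exists (j, u).
have [|phi phi_mono [g hg cvg_g]] := cT (fun n => (z n).2) (fun n => let: And4 _ h _ _ := zP n in h).
  by exists D => n; have [] := zP n.
have e4 : 0 < e / 8 by rewrite divr_gt0.
have [J hJ] := iterB_tail k hg e4.
have s0 : 0 < Num.min 1 (e / 8) by rewrite lt_min ltr01.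
have /cvgrPdist_le /(_ _ s0)[N _ hN] := cvg_g.
pose n := maxn N J.
have phi_ge n' : (n' <= phi n')%N.
  by elim: n' => // n' IH; rewrite (leq_ltn_trans IH)// phi_mono.
have phin := phi_ge n.
have [h1 h2 h3 h4] := zP (phi n).
set j := (z (phi n)).1 in h1 h4; set u := (z (phi n)).2 in h2 h3 h4.
have hTu := T_hcar h2; have hd := hcarB L hTu hg.
have [hb1 b1] := iterB_coords k j hd; have [hb2 b2] := iterB_coords k j hg.
have [hb3 b3] := iterB_coords k j hTu.
have E1 : iter j (B k) (T u) = iter j (B k) (T u - g) + iter j (B k) g.
  apply: (coords_inj L) => // [|a]; first exact: (hcarD L).
  by rewrite (coordsD L)// b1 b2 b3 (coordsB L)// subrK.
have Jj : (J <= j)%N by rewrite (leq_trans _ h1)// (leq_trans _ phin)// leq_maxr.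
have := hN n (leq_maxl _ _); rewrite sub0r normrN ger0_norm ?(hnorm_ge0 L)// -/u.
rewrite le_min => /andP[d1 d2].
have d3 : hnorm H (iter j (B k) (T u - g)) ^+ 2 <= e / 8.
  apply: (@le_trans _ _ (hnorm H (T u - g) ^+ 2)).
    by rewrite lerXn2r ?nnegrE ?(hnorm_ge0 L)// iterB_norm.
  apply: le_trans d2; rewrite expr2 -[leRHS]mulr1 ler_wpM2l// (hnorm_ge0 L)//.
have := hnorm_sqD L hb1 hb2; rewrite -E1; have := hJ j Jj; lra.
Qed.

Lemma compact_eta : compact_op H H T ->
  opnorm (hsum d H) (hsum d H) (shift_eta j T) @[j --> \oo] --> 0%E.
Proof.
move=> cT; apply: ereal_squeeze0 => [j|e e0]; first exact: opnorm_eta_ge0.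
pose D : R := Num.sqrt (2 ^+ d).
have D2 : D ^+ 2 = 2 ^+ d by rewrite sqr_sqrtr// exprn_ge0.
have e2 : 0 < e ^+ 2 / d.+1%:R by rewrite divr_gt0// exprn_gt0.
have /choice[J hJ] := fun k => compact_uniform k D cT e2.
exists (\max_k J k) => j Jj; apply: opnorm_le => h hh nh.
have hw : hcar H (row_op (fun k => iter j (E k)) h).
  by apply: (hcar_sum L) => k; apply: iter_hcar; exact: hh.
have nw : hnorm H (row_op (fun k => iter j (E k)) h) <= D.
  rewrite -(ler_pXn2r (_ : (0 < 2)%N)) ?nnegrE ?(hnorm_ge0 L) ?sqrtr_ge0// D2.
  apply: (le_trans (sum_norm_sq (index_enum 'I_d) _)) => [k|]; first by apply: iter_hcar; exact: hh.
  rewrite /index_enum -enumT size_enum_ord ler_piMr ?exprn_ge0//.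
  rewrite big_enum /= (eq_bigr (fun k => hnorm H (h k) ^+ 2)); last first.
    by move=> k _; rewrite iter_norm//; exact: hh.
  by rewrite -hsum_norm_sq exprn_ile1// hsum_norm_ge0.
rewrite -(ler_pXn2r (_ : (0 < 2)%N)) ?nnegrE ?hsum_norm_ge0 ?(ltW e0)// hsum_norm_sq.
apply: (@le_trans _ _ (\sum_(k < d) e ^+ 2 / d.+1%:R)).
  by apply: ler_sum => k _; apply: hJ => //; rewrite (leq_trans _ Jj)// leq_bigmax.
rewrite sumr_const card_ord -[_ *+ d]mulr_natr -mulrA ler_piMr ?sqr_ge0//.
by rewrite mulrC ler_pdivrMr ?ltr0n// mul1r ler_nat.
Qed.

Lemma sum_sqsum (J : finType) (x : J -> I -> C) :
  (\sum_(k : J) sqsum (x k) = \esum_(a in [set: I]) (\sum_(k : J) nc (x k a) ^+ 2)%R%:E)%E.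
Proof.
rewrite /sqsum -esum_sum; last by move=> a k _ _; rewrite lee_fin sqr_ge0.
by apply: eq_esum => a _; rewrite sumEFin.
Qed.

Lemma finite_cauchy (s : seq I) (y : nat -> I -> C) (l : I -> C) (e : R) :
  (forall a, clim (fun n => y n a) (l a)) -> 0 < e -> exists N, forall n p, (N <= n)%N -> (N <= p)%N ->
    \sum_(a <- s) nc (y n a - y p a) ^+ 2 <= e.
Proof.
move=> hy; elim: s e => [|a s IH] e e0; first by exists 0%N => n p _ _; rewrite big_nil ltW.
have e2 : 0 < e / 2 by rewrite divr_gt0.
have [N1 h1] := IH _ e2.
have m0 : 0 < Num.min 1 (e / 8) by rewrite lt_min ltr01 divr_gt0.
have [N2 h2] := hy a _ m0.
exists (maxn N1 N2) => n p; rewrite !geq_max => /andP[n1 n2] /andP[p1 p2].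
rewrite big_cons [e]splitr; apply: lerD; last exact: h1.
have hq q : (N2 <= q)%N -> nc (y q a - l a) ^+ 2 <= e / 8.
  move=> /h2; rewrite le_min => /andP[d1 d2]; apply: le_trans d2.
  by rewrite expr2 -[leRHS]mulr1 ler_wpM2l// nc_ge0.
have -> : y n a - y p a = (y n a - l a) + (l a - y p a) by ring.
have := nc_sqD (y n a - l a) (l a - y p a); have := hq n n2; have := hq p p2.
by rewrite (ncC (l a)); lra.
Qed.

(** The range of the row of shifts consists of the vectors whose coordinates vanish on
    the box of side [j]: each remaining index is charged to one direction in which
    it leaves the box. *)
Lemma eta_outside_box j (e : R) x : 0 <= e ->
  (opnorm (hsum d H) (hsum d H) (shift_eta j T) <= e%:E)%E ->
  hcar H x -> hnorm H x <= 1 -> (forall a, (forall k, a k < j)%N -> c x a = 0) ->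
  (sqsum (restr (fun a => ~~ [forall k, (a k < j)%N]) (c (T x))) <= (e ^+ 2)%:E)%E.
Proof.
move=> e0 he hx nx x0.
pose sel a := [pick l | (j <= a l)%N].
pose xl l := restr (fun a => sel a == Some l) (c x).
have /choice[h hP] : forall l, exists h, hcar H h /\ forall a, c h a = xl l (raise j l a).
  move=> l; have [|h hh hE] := coords_surj L (x := fun a => xl l (raise j l a)); last by exists h.
  apply: le_lt_trans (sqsum_inj_le _ (@raise_inj j l)) _.
  exact: le_lt_trans (sqsum_restr _ _) (coords_lty L hx).
have hE : row_op (fun k => iter j (E k)) h = x.
  have hi l : hcar H (iter j (E l) (h l)) by apply: iter_hcar; have [] := hP l.
  apply: (coords_inj L) => // [|a]; first exact: (hcar_sum L).
  rewrite /row_op (coords_sum L)//.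
  have E1 l : c (iter j (E l) (h l)) a = if sel a == Some l then c x a else 0.
    have [hl1 hl2] := hP l; have [ja|ja] := leqP j (a l).
      by have [b ->] := unraise ja; rewrite iter_bump// hl2.
    rewrite iter_zero//; case: eqP => //; rewrite /sel; case: pickP => // l' jl' [ll'].
    by move: ja; rewrite -ll' ltnNge jl'.
  rewrite (eq_bigr _ (fun l _ => E1 l)) /sel; case: pickP => [l jl|nl].
    rewrite (bigD1 l)//= eqxx big1 ?addr0// => l' ll'; rewrite ifN//.
    by apply: contraNneq ll' => -[->].
  by rewrite big1// x0// => k; rewrite ltnNge nl.
have nh : hnorm (hsum d H) h <= 1.
  rewrite -(ler_pXn2r (_ : (0 < 2)%N)) ?nnegrE ?hsum_norm_ge0// hsum_norm_sq expr1n.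
  apply: (@le_trans _ _ (hnorm H x ^+ 2)); last by rewrite exprn_ile1// (hnorm_ge0 L).
  rewrite -lee_fin -sumEFin (hnorm_sq L hx).
  apply: (@le_trans _ _ (\sum_(l < d) sqsum (xl l))%E).
    apply: lee_sum => l _; have [hl1 hl2] := hP l; rewrite (hnorm_sq L hl1).
    rewrite (@sqsum_eq _ _ _ (fun a => xl l (raise j l a))); last by move=> a; rewrite hl2.
    by apply: sqsum_inj_le; exact: raise_inj.
  rewrite sum_sqsum; apply: le_esum => a _; rewrite lee_fin.
  case E2 : (sel a) => [l|].
    rewrite (bigD1 l)//= big1 ?addr0; first by rewrite nc_restr; case: ifP; rewrite ?expr0n ?sqr_ge0.
    move=> l' ll'; rewrite nc_restr E2 ifN ?expr0n//.
    by apply: contraNneq ll' => -[->].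
  by rewrite big1 ?sqr_ge0// => l _; rewrite nc_restr E2 expr0n.
have hh : hcar (hsum d H) h by move=> l; have [] := hP l.
have := opnorm_ge he hh nh.
have -> : shift_eta j T h = fun k => iter j (B k) (T x) by rewrite /shift_eta /= hE.
rewrite -(ler_pXn2r (_ : (0 < 2)%N)) ?nnegrE ?hsum_norm_ge0// hsum_norm_sq -lee_fin.
apply: le_trans; rewrite -sumEFin; have hTx := T_hcar hx.
apply: (@le_trans _ _ (\sum_(k < d) sqsum (restr (fun a => (j <= a k)%N) (c (T x))))%E).
  rewrite sum_sqsum; apply: le_esum => a _; rewrite lee_fin nc_restr.
  case: ifP => [|_]; last by rewrite expr0n sumr_ge0// => k _; rewrite sqr_ge0.
  move=> /forallPn[k]; rewrite -leqNgt => jk; rewrite (bigD1 k)//= nc_restr jk.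
  by rewrite lerDl sumr_ge0// => k' _; rewrite sqr_ge0.
apply: lee_sum => k _; have [hb1 hb2] := iterB_coords k j hTx.
rewrite (hnorm_sq L hb1) (sqsum_image (@raise_inj j k)); last first.
  move=> a ha; rewrite /restr ifN//; apply/negP => ja; have [b] := unraise ja; exact: ha.
apply: sqsum_mono => a; rewrite nc_restr hb2; case: ifP => // _; exact: nc_ge0.
Qed.

Lemma index_enumeration : exists en : nat -> I, forall a, exists n, en n = a.
Proof.
exists (fun n => if unpickle n is Some b then fun i => (b : {ffun 'I_d -> nat}) i else fun=> 0%N).
move=> a; exists (pickle (finfun a)); rewrite pickleK.
by apply/funext => i; rewrite ffunE.
Qed.

(** A difference [v] of two terms of the diagonal sequence is split into its
    part in a large box, which is small since the coordinates converge, and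
    the rest, which [eta_outside_box] controls outside of the box; inside of
    the box the coordinates of the images converge. *)
Lemma eta_compact :
  opnorm (hsum d H) (hsum d H) (shift_eta j T) @[j --> \oo] --> 0%E -> compact_op H H T.
Proof.
move=> cvg_eta; split=> // u hu [M0 hM0].
pose M := Num.max M0 1; have M1 : 0 < M by rewrite lt_max ltr01 orbT.
have hM n : hnorm H (u n) <= M by rewrite le_max hM0.
have [K K0 hK] := T_bound; have hTu n : hcar H (T (u n)) by exact: T_hcar.
have [en enP] := index_enumeration.
pose w n k := if odd k then c (T (u n)) (en k./2) else c (u n) (en k./2).
have [|phi phi_mono [l lP]] := @diagonal_subsequence R w (fun=> K * M + M).
  move=> n k; have KM : 0 <= K * M by rewrite mulr_ge0// ltW.
  rewrite /w; case: ifP => _.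
    apply: le_trans (coord_le L _ (hTu n)) _; apply: le_trans (hK _ (hu n)) _.
    by rewrite -[leLHS]addr0 lerD ?ler_wpM2l// ltW.
  apply: le_trans (coord_le L _ (hu n)) _; apply: le_trans (hM n) _.
  by rewrite lerDr.
exists phi => //.
have /choice[l1 h1] : forall a, exists l1, clim (fun n => c (u (phi n)) a) l1.
  move=> a; have [k ka] := enP a; exists (l k.*2); apply: clim_eq (lP k.*2) => n.
  by rewrite /w odd_double doubleK ka.
have /choice[l2 h2] : forall a, exists l2, clim (fun n => c (T (u (phi n))) a) l2.
  move=> a; have [k ka] := enP a; exists (l k.*2.+1); apply: clim_eq (lP k.*2.+1) => n.
  by rewrite /w /= odd_double /= uphalf_double ka.
have cauchy e : 0 < e -> exists N, forall n p, (N <= n)%N -> (N <= p)%N ->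
    hnorm H (T (u (phi n)) - T (u (phi p))) ^+ 2 <= e.
  move=> e0.
  have k1 : 0 < 2 * K ^+ 2 + 1 by rewrite ltr_wpDl// mulr_ge0// sqr_ge0.
  have e1 : 0 < e / 3 / (2 * K ^+ 2 + 1) by rewrite !divr_gt0.
  have e2 : 0 < e / 3 by rewrite divr_gt0.
  pose dl := Num.sqrt (e / 24) / M.
  have dl0 : 0 < dl by rewrite divr_gt0// sqrtr_gt0 divr_gt0.
  have [j hj] : exists j, (opnorm (hsum d H) (hsum d H) (shift_eta j T) <= dl%:E)%E.
    have /fine_cvgP[[N1 _ hN1] /cvgrPdist_le /(_ _ dl0)[N2 _ hN2]] := cvg_eta.
    exists (maxn N1 N2); have := hN2 _ (leq_maxr N1 N2).
    have fn := hN1 _ (leq_maxl N1 N2).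
    rewrite /= sub0r normrN ger0_norm ?fine_ge0 ?opnorm_eta_ge0//.
    by rewrite -lee_fin fineK.
  pose s : seq I := [seq (fun i => (b : {ffun 'I_d -> 'I_j.+1}) i : nat) | b <- enum {ffun 'I_d -> 'I_j.+1}].
  have us : uniq s by exact: box_uniq.
  have [N1 hN1] := finite_cauchy s h1 e1.
  have [N2 hN2] := finite_cauchy s h2 e2.
  exists (maxn N1 N2) => n p; rewrite !geq_max => /andP[n1 n2] /andP[p1 p2].
  pose v := u (phi n) - u (phi p).
  have hv : hcar H v by exact: (hcarB L).
  have TvE : T (u (phi n)) - T (u (phi p)) = T v.
    have hN := hcarZ L (-1) (hu (phi p)).
    by rewrite /v -[- u (phi p)]scaleN1r TD// TZ// scaleN1r.
  rewrite TvE; have hTv := T_hcar hv.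
  have nv : hnorm H v <= 2 * M.
    rewrite -(ler_pXn2r (_ : (0 < 2)%N)) ?nnegrE ?(hnorm_ge0 L)// ?mulr_ge0 ?(ltW M1)//.
    have hN := hcarZ L (-1) (hu (phi p)).
    have := hnorm_sqD L (hu (phi n)) hN; rewrite scaleN1r -/v -scaleN1r (hnormZ L)// ncN nc1 mul1r.
    have sq k : hnorm H (u k) ^+ 2 <= M ^+ 2.
      by rewrite lerXn2r ?nnegrE ?(hnorm_ge0 L)// ltW.
    have := sq (phi n); have := sq (phi p); rewrite (_ : (2 * M) ^+ 2 = 4 * M ^+ 2); last by ring.
    move: (hnorm H (u (phi n)) ^+ 2) (hnorm H (u (phi p)) ^+ 2) (hnorm H v ^+ 2) (hnorm H _ ^+ 2) (M ^+ 2) => q1 q2 q3 q4 q5; clear hj cvg_eta; lra.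
  have [|v1 hv1 v1E] := coords_surj L (x := restr (fun a => a \in s) (c v)).
    exact: le_lt_trans (sqsum_restr _ _) (coords_lty L hv).
  pose v2 := v - v1; have hv2 : hcar H v2 by exact: (hcarB L).
  have v2E a : c v2 a = restr (fun a => a \notin s) (c v) a.
    by rewrite (coordsB L)// v1E /restr; case: (a \in s); rewrite ?subrr ?subr0.
  have TE : T v = T v1 + T v2 by rewrite -TD// /v2 addrC subrK.
  have nv1 : hnorm H v1 ^+ 2 <= e / 3 / (2 * K ^+ 2 + 1).
    apply: le_trans (hN1 n p n1 p1); rewrite -lee_fin (hnorm_sq L hv1).
    apply: le_trans (sqsum_support us _) _; first by move=> a as_; rewrite v1E /restr (negbTE as_).
    rewrite lee_fin big_seq [leRHS]big_seq; apply: ler_sum => a as_.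
    by rewrite v1E /restr as_ (coordsB L).
  pose A a := [forall k, (a k < j)%N].
  have partA : (sqsum (restr A (c (T v))) <= (e / 3)%:E)%E.
    apply: (@le_trans _ _ (\sum_(a <- s) nc (c (T v) a) ^+ 2)%:E).
      apply: le_trans (sqsum_support us _) _.
        move=> a as_; rewrite /restr ifN//; apply: contraNN as_ => /forallP aj.
        by apply: mem_box => i; rewrite ltnW.
      by rewrite lee_fin; apply: ler_sum => a _; rewrite lerXn2r ?nnegrE ?nc_ge0// nc_restr; case: ifP; rewrite ?nc_ge0.
    rewrite lee_fin; apply: le_trans (hN2 n p n2 p2); apply: ler_sum => a _.
    by rewrite -TvE (coordsB L).
  have part1 : (sqsum (restr (predC A) (c (T v1))) <= (K ^+ 2 * (e / 3 / (2 * K ^+ 2 + 1)))%:E)%E.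
    apply: le_trans (sqsum_restr _ _) _; rewrite -(hnorm_sq L (T_hcar hv1)) lee_fin.
    apply: (@le_trans _ _ ((K * hnorm H v1) ^+ 2)).
      by rewrite lerXn2r ?nnegrE ?mulr_ge0 ?(hnorm_ge0 L)// ?hK//; exact: T_hcar.
    by rewrite exprMn ler_wpM2l// sqr_ge0.
  have part2 : (sqsum (restr (predC A) (c (T v2))) <= (e / 6)%:E)%E.
    pose x := ((2 * M)^-1)%:C%C *: v2.
    have MC : 0 < 2 * M by rewrite mulr_gt0.
    have hx : hcar H x by exact: (hcarZ L).
    have nv2 : hnorm H v2 <= 2 * M.
      apply: le_trans nv; rewrite -(ler_pXn2r (_ : (0 < 2)%N)) ?nnegrE ?(hnorm_ge0 L)//.
      rewrite -lee_fin !(hnorm_sq L)// (@sqsum_eq _ _ _ (restr (fun a => a \notin s) (c v))).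
        exact: sqsum_restr.
      by move=> a; rewrite v2E.
    have nx : hnorm H x <= 1.
      by rewrite (hnormZ L)// nc_real ger0_norm ?invr_ge0 ?(ltW MC)// mulrC ler_pdivrMr// mul1r.
    have x0 a : (forall k, a k < j)%N -> c x a = 0.
      move=> aj; rewrite (coordsZ L)// v2E /restr ifN ?mulr0// negbK.
      by apply: mem_box => i; rewrite ltnW.
    have := eta_outside_box (ltW dl0) hj hx nx x0.
    have v2x : T v2 = (2 * M)%:C%C *: T x.
      rewrite -TZ// /x scalerA -rmorphM /= mulfV ?scale1r// gt_eqF//.
    move=> hb; apply: (@le_trans _ _ (((2 * M) ^+ 2)%:E * (dl ^+ 2)%:E)%E); last first.
      rewrite -EFinM lee_fin /dl !exprMn exprVn sqr_sqrtr ?divr_ge0 ?(ltW e0)//.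
      by rewrite le_eqVlt; apply/orP; left; apply/eqP; field; rewrite gt_eqF.
    apply: (@le_trans _ _ (((2 * M) ^+ 2)%:E * sqsum (restr (fun a => ~~ A a) (c (T x))))%E); last first.
      by apply: lee_wpmul2l; rewrite ?lee_fin ?sqr_ge0.
    apply: sqsum_le => s' us'.
    apply: (@le_trans _ _ (((2 * M) ^+ 2)%:E * (\sum_(a <- s') nc (restr (fun a => ~~ A a) (c (T x)) a) ^+ 2)%R%:E)%E); last first.
      by apply: lee_wpmul2l; [rewrite lee_fin sqr_ge0|exact: sqsum_ge].
    rewrite -EFinM lee_fin mulr_sumr; apply: ler_sum => a _; rewrite !nc_restr /=.
    case: (A a) => /=; first by rewrite expr0n mulr0.
    rewrite v2x (coordsZ L); last exact: T_hcar.
    by rewrite ncM nc_real exprMn ger0_norm// ltW.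
  rewrite -lee_fin (hnorm_sq L hTv) (sqsum_split A).
  have hC : (sqsum (restr (predC A) (c (T v))) <= (e / 3 + e / 3)%:E)%E.
    rewrite (@sqsum_eq _ _ _ (fun a => restr (predC A) (c (T v1)) a + restr (predC A) (c (T v2)) a)); last first.
      move=> a; rewrite TE /restr; case: (predC A a); last by rewrite addr0.
      by rewrite (coordsD L)//; exact: T_hcar.
    apply: le_trans (sqsumD _ _) _.
    apply: le_trans (leeD (leeD part1 part1) (leeD part2 part2)) _.
    rewrite -!EFinD lee_fin; apply: lerD; last by lra.
    rewrite -mulrDl.
    have -> : (K ^+ 2 + K ^+ 2) * (e / 3 / (2 * K ^+ 2 + 1)) = e / 3 * ((2 * K ^+ 2) / (2 * K ^+ 2 + 1)).
      by field; rewrite gt_eqF.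
    rewrite -[leRHS]mulr1 ler_wpM2l ?(ltW e2)// ler_pdivrMr// mul1r lerDl//.
  apply: le_trans (leeD partA hC) _; rewrite -EFinD lee_fin.
  by lra.
have lim_b n e : 0 < e -> (exists N, forall p, (N <= p)%N -> hnorm H (T (u (phi n)) - T (u (phi p))) ^+ 2 <= e) ->
    (sqsum (fun a => (c (T (u (phi n))) a - l2 a)%R) <= e%:E)%E.
  move=> e0 [N hN].
  apply: (@sqsum_fatou _ _ (fun p a => c (T (u (phi n))) a - c (T (u (phi p))) a)).
    by move=> a; apply: climB; [exact: clim_cst|exact: h2].
  exists N => p /hN; rewrite -lee_fin (hnorm_sq L); last exact: (hcarB L).
  apply: le_trans; rewrite (@sqsum_eq _ _ _ (c (T (u (phi n)) - T (u (phi p)))))//.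
  by move=> a; rewrite (coordsB L).
have l2_lty : (sqsum l2 < +oo)%E.
  have [N hN] := cauchy 1 ltr01.
  have hb := lim_b N 1 ltr01 (ex_intro _ N (fun p Np => hN N p (leqnn N) Np)).
  rewrite (@sqsum_eq _ _ _ (fun a => c (T (u (phi N))) a + -1 * (c (T (u (phi N))) a - l2 a))).
    apply: sqsum_lty_D; first exact: (coords_lty L).
    by apply: sqsumZ_lty; apply: le_lt_trans hb _; rewrite ltry.
  by move=> a; congr nc; ring.
have [g hg gE] := coords_surj L l2_lty.
exists g => //; apply/cvgrPdist_le => e e0.
have e2 : 0 < e ^+ 2 by rewrite exprn_gt0.
have [N hN] := cauchy _ e2; exists N => // n /= Nn.
have hd : hcar H (T (u (phi n)) - g) by exact: (hcarB L).
rewrite sub0r normrN ger0_norm ?(hnorm_ge0 L)//.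
rewrite -(ler_pXn2r (_ : (0 < 2)%N)) ?nnegrE ?(hnorm_ge0 L) ?(ltW e0)//.
rewrite -lee_fin (hnorm_sq L hd).
have := lim_b n (e ^+ 2) e2 (ex_intro _ N (fun p Np => hN n p Nn Np)).
apply: le_trans; rewrite (@sqsum_eq _ _ _ (fun a => c (T (u (phi n))) a - l2 a))//.
by move=> a; rewrite (coordsB L)// gE.
Qed.

End compactness_criterion.

(** * Uniqueness of power series *)

Section power_series.
Context {R : realType} {m : nat}.
Local Notation C := R[i].
Implicit Types (z : 'rV[C]_m) (F G : 'rV[C]_m -> C) (a : 'I_m -> nat) (c : ('I_m -> nat) -> C).

(** An expansion on the open polydisc, with the growth that makes it converge
    absolutely on smaller polydiscs. *)
Definition has_ps c F :=
  (forall r : R, 0 < r < 1 -> exists M : R, forall a, nc (c a) * r ^+ degree a <= M) /\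
  forall z, (forall k, nc (z 0 k) < 1) ->
    clim (fun N => boxsum N (fun a => c a * mono a z)) (F z).

Lemma boxsumD (V : nmodType) N (g h : ('I_m -> nat) -> V) :
  boxsum N (fun a => g a + h a) = boxsum N g + boxsum N h.
Proof. exact: big_split. Qed.

Lemma eq_boxsum (V : nmodType) N (g h : ('I_m -> nat) -> V) : (forall a, g a = h a) ->
  boxsum N g = boxsum N h.
Proof. by move=> gh; congr boxsum; apply/funext. Qed.

Lemma has_ps_taylor F : hol F -> has_ps (taylor F) F.
Proof.
move=> hF; split=> [r r01|z hz]; last exact: taylor_series.
have /andP[r0 r1] := r01; have [M M0 hM] := hol_bounded r1 hF.
exists (2 ^+ m * M) => a; rewrite -ler_pdivlMr ?exprn_gt0//; exact: taylor_le.
Qed.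

Lemma has_psD x c c' F G : has_ps c F -> has_ps c' G ->
  has_ps (fun a => x * c a + c' a) (fun z => x * F z + G z).
Proof.
move=> [gc hc] [gc' hc']; split=> [r r01|z hz].
  have [M hM] := gc r r01; have [M' hM'] := gc' r r01.
  exists (nc x * M + M') => a; have /andP[r0 _] := r01.
  apply: (@le_trans _ _ (nc x * (nc (c a) * r ^+ degree a) + nc (c' a) * r ^+ degree a)).
    by rewrite mulrA -mulrDl ler_wpM2r ?exprn_ge0 ?(ltW r0)// -ncM ncD.
  by rewrite lerD// ler_wpM2l ?nc_ge0.
apply: clim_eq (climD (climZ x (hc z hz)) (hc' z hz)) => N.
by rewrite -boxsumZ -boxsumD; apply: eq_boxsum => a; rewrite mulrDl mulrA.
Qed.

Lemma has_ps_ext c F G : (forall z, (forall k, nc (z 0 k) < 1) -> F z = G z) ->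
  has_ps c F -> has_ps c G.
Proof. by move=> FG [gc hc]; split=> // z hz; rewrite -FG//; exact: hc. Qed.

Lemma growth_dominated c (r s : R) : (forall r : R, 0 < r < 1 -> exists M : R, forall a, nc (c a) * r ^+ degree a <= M) ->
  0 <= r -> r < s -> s < 1 -> exists M : R, forall a, nc (c a) * r ^+ degree a <= M * (r / s) ^+ degree a.
Proof.
move=> gc r0 rs s1; have s0 : 0 < s by exact: le_lt_trans rs.
have [M hM] := gc s (introT andP (conj s0 s1)); exists M => a.
rewrite expr_div_n mulrA [leRHS]mulrAC ler_wpM2r ?exprn_ge0// ler_pdivlMr ?exprn_gt0//.
Qed.

(** By Parseval's formula on a small torus the square sum of the weighted
    coefficients of the zero function vanishes. *)
Lemma has_ps0 c : has_ps c (fun=> 0) -> forall a, c a = 0.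
Proof.
move=> [gc hc] a.
have [M hM] := @growth_dominated c (1 / 4) (1 / 2) gc ltac:(lra) ltac:(lra) ltac:(lra).
have q0 : 0 <= (1 / 4 / (1 / 2) : R) by lra.
have q1 : (1 / 4 / (1 / 2) : R) < 1 by lra.
have r0 : 0 <= (1 / 4 : R) by lra.
have := @parseval_series R m c (fun=> 0) M _ (1 / 4) r0 q0 q1 hM.
have h0 : forall a, nc (0 : C) * (1 / 4) ^+ degree a <= 0 * (1 / 4 / (1 / 2)) ^+ degree a.
  by move=> b; rewrite nc0 !mul0r.
have := @parseval_series R m (fun=> 0) (fun=> 0) 0 _ (1 / 4) r0 q0 q1 h0.
set T := tint _ => A B.
have A' : (boxsum N (fun b : 'I_m -> nat => (nc (0 : C) * (1 / 4) ^+ degree b) ^+ 2))%:E @[N --> \oo] --> T.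
  by apply: A => t; apply: clim_eq (clim_cst 0) => N; rewrite [RHS]big1// => b _; exact: mul0r.
have {A A'} T0 : T = 0%E.
  have z0 : (fun N => (boxsum N (fun b : 'I_m -> nat => (nc (0 : C) * (1 / 4) ^+ degree b) ^+ 2))%:E) = fun=> 0%E.
    by apply/funext => N; rewrite /boxsum big1// => b _; rewrite nc0 mul0r expr0n.
  by move: A'; rewrite z0 => /(cvg_lim (@ereal_hausdorff R)) <-; rewrite lim_cst.
have {}B := B (fun t => hc _ (polydisc_lt1 (ltac:(lra) : (1 / 4 : R) < 1) (cpt_polydisc _ r0))).
suff : nc (c a) == 0 by rewrite nc_eq0 => /eqP.
apply/eqP; set Q := nc (c a).
have key : (((Q * (1 / 4) ^+ degree a) ^+ 2)%:E <= 0%:E)%E.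
  rewrite -[leRHS]T0; apply: (cvge_ge _ B).
  exists (\max_i a i)%N => // N /= hN; rewrite lee_fin boxsum_seq.
  apply: (@le_trans _ _ (\sum_(b <- [:: a]) (nc (c b) * (1 / 4) ^+ degree b) ^+ 2)); first by rewrite big_seq1.
  have sub : {subset [:: a] <= [seq (fun i => (b : {ffun 'I_m -> 'I_N.+1}) i : nat) | b <- enum {ffun 'I_m -> 'I_N.+1}]}.
    move=> b; rewrite inE => /eqP ->; apply: mem_box => i.
    by apply: leq_trans hN; exact: (@leq_bigmax _ (fun i => a i)).
  apply: (@ler_sum_sub _ _ _ _ _ _ (box_uniq m N) sub) => // b; exact: sqr_ge0.
move: key; rewrite lee_fin => key.
have : (Q * (1 / 4) ^+ degree a) ^+ 2 == 0 by rewrite eq_le key sqr_ge0.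
by rewrite sqrf_eq0 mulf_eq0 expf_eq0 => /orP[/eqP//|/andP[_ /eqP h]]; exfalso; lra.
Qed.

Lemma has_ps_unique c c' F G : (forall z, (forall k, nc (z 0 k) < 1) -> F z = G z) ->
  has_ps c F -> has_ps c' G -> forall a, c a = c' a.
Proof.
move=> FG hc hc' a.
have h : has_ps (fun a => -1 * c' a + c a) (fun=> 0).
  by apply: has_ps_ext (has_psD (-1) hc' hc) => z hz; rewrite FG// mulN1r addNr.
by have /eqP := has_ps0 h a; rewrite mulN1r addrC subr_eq0 => /eqP.
Qed.

Lemma taylorE c F : hol F -> has_ps c F -> forall a, taylor F a = c a.
Proof. by move=> hF; apply: has_ps_unique (has_ps_taylor hF). Qed.

Lemma has_ps_psum c (M : R) : (forall a, nc (c a) <= M) -> has_ps c (psum c).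
Proof.
move=> hM; split=> [r /andP[r0 r1]|z hz]; last exact: (psum_clim hM).
exists M => a; apply: le_trans (hM a); apply: ler_piMr; rewrite ?nc_ge0//.
by apply: exprn_ile1; exact: ltW.
Qed.

Lemma boxsum_perm (V : nmodType) (s : 'S_m) N (g : ('I_m -> nat) -> V) :
  boxsum N (fun a => g (a \o s)) = boxsum N g.
Proof.
rewrite [RHS](reindex_inj (h := fun b : {ffun 'I_m -> 'I_N.+1} => [ffun i => b (s i)])).
  by apply: eq_bigr => b _; congr g; apply/funext => i /=; rewrite ffunE.
move=> b b' /ffunP e; apply/ffunP => i; have := e (s^-1 i)%g.
by rewrite !ffunE permKV.
Qed.

Lemma degree_perm (s : 'S_m) a : degree (a \o s) = degree a.
Proof. by rewrite /degree [RHS](reindex_inj (@perm_inj _ s)). Qed.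

Lemma mono_perm (s : 'S_m) a z : mono (a \o s) (col_perm s z) = mono a z.
Proof.
rewrite /mono [RHS](reindex_inj (@perm_inj _ s)); apply: eq_bigr => i _.
by rewrite mxE.
Qed.

(** Permuting the variables permutes the exponents the other way, and boxes
    are invariant. *)
Lemma has_ps_perm (s : 'S_m) c F : has_ps c F ->
  has_ps (fun a => c (a \o s)) (fun z => F (col_perm s z)).
Proof.
move=> [gc hc]; split=> [r r01|z hz].
  by have [M hM] := gc r r01; exists M => a; rewrite -(degree_perm s); exact: hM.
apply: clim_eq (hc (col_perm s z) _); last by move=> k; rewrite mxE.
move=> N; rewrite -[LHS](boxsum_perm s); apply: eq_boxsum => a.
by rewrite mono_perm.
Qed.

(** The box of size [N] of the old coefficients becomes the part with positive
    exponents of the box of size [N.+1]. *)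
Lemma has_ps_mul_coords c F : has_ps c F ->
  has_ps (fun a => if [forall i, (0 < a i)%N] then c (fun i => (a i).-1) else 0)
         (fun z => (\prod_i z 0 i) * F z).
Proof.
move=> [gc hc]; split=> [r r01|z hz].
  have /andP[r0 r1] := r01.
  have [M hM] := gc r r01; exists M => a; case: ifP => [_|_]; last first.
    rewrite nc0 mul0r; apply: le_trans (hM (fun=> 0%N)).
    by rewrite mulr_ge0 ?nc_ge0 ?exprn_ge0 ?ltW.
  apply: le_trans (hM (fun i => (a i).-1)); rewrite ler_wpM2l ?nc_ge0//.
  by apply: ler_wiXn2l; rewrite ?ltW//; apply: leq_sum => i _; exact: leq_pred.
have shiftN N : boxsum N.+1 (fun a => (if [forall i, (0 < a i)%N] then c (fun i => (a i).-1) else 0) * mono a z) =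
    (\prod_i z 0 i) * boxsum N (fun a => c a * mono a z).
  rewrite -boxsumZ /boxsum (bigID (fun b : {ffun 'I_m -> 'I_N.+2} => [forall i, (0 < b i)%N])) /=.
  rewrite [X in _ + X]big1 ?addr0; last by move=> b /negbTE ->; rewrite mul0r.
  rewrite (reindex_onto (fun b : {ffun 'I_m -> 'I_N.+1} => [ffun i => lift ord0 (b i) : 'I_N.+2])
     (fun b : {ffun 'I_m -> 'I_N.+2} => [ffun i => inord (b i).-1])) /=; last first.
    move=> b /forallP hb; apply/ffunP => i; rewrite !ffunE; apply/val_inj => /=.
    rewrite /bump /= inordK; first by rewrite add1n prednK.
    by have := ltn_ord (b i); have := hb i; case: (nat_of_ord (b i)).
  apply: eq_big => [b|b hb].
    apply/andP; split; first by apply/forallP => i; rewrite ffunE.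
    apply/eqP/ffunP => i; rewrite !ffunE; by apply/val_inj => /=; rewrite inordK ?add0n ?ltn_ord.
  case/andP: hb => -> _; rewrite mulrCA; congr (_ * _).
    by congr c; apply/funext => i; rewrite ffunE.
  by rewrite /mono -big_split /=; apply: eq_bigr => i _; rewrite ffunE /= /bump /= add1n exprS.
move=> e e0; have [N hN] := climZ (\prod_i z 0 i) (hc z hz) e0.
exists N.+1 => -[//|n] Nn; rewrite shiftN; exact: hN.
Qed.

End power_series.

(** * Strictly decreasing exponents and antisymmetric families *)

Section decreasing_exponents.
Context {d : nat}.
Implicit Types (a p m : 'I_d -> nat) (s t : 'S_d).

Definition decreasing p := forall i j : 'I_d, (i < j)%N -> (p j < p i)%N.

(** The strictly decreasing exponent with gaps [m]: the last entry is the last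
    gap, and each entry exceeds the next one by its gap plus one. *)
Definition of_gaps m : 'I_d -> nat := fun i => (m i + \sum_(k < d | i < k) (m k).+1)%N.

Lemma sum_after m (i : 'I_d) j : (i < j)%N ->
  (\sum_(k < d | j <= k) (m k).+1 <= \sum_(k < d | i < k) (m k).+1)%N.
Proof.
move=> ij; rewrite [leqRHS](bigID (fun k : 'I_d => (j <= k)%N)) /=.
apply: leq_trans (leq_addr _ _); rewrite eq_leq//; apply: eq_bigl => k.
by case jk: (j <= k)%N; rewrite ?andbF// andbT (leq_trans ij jk).
Qed.

Lemma sum_from m (j : 'I_d) : (\sum_(k < d | j <= k) (m k).+1 = (of_gaps m j).+1)%N.
Proof.
rewrite (bigD1 j)//= /of_gaps -addSn; congr (_ + _)%N; apply: eq_bigl => k.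
by rewrite ltn_neqAle andbC eq_sym.
Qed.

Lemma of_gaps_decreasing m : decreasing (of_gaps m).
Proof.
move=> i j ij; rewrite -sum_from; apply: leq_trans (sum_after m ij) _.
exact: leq_addl.
Qed.

Lemma of_gaps_inj : injective of_gaps.
Proof.
move=> m m' e; apply/funext => i.
have [k] := ubnP (d - i)%N; elim: k i => // k IH i hk.
have := congr1 (fun p => p i) e; rewrite /of_gaps.
rewrite (eq_bigr (fun k => (m' k).+1)); first exact: addIn.
move=> l il; rewrite IH//.
by rewrite -ltnS; apply: leq_trans hk; rewrite ltnS ltn_sub2l.
Qed.

Lemma of_gaps_surj p : decreasing p -> exists m, of_gaps m = p.
Proof.
move=> dp; pose P k := if insub k is Some i then (p (i : 'I_d)).+1 else 0%N.
have PE (i : 'I_d) : P i = (p i).+1 by rewrite /P valK.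
have Pd : P d = 0%N by rewrite /P insubN// ltnn.
have Pm k : (k < d)%N -> (P k.+1 < P k)%N.
  move=> kd; have /= -> := PE (Ordinal kd).
  have [k1|] := ltnP k.+1 d; last by move=> dk; rewrite /P insubN// -leqNgt.
  by have /= -> := PE (Ordinal k1); rewrite ltnS; exact: dp.
have tel j : (j <= d)%N -> (\sum_(j <= k < d) (P k - P k.+1) = P j)%N.
  move=> jd; have [k] := ubnP (d - j)%N; elim: k j jd => // k IH j jd hk.
  move: jd; rewrite leq_eqVlt => /orP[/eqP->|jd]; first by rewrite big_geq.
  rewrite big_ltn// IH//; first by rewrite subnK// ltnW// Pm.
  by rewrite -ltnS; apply: leq_trans hk; rewrite ltnS ltn_sub2l.
exists (fun i => (P i - P i.+1).-1); apply/funext => i; rewrite /of_gaps.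
have -> : (\sum_(k < d | i < k) (P k - P k.+1).-1.+1 = P i.+1)%N.
  rewrite -tel// (big_nat_widenl _ 0)//= big_mkord; apply: eq_bigr => k ik.
  by rewrite prednK// subn_gt0 Pm.
have := Pm i (ltn_ord i); rewrite PE ltnS => h.
by rewrite -subn1 -subnDA addn1 subSS subnK.
Qed.

(** Adding one to the first [l.+1] exponents changes only the gap between the
    exponents [l] and [l.+1]. *)
Lemma add_ones_of_gaps (l i : 'I_d) m : (of_gaps m i + (i <= l) = of_gaps (raise 1 l m) i)%N.
Proof.
rewrite /of_gaps /raise addnAC; case: (ltngtP i l) => [il|il|/val_inj ->].
- rewrite (_ : (i == l) = false) ?addn0; last by apply/eqP => e; rewrite e ltnn in il.
  rewrite -addnA; congr (_ + _)%N.
  rewrite (bigD1 l)//= [in RHS](bigD1 l)//= eqxx addn1 add1n -addSn; congr (_ + _)%N.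
  by apply: eq_bigr => k /andP[_ /negbTE ->]; rewrite addn0.
- rewrite (_ : (i == l) = false) ?addn0; last by apply/eqP => e; rewrite e ltnn in il.
  congr (_ + _)%N; apply: eq_bigr => k ik; rewrite (_ : (k == l) = false) ?addn0//.
  by apply/eqP => e; move: (ltn_trans il ik); rewrite e ltnn.
- rewrite eqxx; congr (_ + _)%N; apply: eq_bigr => k lk; rewrite (_ : (k == l) = false) ?addn0//.
  by apply/eqP => e; move: lk; rewrite e ltnn.
Qed.

(** The number of larger entries: on an injective family this is the
    permutation sorting it. *)
Definition rank a (i : 'I_d) : nat := (\sum_(j < d | a i < a j) 1)%N.

Lemma sum1_lt (P Q : pred 'I_d) j : (forall k, P k -> Q k) -> Q j -> ~~ P j ->
  (\sum_(k | P k) 1 < \sum_(k | Q k) 1)%N.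
Proof.
move=> PQ Qj Pj; rewrite [ltnRHS](bigD1 j)//= add1n ltnS big_mkcond [leqRHS]big_mkcond.
apply: leq_sum => k _; case Pk: (P k) => //; rewrite (PQ _ Pk) /=.
by case: eqP => // kj; rewrite kj (negbTE Pj) in Pk.
Qed.

Lemma rank_lt a i : (rank a i < d)%N.
Proof.
rewrite -[ltnRHS]card_ord -sum1_card; apply: (@sum1_lt _ _ i) => //.
by rewrite ltnn.
Qed.

Lemma rank_decr a i j : (a i < a j)%N -> (rank a j < rank a i)%N.
Proof.
by move=> ij; apply: (@sum1_lt _ _ j) => [k| |]; rewrite ?ltnn//; exact: ltn_trans.
Qed.

Definition sorting a : 'S_d := odflt 1%g [pick s : 'S_d | [forall i, rank a i == s i]].

Lemma rank_comp p s i : decreasing p -> rank (p \o s) i = s i.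
Proof.
move=> dp; have lt_p k l : (p k < p l)%N = (l < k)%N.
  case: (ltngtP l k) => [/dp//|/dp h|/val_inj ->]; last exact: ltnn.
  by apply/negbTE; rewrite -leqNgt ltnW.
rewrite /rank (eq_bigl (fun j => (s j < s i)%N)); last by move=> j; rewrite /= lt_p.
rewrite (_ : \sum_(_ < _ | _) _ = \sum_(j < d | (j < s i)%N) 1)%N; last first.
  by rewrite [RHS](reindex_inj (@perm_inj _ s)).
by rewrite (big_ord_narrow (ltnW (ltn_ord (s i)))) sum1_card card_ord.
Qed.

Lemma sorting_comp p s : decreasing p -> sorting (p \o s) = s.
Proof.
move=> dp; rewrite /sorting; case: pickP => [t /forallP ht|/(_ s)/negP[]].
  by apply/permP => i; apply/val_inj => /=; have := ht i; rewrite rank_comp// => /eqP.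
by apply/forallP => i; rewrite rank_comp.
Qed.

Lemma decreasing_inj p : decreasing p -> injective p.
Proof.
move=> dp i j e; apply/eqP; case: (ltngtP i j) => [/dp|/dp|/val_inj -> //]; by rewrite e ltnn.
Qed.

(** The permutation counting for each entry the number of larger ones sorts
    the family. *)
Lemma sort_exists a : injective a -> exists m s, a = of_gaps m \o s.
Proof.
move=> ia; pose f i : 'I_d := Ordinal (rank_lt a i).
have fi : injective f.
  move=> i j /(congr1 val) /= e; apply: ia; apply/eqP.
  by case: (ltngtP (a i) (a j)) => [/rank_decr|/rank_decr|//]; rewrite e ltnn.
have dp : decreasing (a \o (perm fi)^-1%g).
  move=> i j ij /=; set u := ((perm fi)^-1%g i); set v := ((perm fi)^-1%g j).
  have iu : rank a u = i by rewrite -[in RHS](permKV (perm fi) i) permE.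
  have jv : rank a v = j by rewrite -[in RHS](permKV (perm fi) j) permE.
  case: (ltngtP (a v) (a u)) => // [/rank_decr|/ia uv]; first by rewrite iu jv ltnNge ltnW.
  by move: iu; rewrite -uv jv => e; rewrite e ltnn in ij.
have [m hm] := of_gaps_surj dp; exists m, (perm fi).
by rewrite hm; apply/funext => i /=; rewrite permK.
Qed.

Lemma sort_unique m m' s s' : of_gaps m \o s = of_gaps m' \o s' -> m = m' /\ s = s'.
Proof.
move=> e; have ss : s = s'.
  by rewrite -(sorting_comp s (of_gaps_decreasing m)) e sorting_comp//; exact: of_gaps_decreasing.
split=> //; apply: of_gaps_inj; apply/funext => i.
have : (of_gaps m \o s) ((s^-1)%g i) = (of_gaps m' \o s') ((s^-1)%g i) by rewrite e.
by rewrite /= -ss permKV.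
Qed.

End decreasing_exponents.

Section antisymmetric_families.
Context {R : realType} {d : nat}.
Local Notation C := R[i].
Local Notation I := ('I_d -> nat).
Implicit Types (x : I -> C) (y : I -> C) (a m : I) (s : 'S_d).

Definition antisym x := forall s a, x (a \o s) = (-1) ^+ s * x a.

(** Exchanging two equal entries fixes the family and changes the sign. *)
Lemma antisym0 x a : antisym x -> ~ injective a -> x a = 0.
Proof.
move=> hx; apply: contra_notP => xa i j e; apply/eqP/negP => /negP ij; apply: xa.
have := hx (tperm i j) a; rewrite odd_tperm ij expr1 mulN1r => h.
have {}h : x a = - x a.
  rewrite -h; congr x; apply/funext => k /=.
  by case: tpermP => [->|->|//]; rewrite e.
have : 2 * x a = 0 by rewrite mulr2n mulrDl mul1r {1}h addNr.
by move/eqP; rewrite mulf_eq0 pnatr_eq0 => /eqP.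
Qed.

Lemma antisym_sort x m s : antisym x -> x (of_gaps m \o s) = (-1) ^+ s * x (of_gaps m).
Proof. by move=> hx; rewrite hx. Qed.

Lemma nc_sign (b : bool) (u : C) : nc ((-1) ^+ b * u) = nc u.
Proof. by rewrite ncM ncX ncN nc1 expr1n mul1r. Qed.

(** The injective families fall into [d`!] classes according to the
    permutation sorting them; by antisymmetry each class contributes the same
    square sum. *)
Lemma sqsum_antisym x : antisym x ->
  sqsum x = sqsum (fun m => (Num.sqrt (d`!%:R))%:C%C * x (of_gaps m)).
Proof.
move=> hx.
pose A s (a : I) := `[< exists m, a = of_gaps m \o s >].
transitivity (\sum_(s : 'S_d) sqsum (restr (A s) x))%E.
  rewrite sum_sqsum; apply: eq_esum => a _; congr (_%:E).
  have [ia|ia] := pselect (injective a); last first.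
    rewrite (antisym0 hx ia) nc0 expr0n big1// => s _.
    by rewrite nc_restr (antisym0 hx ia) nc0 if_same expr0n.
  have [m [s e]] := sort_exists ia.
  rewrite (bigD1 s)//= nc_restr /A asboolT; last by exists m.
  rewrite big1 ?addr0// => t ts; rewrite nc_restr /A asboolF ?expr0n//.
  move=> [m' e']; move: ts; have [_ ->] := sort_unique (etrans (esym e) e').
  by rewrite eqxx.
transitivity (\sum_(s : 'S_d) sqsum (fun m => x (of_gaps m)))%E.
  apply: eq_bigr => s _.
  rewrite (sqsum_image (e := fun m => of_gaps m \o s)).
  - apply: sqsum_eq => m; rewrite nc_restr /A asboolT; last by exists m.
    by rewrite antisym_sort// nc_sign.
  - by move=> m m' /sort_unique[].
  - by move=> a ha; rewrite /restr /A asboolF// => -[m] /ha.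
rewrite sum_sqsum; apply: eq_esum => m _; congr (_%:E).
rewrite sumr_const card_Sn ncM nc_real ger0_norm ?sqrtr_ge0// exprMn sqr_sqrtr ?ler0n//.
by rewrite mulr_natl.
Qed.

(** Well defined as an injective family has only one decomposition
    ([sort_unique]); zero on the other families. *)
Definition antisym_ext y a : C :=
  xget 0 [set u | exists m s, a = of_gaps m \o s /\ u = (-1) ^+ s * y m].

Lemma antisym_extE y m s : antisym_ext y (of_gaps m \o s) = (-1) ^+ s * y m.
Proof.
rewrite /antisym_ext; case: xgetP => [u _ [m' [s' [e ->]]]|/(_ ((-1) ^+ s * y m))[]].
  by have [-> ->] := sort_unique e.
by exists m, s.
Qed.

Lemma antisym_extP y : antisym (antisym_ext y).
Proof.
move=> s a; have [ia|ia] := pselect (injective a); last first.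
  suff h0 b : ~ injective b -> antisym_ext y b = 0.
    rewrite !h0 ?mulr0// => ias; apply: ia => i j e; apply: (can_inj (permKV s)).
    by apply: ias => /=; rewrite !permKV.
  move=> ib; rewrite /antisym_ext; case: xgetP => // u _ [m [t [e _]]].
  by exfalso; apply: ib; rewrite e; apply: inj_comp; [exact/decreasing_inj/of_gaps_decreasing|exact: perm_inj].
have [m [t ->]] := sort_exists ia.
have -> : (of_gaps m \o t) \o s = of_gaps m \o (s * t)%g by apply/funext => i; rewrite /= permM.
by rewrite !antisym_extE odd_permM signr_addb mulrA.
Qed.

Lemma antisym_ext_base y m : antisym_ext y (of_gaps m) = y m.
Proof.
have -> : of_gaps m = of_gaps m \o (1%g : 'S_d) by apply/funext => i; rewrite /= perm1.
by rewrite antisym_extE odd_perm1 mul1r.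
Qed.

Lemma antisym_eq x x' : antisym x -> antisym x' ->
  (forall m, x (of_gaps m) = x' (of_gaps m)) -> forall a, x a = x' a.
Proof.
move=> hx hx' e a; have [ia|ia] := pselect (injective a); last by rewrite !antisym0.
by have [m [s ->]] := sort_exists ia; rewrite !antisym_sort// e.
Qed.

End antisymmetric_families.

(** * Coordinates on the antisymmetric Hardy space *)

Section differentiable_functions.
Context {R : realType} {m : nat}.
Local Notation C := R[i].
Implicit Types (F G : 'rV[C]_m -> C) (z : 'rV[C]_m).

Lemma differentiable_add F G z : differentiable F z -> differentiable G z ->
  differentiable (fun z => F z + G z) z.
Proof. by move=> hF hG; exact: differentiableD. Qed.

Lemma differentiable_mul F G z : differentiable F z -> differentiable G z ->
  differentiable (fun z => F z * G z) z.
Proof. by move=> hF hG; exact: differentiableM. Qed.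

Lemma differentiable_const (x : C) z : differentiable (fun _ : 'rV[C]_m => x) z.
Proof. exact: differentiable_cst. Qed.

Lemma differentiable_scale (x : C) F z : differentiable F z -> differentiable (fun z => x * F z) z.
Proof. by move=> hF; apply: differentiable_mul hF; exact: differentiable_const. Qed.

Lemma differentiable_sumr (J : Type) (r : seq J) (P : pred J) (F : J -> 'rV[C]_m -> C) z :
  (forall j, differentiable (F j) z) -> differentiable (fun z => \sum_(j <- r | P j) F j z) z.
Proof.
move=> hF; elim: r => [|j r IH].
  by under eq_fun do rewrite big_nil; exact: differentiable_const.
have -> : (fun z => \sum_(j <- j :: r | P j) F j z) =
    fun z => (if P j then F j z else 0) + \sum_(j <- r | P j) F j z.
  by apply/funext => w; rewrite big_cons; case: (P j); rewrite ?add0r.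
apply: differentiable_add IH; case: (P j); first exact: hF.
exact: differentiable_const.
Qed.

End differentiable_functions.

Section antisymmetric_hardy_space.
Context {R : realType} {n : nat}.
Local Notation C := R[i].
Local Notation d := n.+2.
Local Notation V := (fspace R n).
Local Notation I := ('I_d -> nat).
Implicit Types (f g : V) (z : 'rV[C]_d) (a p m : I) (l : 'I_d).

Lemma polydiscE z : @polydisc R n z <-> forall k, nc (z 0 k) < 1.
Proof.
have E k : (`|z 0 k| < 1) = (nc (z 0 k) < 1) by rewrite normC_nc -[RHS]ltcR.
by split=> h k; have := h k; rewrite E.
Qed.

Lemma polydisc_ball z : (forall k, nc (z 0 k) < 1) ->
  exists2 e : R, 0 < e & forall h, rnorm h < e -> forall k, nc ((z + h) 0 k) < 1.
Proof.
move=> /polydisc_room[r /andP[r0 r1] hr]; exists (1 - r); first by rewrite subr_gt0.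
move=> h hh k; rewrite mxE; apply: le_lt_trans (ncD _ _) _.
have := nc_coord_le h k; have := hr k; lra.
Qed.

(** The polydisc is open, so extension by zero does not affect
    differentiability inside. *)
Lemma hol_patch (F : V) : hol F -> hol (patch (fun=> 0) (@polydisc R n) F).
Proof.
move=> hF z hz; have [e e0 he] := polydisc_ball hz.
apply: differentiable_near e0 _ (hF z hz) => h /he /polydiscE hh.
by rewrite patchT// inE.
Qed.

Lemma patch_supported (F : V) : supported_in (@polydisc R n) (patch (fun=> 0) (@polydisc R n) F).
Proof. by move=> z hz; rewrite patchN// notin_setE. Qed.

Lemma patch_polydisc (F : V) z : (forall k, nc (z 0 k) < 1) ->
  patch (fun=> 0) (@polydisc R n) F z = F z.
Proof. by move=> /polydiscE hz; rewrite patchT// inE. Qed.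

Lemma holE f : holomorphic_on (@polydisc R n) f <-> hol f.
Proof. by split=> h z hz; apply: h; exact/polydiscE. Qed.

Lemma sup_integral_hol f : hol f -> sup_integral (sq_modulus f) = sqsum (taylor f).
Proof. by move=> hf; rewrite -hardy_norm. Qed.

Lemma hcar_anti f : hcar (H2anti n) f <->
  [/\ hol f, supported_in (@polydisc R n) f, (sqsum (taylor f) < +oo)%E & Defs.antisymmetric f].
Proof.
split=> [[[/holE hf sf nf] af]|[hf sf nf af]].
  by split=> //; rewrite -sup_integral_hol.
by split=> //; split=> //; [exact/holE|rewrite sup_integral_hol].
Qed.

Lemma hol_lin (x : C) f g : hol f -> hol g -> hol (x *: f + g).
Proof.
move=> hf hg z hz; change (differentiable (fun z => x * f z + g z) z).
by apply: differentiable_add; [apply: differentiable_scale; exact: hf|exact: hg].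
Qed.

Lemma taylor_lin (x : C) f g a : hol f -> hol g ->
  taylor (x *: f + g) a = x * taylor f a + taylor g a.
Proof.
move=> hf hg; have h := has_psD x (has_ps_taylor hf) (has_ps_taylor hg).
exact: (taylorE (hol_lin x hf hg) h).
Qed.

Lemma taylor_antisym f : hol f -> Defs.antisymmetric f -> antisym (taylor f).
Proof.
move=> hf af s a.
have h0 : has_ps (fun _ : I => 0) (fun _ : 'rV[C]_d => 0 : C).
  split=> [r _|z _]; first by exists 0 => b; rewrite nc0 mul0r.
  by apply: clim_eq (clim_cst 0) => N; rewrite [RHS]big1// => b _; exact: mul0r.
have h1 := has_ps_perm s (has_ps_taylor hf).
have h2 := has_psD ((-1) ^+ s) (has_ps_taylor hf) h0.
rewrite (has_ps_unique _ h1 h2) ?addr0// => z /polydiscE hz.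
by rewrite af// addr0.
Qed.

Lemma antisym_taylor f : hol f -> antisym (taylor f) -> Defs.antisymmetric f.
Proof.
move=> hf af s z /polydiscE hz.
have [_ hc] := has_ps_perm s (has_ps_taylor hf).
apply: (clim_unique (hc z hz)).
apply: clim_eq (climZ ((-1) ^+ s) (taylor_series hf hz)) => N.
by rewrite -boxsumZ; apply: eq_boxsum => a; rewrite af mulrA.
Qed.

(** The factor accounts for the [d`!] exponents with the same decreasing
    rearrangement, and makes the coordinates orthonormal. *)
Definition cA f m : C := (Num.sqrt (d`!%:R))%:C%C * taylor f (of_gaps m).

Lemma fact_sqrt_neq0 : (Num.sqrt (d`!%:R : R))%:C%C != 0.
Proof. by rewrite -nc_gt0 nc_real gtr0_norm sqrtr_gt0 ltr0n fact_gt0. Qed.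

Lemma sqsum_cA f : hol f -> Defs.antisymmetric f -> sqsum (cA f) = sqsum (taylor f).
Proof. by move=> hf af; rewrite [RHS]sqsum_antisym//; exact: taylor_antisym. Qed.

Lemma sqsum_bounded (x : I -> C) : (sqsum x < +oo)%E -> exists M : R, forall a, nc (x a) <= M.
Proof.
move=> hx; exists (Num.sqrt (fine (sqsum x))) => a.
have fn : sqsum x \is a fin_num by rewrite ge0_fin_numE ?sqsum_ge0.
rewrite -(ler_pXn2r (_ : (0 < 2)%N)) ?nnegrE ?nc_ge0 ?sqrtr_ge0// sqr_sqrtr ?fine_ge0 ?sqsum_ge0//.
by rewrite -lee_fin fineK// sqsum_coord.
Qed.

(** Surjectivity: a square summable family extends antisymmetrically to
    bounded coefficients, whose power series is holomorphic. *)
Lemma anti_coords : l2_coords (H2anti n) cA.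
Proof.
split.
- move=> x f g /hcar_anti[hf sf nf af] /hcar_anti[hg sg ng ag]; apply/hcar_anti.
  have hl := hol_lin x hf hg; split=> //.
  + move=> z hz; change (x * f z + g z = 0); by rewrite sf// sg// mulr0 addr0.
  + rewrite (@sqsum_eq _ _ _ (fun a => x * taylor f a + taylor g a)%R).
      by apply: sqsum_lty_D => //; exact: sqsumZ_lty.
    by move=> a; rewrite taylor_lin.
  + move=> s z hz; change (x * f (col_perm s z) + g (col_perm s z) = (-1) ^+ s * (x * f z + g z)).
    by rewrite af// ag// mulrDr mulrCA.
- move=> x f g m /hcar_anti[hf _ _ _] /hcar_anti[hg _ _ _].
  by rewrite /cA taylor_lin// mulrDr mulrCA.
- by move=> f /hcar_anti[hf _ nf af]; rewrite sqsum_cA.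
- by move=> f /hcar_anti[hf _ _ af]; rewrite sqsum_cA// -sup_integral_hol.
- move=> y hy; pose x := antisym_ext (fun m => (Num.sqrt (d`!%:R : R))%:C%C^-1 * y m).
  have ax : antisym x by exact: antisym_extP.
  have sx : sqsum x = sqsum y.
    rewrite sqsum_antisym//; apply: sqsum_eq => m.
    by rewrite /x antisym_ext_base mulVKf// fact_sqrt_neq0.
  have [M hM] := sqsum_bounded (eq_ind_r (fun e => e < +oo)%E hy sx).
  pose F := patch (fun=> 0) (@polydisc R n) (psum x).
  have hF : hol F by apply: hol_patch; exact: psum_hol hM.
  have tF a : taylor F a = x a.
    apply: (taylorE hF (has_ps_ext _ (has_ps_psum hM))) => z hz.
    by rewrite /F patch_polydisc.
  exists F; last by move=> m; rewrite /cA tF /x antisym_ext_base mulVKf// fact_sqrt_neq0.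
  apply/hcar_anti; split=> //; first exact: patch_supported.
    by rewrite (@sqsum_eq _ _ _ x) ?sx// => a; rewrite tF.
  by apply: antisym_taylor => // s a; rewrite !tF.
- move=> f g /hcar_anti[hf sf nf af] /hcar_anti[hg sg ng ag] e.
  have te a : taylor f a = taylor g a.
    apply: antisym_eq; [exact: taylor_antisym..|] => m.
    exact: (mulfI fact_sqrt_neq0 (e m)).
  apply/funext => z; have [/polydiscE hz|hz] := pselect (polydisc z); last by rewrite sf// sg.
  apply: (clim_unique (taylor_series hf hz)); apply: clim_eq (taylor_series hg hz) => N.
  by apply: eq_boxsum => a; rewrite te.
Qed.

Lemma has_ps_mono (b : I) : has_ps (fun a => (a == b)%:R : C) (mono b).
Proof.
split=> [r /andP[r0 r1]|z hz].
  exists 1 => a; apply: le_trans (_ : nc (a == b)%:R * 1 <= _).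
    by rewrite ler_wpM2l ?nc_ge0// exprn_ile1// ltW.
  by rewrite mulr1; case: (a == b); rewrite ?nc1 ?nc0.
move=> e e0; exists (\max_i b i)%N => N hN.
pose b' : {ffun 'I_d -> 'I_N.+1} := [ffun i => inord (b i)].
have b'E : (fun i => b' i : nat) = b.
  apply/funext => i; rewrite ffunE inordK// ltnS; apply: leq_trans hN.
  exact: (@leq_bigmax _ (fun i => b i)).
rewrite /boxsum (bigD1 b')//= b'E eqxx mul1r big1 ?addr0 ?subrr ?nc0 ?ltW// => c cb.
rewrite (_ : _ == b = false) ?mul0r//; apply/eqP => cE; move/eqP: cb; apply.
apply/ffunP => i; apply/val_inj => /=.
by rewrite [RHS](congr1 (fun f : I => f i) b'E) -cE.
Qed.

Lemma has_ps_sum (J : Type) (r : seq J) (c : J -> I -> C) (F : J -> V) (x : J -> C) :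
  (forall j, has_ps (c j) (F j)) ->
  has_ps (fun a => \sum_(j <- r) x j * c j a) (fun z => \sum_(j <- r) x j * F j z).
Proof.
move=> h; elim: r => [|j r IH].
  split=> [r _|z _]; first by exists 0 => b; rewrite big_nil nc0 mul0r.
  by rewrite big_nil; apply: clim_eq (clim_cst 0) => N; rewrite [RHS]big1// => b _; rewrite big_nil mul0r.
have := has_psD (x j) (h j) IH; congr has_ps.
  by apply/funext => a; rewrite big_cons.
by apply/funext => z; rewrite big_cons.
Qed.

Lemma anti_monomial_hol p : hol (anti_monomial p : V).
Proof.
apply: hol_patch => z hz.
apply: differentiable_sumr => s; apply: differentiable_scale.
exact: (mono_differentiable (p \o s)).
Qed.

Lemma anti_monomial_taylor p a :
  taylor (anti_monomial p : V) a = \sum_(s : 'S_d) (-1) ^+ s * (a == p \o s)%:R.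
Proof.
have h := has_ps_sum (index_enum 'S_d) (fun s => (-1) ^+ s) (fun s => has_ps_mono (p \o s)).
apply: (taylorE (anti_monomial_hol p) (has_ps_ext _ h)) => z hz.
by rewrite /anti_monomial patch_polydisc.
Qed.

Lemma cA_anti_monomial m m' :
  cA (anti_monomial (of_gaps m)) m' = (Num.sqrt (d`!%:R))%:C%C * (m' == m)%:R.
Proof.
rewrite /cA anti_monomial_taylor (bigD1 (1%g : 'S_d))//= odd_perm1 mul1r big1 ?addr0.
  congr (_ * _); congr (_%:R); congr nat_of_bool.
  have -> : of_gaps m \o (1%g : 'S_d) = of_gaps m by apply/funext => i; rewrite /= perm1.
  by apply/eqP/eqP => [/of_gaps_inj|->].
move=> s s1; rewrite (_ : _ == _ = false) ?mulr0//; apply/eqP => e; move/eqP: s1; apply.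
have e' : of_gaps m' \o (1%g : 'S_d) = of_gaps m \o s.
  by rewrite -e; apply/funext => i; rewrite /= perm1.
by have [_ <-] := sort_unique e'.
Qed.

Lemma anti_monomial_hcar m : hcar (@H2anti R n) (anti_monomial (of_gaps m)).
Proof.
apply/hcar_anti; have h := anti_monomial_hol (of_gaps m).
have asym : Defs.antisymmetric (anti_monomial (of_gaps m) : V).
  apply: antisym_taylor => // s a; rewrite !anti_monomial_taylor.
  rewrite mulr_sumr [LHS](reindex_inj (mulgI s)); apply: eq_bigr => t _.
  rewrite odd_permM signr_addb -mulrA; congr (_ * (_ * _)); congr (_%:R); congr nat_of_bool.
  have -> : of_gaps m \o (s * t)%g = (of_gaps m \o t) \o s by apply/funext => i; rewrite /= permM.
  apply/eqP/eqP => [e|->//]; apply/funext => i.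
  have := congr1 (fun f : I => f ((s^-1)%g i)) e; by rewrite /= permKV.
split=> //; first exact: patch_supported.
rewrite -sqsum_cA//.
apply: le_lt_trans (sqsum_support (s0 := [:: m]) _ _) _ => //; last exact: ltry.
by move=> m'; rewrite inE => /negbTE e; rewrite cA_anti_monomial e mulr0.
Qed.

End antisymmetric_hardy_space.

(** * Shifts along one coordinate *)

Section unilateral_shift.
Context {R : realType} {d : nat}.
Local Notation C := R[i].
Local Notation I := ('I_d -> nat).
Context {V : lmodType C} {H : hspace V} {c : V -> I -> C}.
Hypothesis L : l2_coords H c.

(** The result of moving all coordinates of [f] by one step in the direction
    [l]. *)
Definition is_shift l f g :=
  [/\ hcar H g, forall a, c g (raise 1 l a) = c f a & forall a, a l = 0%N -> c g a = 0].

Definition shift_up l f : V := xget 0 (is_shift l f).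

Lemma shift_upP l f : hcar H f -> is_shift l f (shift_up l f).
Proof.
move=> hf; apply: (@xgetPex _ 0 (is_shift l f)).
pose x (a : I) := if (0 < a l)%N then c f (fun i => (a i - (i == l))%N) else 0.
have xE a : x (raise 1 l a) = c f a.
  rewrite /x /raise eqxx addn1 /=; congr c; apply/funext => i.
  by case: (i == l); rewrite addnK.
have x0 a : a l = 0%N -> x a = 0 by rewrite /x => ->.
have [|g hg gE] := coords_surj L (x := x).
  rewrite (sqsum_image (@raise_inj _ 1 l)).
    by rewrite (@sqsum_eq _ _ _ (c f)) ?(coords_lty L)// => a; rewrite xE.
  move=> a ha; apply: x0; apply/eqP; rewrite -leqn0 leqNgt; apply/negP => al.
  have [b e] := unraise al; exact: ha e.
by exists g; split=> // a; rewrite gE//; exact: x0.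
Qed.

Lemma is_shift_unique l f g h : is_shift l f g -> is_shift l f h -> g = h.
Proof.
move=> [hg g1 g0] [hh h1 h0]; apply: (coords_inj L) => // a.
have [al|al] := posnP (a l); first by rewrite g0 ?h0.
by have [b ->] := unraise al; rewrite g1 h1.
Qed.

Lemma is_shift_norm l f g : hcar H f -> is_shift l f g -> hnorm H g = hnorm H f.
Proof.
move=> hf [hg g1 g0]; rewrite !(coords_norm L)//; congr (Num.sqrt (fine _)).
rewrite (sqsum_image (@raise_inj _ 1 l)); first by apply: sqsum_eq => a; rewrite g1.
move=> a ha; apply: g0; apply/eqP; rewrite -leqn0 leqNgt; apply/negP => al.
by have [b e] := unraise al; exact: ha e.
Qed.

Lemma shift_up_bounded l : bounded_op H H (shift_up l).
Proof.
split=> [f hf|x f g hf hg|]; first by have [] := shift_upP l hf.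
  have hl := coords_closed L x hf hg.
  have [hF F1 F0] := shift_upP l hf; have [hG G1 G0] := shift_upP l hg.
  apply: (is_shift_unique (shift_upP l hl)); split=> [|a|a a0].
  - exact: (coords_closed L).
  - by rewrite !(coords_linear L)// F1 G1.
  - by rewrite (coords_linear L)// F0// G0// mulr0 addr0.
by exists 1 => f hf; rewrite mul1r (is_shift_norm hf (shift_upP l hf)).
Qed.

(** Up to a small error every vector is a finite combination of basis vectors. *)
Lemma bounded_op_ext (A B : V -> V) (b : I -> V) (k : C) :
  bounded_op H H A -> bounded_op H H B -> k != 0 ->
  (forall i, hcar H (b i)) -> (forall i j, c (b i) j = k * (j == i)%:R) ->
  (forall i, A (b i) = B (b i)) -> forall f, hcar H f -> A f = B f.
Proof.
move=> [A1 A2 [MA A3]] [B1 B2 [MB B3]] k0 hb bE ABb f hf.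
have zero (T : V -> V) : (forall (a : C) f g, hcar H f -> hcar H g -> T (a *: f + g) = a *: T f + T g) -> T 0 = 0.
  move=> T2; have h0 := hcar0 L; have := T2 1 0 0 h0 h0; rewrite !scale1r addr0 => e.
  by apply: (addrI (T 0)); rewrite -e addr0.
apply: (coords_inj L) => [||i]; [exact: A1|exact: B1|].
apply: nc_forall_eps => e e0.
pose M := `|MA| + `|MB| + 1; have M0 : 0 < M by rewrite ltr_wpDl// addr_ge0.
have e1 : 0 < (e / M) ^+ 2 by rewrite exprn_gt0// divr_gt0.
have [s us hs] := sqsum_tail (coords_lty L hf) e1.
pose h := \sum_(j <- s) (k^-1 * c f j) *: b j.
have hh : hcar H h by apply: (hcar_sum L) => j; exact: (hcarZ L).
have hE j : c h j = restr (fun j => j \in s) (c f) j.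
  rewrite /h (coords_sum L)//; last by move=> j'; exact: (hcarZ L).
  under eq_bigr => j' _ do rewrite (coordsZ L)// bE.
  rewrite /restr; case: ifP => js.
    rewrite (bigD1_seq j)//= eqxx mulr1 big1 ?addr0; last first.
      by move=> j' /negbTE; rewrite eq_sym => ->; rewrite !mulr0.
    by rewrite mulrAC mulVf// mul1r.
  rewrite big_seq big1// => j' j's; rewrite (_ : (j == j') = false) ?mulr0//.
  by apply/eqP => jj; rewrite jj j's in js.
have ABh : A h = B h.
  rewrite /h; elim: s {us hs h hh hE} => [|j s IH]; first by rewrite big_nil !zero.
  have hr : hcar H (\sum_(j <- s) (k^-1 * c f j) *: b j) by apply: (hcar_sum L) => j'; exact: (hcarZ L).
  by rewrite big_cons A2// B2// ABb IH.
have hr : hcar H (f - h) by exact: (hcarB L).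
have nr : hnorm H (f - h) <= e / M.
  rewrite -(ler_pXn2r (_ : (0 < 2)%N)) ?nnegrE ?(hnorm_ge0 L)// ?divr_ge0 ?(ltW e0) ?(ltW M0)//.
  rewrite -lee_fin (hnorm_sq L hr); apply: le_trans hs.
  apply: sqsum_mono => j; rewrite (coordsB L)// hE nc_restr /restr.
  by case: (j \in s); rewrite ?subrr ?nc0 ?subr0.
have fE : f = 1 *: (f - h) + h by rewrite scale1r subrK.
have -> : c (A f) i - c (B f) i = c (A (f - h)) i - c (B (f - h)) i.
  rewrite {1 2}fE A2// B2// ABh !scale1r !(coordsD L); [|by rewrite -?ABh; auto..].
  by rewrite opprD addrACA subrr addr0.
apply: le_trans (ncB _ _) _.
apply: (@le_trans _ _ (hnorm H (A (f - h)) + hnorm H (B (f - h)))).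
  by rewrite lerD// (coord_le L)//; [exact: A1|exact: B1].
apply: (@le_trans _ _ ((`|MA| + `|MB|) * hnorm H (f - h))).
  rewrite mulrDl lerD//; [apply: le_trans (A3 _ hr) _|apply: le_trans (B3 _ hr) _];
  by rewrite ler_wpM2r ?(hnorm_ge0 L)// ler_norm.
apply: (@le_trans _ _ (M * (e / M))); last by rewrite mulrC divfK// gt_eqF.
apply: ler_pM => //; rewrite ?addr_ge0 ?(hnorm_ge0 L)//.
by rewrite lerDl.
Qed.

End unilateral_shift.

Section Y_operators.
Context {R : realType} {n : nat}.
Local Notation C := R[i].
Local Notation d := n.+2.
Local Notation V := (fspace R n).
Local Notation I := ('I_d -> nat).

Lemma add_onesE (l : 'I_d) (m : I) : add_ones l.+1 (of_gaps m) = of_gaps (raise 1 l m).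
Proof. by apply/funext => i; rewrite /add_ones ltnS add_ones_of_gaps. Qed.

Lemma anti_monomial_shift (l : 'I_d) (m : I) :
  shift_up (H := @H2anti R n) (c := cA) l (anti_monomial (of_gaps m)) =
  anti_monomial (of_gaps (raise 1 l m)).
Proof.
apply: (is_shift_unique anti_coords (shift_upP anti_coords l (anti_monomial_hcar m))).
split=> [|a|a a0]; first exact: anti_monomial_hcar.
  rewrite !cA_anti_monomial; congr (_ * _%:R); congr nat_of_bool.
  by apply/eqP/eqP => [/raise_inj|->].
rewrite cA_anti_monomial (_ : (a == _) = false) ?mulr0//; apply/eqP => e.
by move: a0; rewrite e /raise eqxx addn1.
Qed.

Lemma shift_is_Yop (l : 'I_d) : is_Yop l.+1 (shift_up (H := @H2anti R n) (c := cA) l).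
Proof.
split=> [|f hf|p hp]; first exact: (shift_up_bounded anti_coords l).
  exact: (is_shift_norm anti_coords hf (shift_upP anti_coords l hf)).
by have [m <-] := of_gaps_surj hp; rewrite anti_monomial_shift add_onesE.
Qed.

(** [Yop] is only determined by its values on the antisymmetric monomials;
    boundedness and density extend the identity with the coordinate shift to
    the whole space. *)
Lemma Yop_shift (l : 'I_d) (f : V) : hcar (H2anti n) f ->
  is_shift (H := H2anti n) (c := cA) l f (Yop l.+1 f).
Proof.
move=> hf; have [Yb _ Ym] : is_Yop l.+1 (@Yop R n l.+1).
  by apply: (@xgetPex _ _ (is_Yop l.+1)); exists (shift_up (H := @H2anti R n) (c := cA) l); exact: shift_is_Yop.
rewrite (bounded_op_ext anti_coords Yb (shift_up_bounded anti_coords l) fact_sqrt_neq0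
  anti_monomial_hcar cA_anti_monomial _ hf); first exact: (shift_upP anti_coords l hf).
move=> m; rewrite Ym; last exact: of_gaps_decreasing.
by rewrite anti_monomial_shift add_onesE.
Qed.

End Y_operators.

(** * Reduction modulo the characteristic polynomial *)

Section characteristic_polynomial.
Context {K : fieldType} {d : nat}.
Implicit Types (z w : 'rV[K]_d) (Q : {poly K}) (x : K).

(** Homogenized evaluation, turning factors [1 + z X] into factors [X - z]. *)
Definition homog N Q : {poly K} := \sum_(i < N.+1) (Q`_i * (-1) ^+ i) *: 'X^(N - i).

Lemma homog_mul N Q x : (size Q <= N.+1)%N ->
  homog N.+1 ((1 + x *: 'X) * Q) = ('X - x%:P) * homog N Q.
Proof.
move=> sQ; rewrite /homog mulrBl.
have coefE i : ((1 + x *: 'X) * Q)`_i = Q`_i + x * (if i == 0%N then 0 else Q`_i.-1).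
  by rewrite mulrDl mul1r coefD -scalerAl coefZ coefXM.
transitivity ((\sum_(i < N.+2) (Q`_i * (-1) ^+ i) *: 'X^(N.+1 - i)) +
    \sum_(i < N.+2) (x * (if i == 0%N :> nat then 0 else Q`_i.-1) * (-1) ^+ i) *: 'X^(N.+1 - i) : {poly K}).
  by rewrite -big_split /=; apply: eq_bigr => i _; rewrite coefE mulrDl scalerDl.
congr (_ + _).
  rewrite big_ord_recr /= nth_default// mul0r scale0r addr0 mulr_sumr; apply: eq_bigr => i _.
  by rewrite subSn ?leq_ord//= exprS -scalerAr.
rewrite big_ord_recl /= mulr0 mul0r scale0r add0r mulr_sumr -sumrN; apply: eq_bigr => i _.
by rewrite /bump /= add1n /= subSS mul_polyC scalerA exprS mulN1r !mulrN scaleNr mulrA.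
Qed.

Lemma size_prod_1pX (r : seq K) : (size (\prod_(x <- r) (1 + x *: 'X))%R <= (size r).+1)%N.
Proof.
elim: r => [|x r IH]; first by rewrite big_nil size_poly1.
rewrite big_cons; apply: leq_trans (size_polyMleq _ _) _.
have h : (size (1 + x *: 'X : {poly K})%R <= 2)%N.
  apply: leq_trans (size_polyD _ _) _; rewrite geq_max size_poly1 /=.
  by apply: leq_trans (size_scale_leq _ _) _; rewrite size_polyX.
by apply: (@leq_trans (2 + (size r).+1).-1)%N => //; rewrite -!subn1 leq_sub2r// leq_add.
Qed.

Lemma homog_prod (r : seq K) :
  homog (size r) (\prod_(x <- r) (1 + x *: 'X)) = \prod_(x <- r) ('X - x%:P).
Proof.
elim: r => [|x r IH]; last by rewrite !big_cons homog_mul ?IH// size_prod_1pX.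
by rewrite !big_nil /homog big_ord_recl big_ord0 /= coef1 expr0 mulr1 scale1r addr0.
Qed.

Definition elsym z (i : nat) : K := \sum_(A : {set 'I_d} | #|A| == i) \prod_(k in A) z 0 k.

Lemma coef_prod_1pX z i : (\prod_k (1 + z 0 k *: 'X))`_i = elsym z i.
Proof.
have -> : \prod_k (1 + z 0 k *: 'X) = \sum_(A : {set 'I_d}) (\prod_(k in A) z 0 k) *: 'X^#|A| :> {poly K}.
  under eq_bigr do rewrite addrC.
  rewrite bigA_distr /=; apply: eq_bigr => A _.
  rewrite [LHS](bigID (mem A)) /= [X in _ * X]big1 ?mulr1; last by move=> k /negbTE ->.
  rewrite (eq_bigr (fun k => (z 0 k)%:P * 'X)); last by move=> k ->; rewrite mul_polyC.
  by rewrite big_split /= prodr_const -mul_polyC rmorph_prod.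
rewrite coef_sum /elsym [RHS]big_mkcond; apply: eq_bigr => A _.
by rewrite coefZ coefXn eq_sym; case: eqP => _; rewrite ?mulr1 ?mulr0.
Qed.

Definition symrow z : 'rV[K]_d := \row_i elsym z i.+1.

(** The polynomial whose roots are the coordinates of [z] when [w] consists of
    their elementary symmetric functions. *)
Definition chi w : {poly K} := 'X^d - \sum_(i < d) (w 0 i * (-1) ^+ i) *: 'X^(d - i.+1).

Lemma chi_symrow z : chi (symrow z) = \prod_k ('X - (z 0 k)%:P).
Proof.
have := homog_prod [seq z 0 k | k <- enum 'I_d].
have hp (f : K -> {poly K}) : \prod_(x <- [seq z 0 k | k <- enum 'I_d]) f x = \prod_k f (z 0 k).
  by rewrite big_map big_enum.
rewrite !hp size_map size_enum_ord => <-.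
rewrite /homog big_ord_recl /= subn0 coef_prod_1pX expr0 mulr1 /chi; congr (_ + _).
  rewrite /elsym (bigD1 finset.set0) ?cards0//= big_set0 big1 ?addr0 ?scale1r//.
  by move=> A /andP[]; rewrite cards_eq0 => ->.
rewrite -sumrN; apply: eq_bigr => i _.
by rewrite mxE coef_prod_1pX /bump /= add1n exprS mulN1r mulrN scaleNr.
Qed.

Lemma chi_inj : injective chi.
Proof.
move=> w w' e; apply/rowP => i.
have coefE v : (chi v)`_(d - i.+1) = - (v 0 i * (-1) ^+ i).
  rewrite /chi coefB coefXn (_ : _ == d = false) ?sub0r; last first.
    by apply/eqP; have := ltn_ord i; lia.
  congr (- _); rewrite coef_sum (bigD1 i)//= coefZ coefXn eqxx mulr1 big1 ?addr0// => k ki.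
  rewrite coefZ coefXn (_ : _ == _ = false) ?mulr0//; apply/negbTE; apply: contra ki => /eqP h.
  by apply/eqP/val_inj => /=; have := ltn_ord i; have := ltn_ord k; lia.
have := coefE w; rewrite e coefE => /oppr_inj h.
apply: (mulIf (_ : (-1) ^+ i != 0)) => //; by rewrite expf_neq0// oppr_eq0 oner_eq0.
Qed.

End characteristic_polynomial.

Section reduced_powers.
Context {K : fieldType} {n : nat}.
Local Notation d := n.+1.
Implicit Types (z w : 'rV[K]_d) (m k : nat).

(** The remainder of [X^m] modulo [chi w]. *)
Fixpoint redp w m : {poly K} :=
  if m is m'.+1 then 'X * redp w m' - (redp w m')`_n *: chi w else 1.

Lemma redp_coefS w m k : (redp w m.+1)`_k =
  (if k is k'.+1 then (redp w m)`_k' else 0) - (redp w m)`_n * (chi w)`_k.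
Proof. by rewrite /= coefB coefZ coefXM; case: k. Qed.

Lemma chi_coef w k : (chi w)`_k = (k == d)%:R - \sum_(i < d) w 0 i * (-1) ^+ i * (k == (d - i.+1)%N)%:R.
Proof.
rewrite /chi coefB coefXn coef_sum; congr (_ - _); apply: eq_bigr => i _.
by rewrite coefZ coefXn.
Qed.

Lemma size_redp w m : (size (redp w m) <= d)%N.
Proof.
elim: m => [|m IH]; first by rewrite size_poly1.
apply/leq_sizeP => -[//|k] dk; rewrite redp_coefS chi_coef big1 ?subr0; last first.
  by move=> i _; rewrite (_ : _ == _ = false) ?mulr0//; apply/eqP; lia.
move: dk; rewrite ltnS leq_eqVlt => /orP[/eqP <-|nk]; first by rewrite eqxx mulr1 subrr.
rewrite (_ : (k.+1 == d) = false) ?mulr0 ?subr0; last by apply/eqP; lia.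
by rewrite nth_default//; exact: leq_trans nk.
Qed.

(** At the roots of the characteristic polynomial a power agrees with its
    remainder. *)
Lemma redp_horner z m (l : 'I_d) : (redp (symrow z) m).[z 0 l] = z 0 l ^+ m.
Proof.
have root : (chi (symrow z)).[z 0 l] = 0.
  by rewrite chi_symrow horner_prod (bigD1 l)//= hornerXsubC subrr mul0r.
elim: m => [|m IH]; first by rewrite hornerE.
by rewrite /= hornerD hornerN hornerZ root mulr0 subr0 hornerM hornerX IH exprS.
Qed.

(** The quotient of the antisymmetric determinant with exponents [a] by the
    Vandermonde determinant, a Schur polynomial up to sign, as a function of
    the elementary symmetric functions. *)
Definition quot_det (a : 'I_d -> nat) w : K := \det (\matrix_(k < d, j < d) (redp w (a j))`_k).

Lemma det_powers z a : \det (\matrix_(i < d, j < d) z 0 i ^+ a j) =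
  \det (\matrix_(i < d, k < d) z 0 i ^+ k) * quot_det a (symrow z).
Proof.
rewrite -det_mulmx; congr (\det _); apply/matrixP => i j; rewrite !mxE.
rewrite -redp_horner (horner_coef_wide _ (size_redp _ _)); apply: eq_bigr => k _.
by rewrite !mxE mulrC.
Qed.

(** Coordinates of [X^m] in the Newton basis of the [z 0 i]. *)
Fixpoint newton (y : nat -> K) m k : K :=
  if m is m'.+1 then y k * newton y m' k + (if k is k'.+1 then newton y m' k' else 0)
  else (k == 0%N)%:R.

Definition newton_poly (y : nat -> K) k : {poly K} := \prod_(i < k) ('X - (y i)%:P).

(** Multiplication by [X] acts on the Newton basis by [X * N_k = N_(k+1) + y_k
    * N_k], and the last Newton polynomial is the characteristic polynomial,
    whose multiple is subtracted. *)
Lemma redp_newton z m (y := fun k => z 0 (inord k)) :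
  redp (symrow z) m = \sum_(k < d) newton y m k *: newton_poly y k.
Proof.
have NS k : newton_poly y k.+1 = newton_poly y k * ('X - (y k)%:P) by rewrite /newton_poly big_ord_recr.
have Nd : newton_poly y d = chi (symrow z).
  by rewrite chi_symrow; apply: eq_bigr => i _; rewrite /y inord_val.
have Ncoef k j : (k <= j)%N -> (newton_poly y k)`_j = (k == j)%:R.
  move=> kj; have := size_prod_XsubC (index_enum 'I_k) (fun i : 'I_k => y i).
  have := monic_prod_XsubC (index_enum 'I_k) xpredT (fun i : 'I_k => y i).
  rewrite -/(newton_poly y k) => /monicP; rewrite lead_coefE => mon.
  rewrite /index_enum -enumT size_enum_ord => sz; move: mon; rewrite sz /=.
  by case: eqP => [->//|/eqP nkj _]; rewrite nth_default// sz ltn_neqAle nkj.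
have top (u : nat -> K) : (\sum_(k < d) u k *: newton_poly y k)`_n = u n.
  rewrite coef_sum big_ord_recr /= coefZ Ncoef// eqxx mulr1 big1 ?add0r// => k _.
  by rewrite coefZ Ncoef ?(ltnW (ltn_ord k))// (_ : (k == n :> nat) = false) ?mulr0// ltn_eqF.
elim: m => [|m IH].
  rewrite big_ord_recl /= scale1r /newton_poly big_ord0 big1 ?addr0// => i _.
  by rewrite scale0r.
rewrite /= IH top -Nd mulr_sumr.
under [RHS]eq_bigr => k _ do rewrite scalerDl.
rewrite big_split /= [X in _ = _ + X]big_ord_recl /= scale0r add0r.
have -> : \sum_(k < d) 'X * (newton y m k *: newton_poly y k) =
    \sum_(k < d) (y k * newton y m k) *: newton_poly y k +
    \sum_(k < d) newton y m k *: newton_poly y k.+1.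
  rewrite -big_split; apply: eq_bigr => k _ /=.
  rewrite NS -!mul_polyC !rmorphM /=; ring.
by rewrite [X in _ + X - _]big_ord_recr /= addrA addrK.
Qed.

End reduced_powers.

(** * The Jacobian of the symmetrization map *)

Section jacobian_determinant.
Context {R : realType} {n : nat}.
Local Notation C := R[i].
Local Notation d := n.+2.
Implicit Types (z w h : 'rV[C]_d).

Lemma symmapE z : symmap z = symrow z.
Proof. by []. Qed.

(** Its coefficients are the elementary symmetric functions in the remaining
    variables. *)
Definition without z (k : 'I_d) : {poly C} := \prod_(m < d | m != k) (1 + z 0 m *: 'X).

(** Elementary symmetric functions are affine in each variable. *)
Lemma elsym_line z (k i : 'I_d) (t : C) :
  elsym (z + t *: delta_mx 0 k) i.+1 = elsym z i.+1 + t * (without z k)`_i.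
Proof.
rewrite -!coef_prod_1pX (bigD1 k)//= [in RHS](bigD1 k)//= !mxE !eqxx mulr1.
have -> : \prod_(m < d | m != k) (1 + (z + t *: delta_mx 0 k) 0 m *: 'X) = without z k.
  by apply: eq_bigr => m /negbTE mk; rewrite !mxE mk andbF mulr0 addr0.
rewrite -/(without z k) !mulrDl !mul1r !coefD scalerDl mulrDl coefD addrA; congr (_ + _).
by rewrite -scalerAl coefZ coefXM.
Qed.

Lemma coord_differentiable (k : 'I_d) z : differentiable (fun z => z 0 k : C) z.
Proof. exact: differentiable_coord. Qed.

Lemma elsym_differentiable i z : differentiable (fun z => elsym z i : C) z.
Proof.
apply: differentiable_sumr => A; under eq_fun do rewrite big_mkcond.
apply: differentiable_prodr => k; case: (k \in A); first exact: coord_differentiable.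
exact: differentiable_const.
Qed.

Lemma symmap_differentiable z : differentiable (@symmap R n) z.
Proof.
have -> : @symmap R n = \sum_(i < d) (fun z => elsym z i.+1 *: (delta_mx 0 i : 'rV[C]_d)).
  apply/funext => w; rewrite fct_sumE; apply/rowP => i; rewrite summxE (bigD1 i)//= !mxE !eqxx /= mulr1.
  by rewrite [X in _ = _ + X]big1 ?addr0// => j ji; rewrite !mxE eqxx /= eq_sym (negbTE ji) mulr0.
apply: differentiable_sum => i.
exact: (@differentiableZl _ _ _ (fun z => elsym z i.+1) _ z (elsym_differentiable _ z)).
Qed.

Lemma jacobianE z : jacobian (@symmap R n) z = \matrix_(k, i) (without z k)`_i.
Proof.
apply/matrixP => k i; rewrite /jacobian !mxE -deriveE; last exact: symmap_differentiable.
suff -> : 'D_(delta_mx 0 k) (@symmap R n) z = \row_i (without z k)`_i by rewrite mxE.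
apply: cvg_lim; first exact: norm_hausdorff.
apply: cvg_near_cst; near=> t.
have t0 : t != 0 by near: t; exact: nbhs_dnbhs_neq.
have -> : (@symmap R n \o shift z) (t *: delta_mx 0 k) = symmap z + t *: \row_i (without z k)`_i.
  apply/rowP => j; rewrite /= addrC symmapE mxE elsym_line !mxE.
  by [].
by rewrite addrAC subrr add0r scalerA mulVf// scale1r.
Unshelve. all: by end_near. Qed.

Lemma jac_det z : jac z = \det (\matrix_(k < d, i < d) (without z k)`_i).
Proof. by rewrite /jac jacobianE. Qed.

(** The antisymmetric polynomial of least degree. *)
Definition vander z : C := \det (\matrix_(i < d, k < d) z 0 i ^+ k).

Lemma vander_prod z : vander z = \prod_(i < d) \prod_(j < d | (i < j)%N) (z 0 j - z 0 i).
Proof.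
rewrite -det_Vandermonde -det_tr /vander; congr (\det _).
by apply/matrixP => i j; rewrite !mxE.
Qed.

Lemma homog_without z k (l : 'I_d) :
  (homog n.+1 (without z k)).[z 0 l] = \prod_(m < d | m != k) (z 0 l - z 0 m).
Proof.
have hp (f : C -> {poly C}) : \prod_(x <- [seq z 0 m | m <- enum 'I_d & m != k]) f x =
    \prod_(m < d | m != k) f (z 0 m).
  by rewrite big_map big_filter big_enum_cond.
have sz : size [seq z 0 m | m <- enum 'I_d & m != k] = n.+1.
  rewrite -sum1_size big_map big_filter big_enum_cond sum1_card.
  transitivity #|predC1 k|; last by rewrite cardC1 card_ord.
  by apply: eq_card => m.
have := homog_prod [seq z 0 m | m <- enum 'I_d & m != k]; rewrite !hp sz -/(without z k) => ->.
by rewrite horner_prod; apply: eq_bigr => m _; rewrite hornerXsubC.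
Qed.

(** Each unordered pair occurs twice, with opposite signs. *)
Lemma distinct_prod : exists2 e : C, e ^+ 2 = 1 & forall z,
  \prod_(k < d) \prod_(m < d | m != k) (z 0 k - z 0 m) = e * vander z ^+ 2.
Proof.
pose N := (\sum_(k < d) #|[pred m : 'I_d | (k < m)%N]|)%N.
exists ((-1) ^+ N) => [|z]; first by rewrite -exprM mulnC exprM sqrrN !expr1n.
have split1 k : \prod_(m < d | m != k) (z 0 k - z 0 m) =
    \prod_(m < d | (m < k)%N) (z 0 k - z 0 m) * \prod_(m < d | (k < m)%N) (z 0 k - z 0 m).
  rewrite (bigID (fun m : 'I_d => (m < k)%N)) /=; congr (_ * _); apply: eq_bigl => m.
    by rewrite neq_ltn; case: ltngtP.
  by rewrite neq_ltn -leqNgt; case: ltngtP.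
under eq_bigr do rewrite split1.
rewrite big_split /= expr2 mulrCA; congr (_ * _).
  rewrite vander_prod [LHS](exchange_big_dep xpredT)//=.
rewrite vander_prod /N expr_sum -big_split; apply: eq_bigr => k _ /=.
by rewrite -prodrN; apply: eq_bigr => m _; rewrite opprB.
Qed.

Lemma without_eq z (k l : 'I_d) : z 0 k = z 0 l -> without z k = without z l.
Proof.
move=> e; have [->//|kl] := eqVneq k l.
rewrite /without (bigD1 l) ?(eq_sym l)//= [in RHS](bigD1 k)//= e; congr (_ * _).
by apply: eq_bigl => m; rewrite andbC.
Qed.

Lemma jac_eq0 z (k l : 'I_d) : k != l -> z 0 k = z 0 l -> jac z = 0.
Proof.
move=> kl e; rewrite jac_det; apply: (determinant_alternate kl) => i.
by rewrite !mxE (without_eq e).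
Qed.

Lemma vander_eq0 z : vander z = 0 -> exists k l : 'I_d, k != l /\ z 0 k = z 0 l.
Proof.
rewrite vander_prod => /eqP /prodf_eq0[k _] /prodf_eq0[l kl]; rewrite subr_eq0 => /eqP e.
by exists k, l; split => //; apply: contraTneq kl => ->; rewrite ltnn.
Qed.

(** Multiplying the Jacobian matrix by a signed and reversed Vandermonde
    matrix gives the diagonal matrix of the products of the differences, whose
    determinant is the squared Vandermonde determinant up to sign. If that
    vanishes, two coordinates agree and so do two rows of the Jacobian matrix. *)
Lemma vander_jac : exists2 kappa : C, kappa != 0 & forall z, vander z = kappa * jac z.
Proof.
pose D : 'M[C]_d := \matrix_(i, k) ((-1) ^+ i * (i == rev_ord k)%:R).
have [e e2 eP] := distinct_prod.
have key z : jac z * (\det D * vander z) = e * vander z ^+ 2.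
  rewrite -(eP z) jac_det.
  have -> : vander z = \det (\matrix_(k < d, i < d) z 0 i ^+ k).
    by rewrite /vander -det_tr; congr (\det _); apply/matrixP => i j; rewrite !mxE.
  rewrite -!det_mulmx.
  have -> : (\matrix_(k < d, i < d) (without z k)`_i) *m (D *m (\matrix_(k < d, i < d) z 0 i ^+ k)) =
      diag_mx (\row_k \prod_(m < d | m != k) (z 0 k - z 0 m)).
    apply/matrixP => k l; rewrite !mxE.
    transitivity ((homog n.+1 (without z k)).[z 0 l]).
      rewrite /homog horner_sum; apply: eq_bigr => i _; rewrite !mxE hornerZ hornerXn -mulrA.
      congr (_ * _); rewrite (bigD1 (rev_ord i))//= !mxE rev_ordK eqxx mulr1 big1 ?addr0.
        by congr (_ * _ ^+ _); rewrite subSS.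
      move=> j ji; rewrite !mxE (_ : (i == rev_ord j) = false) ?mulr0 ?mul0r//.
      by apply/eqP => ij; rewrite ij rev_ordK eqxx in ji.
    rewrite homog_without; case: (eqVneq k l) => [->|kl]; first by rewrite mulr1n.
    by rewrite (bigD1 l) ?(eq_sym l)//= subrr mul0r mulr0n.
  by rewrite det_diag; apply: eq_bigr => k _; rewrite mxE.
have e0 : e != 0 by apply/eqP => e0; move/eqP: e2; rewrite e0 expr0n /= eq_sym oner_eq0.
have D0 : \det D != 0.
  pose z : 'rV[C]_d := \row_k k%:R.
  have v0 : vander z != 0.
    apply/eqP => /vander_eq0[k [l [/eqP kl]]]; rewrite !mxE => /eqP; rewrite eqr_nat => /eqP.
    by move=> /val_inj.
  apply/eqP => D0; have := key z; rewrite D0 mul0r mulr0 => /esym/eqP.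
  by rewrite mulf_eq0 expf_eq0 (negbTE e0) (negbTE v0) andbF.
exists (e^-1 * \det D) => [|z]; first by rewrite mulf_neq0// invr_eq0.
have [v0|v0] := eqVneq (vander z) 0.
  by have [k [l [kl zkl]]] := vander_eq0 v0; rewrite (jac_eq0 kl zkl) mulr0.
have alg (v j dd : C) : v != 0 -> j * (dd * v) = e * v ^+ 2 -> v = e^-1 * dd * j.
  move=> v0' h; apply: (mulfI e0); apply: (mulIf v0').
  have -> : e * (e^-1 * dd * j) = dd * j by rewrite !mulrA mulfV// mul1r.
  by rewrite -[LHS]mulrA -expr2 -h mulrCA mulrA.
exact: alg (key z).
Qed.

Lemma vander_sum z : vander z = \sum_(s : 'S_d) (-1) ^+ s * mono (fun i => s i : nat) z.
Proof.
rewrite /vander /determinant /mono; apply: eq_bigr => s _; congr (_ * _).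
by apply: eq_bigr => i _; rewrite mxE.
Qed.

Lemma jac_neq0 z : vander z != 0 -> jac z != 0.
Proof. by have [kp _ ->] := vander_jac; apply: contraNneq => ->; rewrite mulr0. Qed.

Lemma vander_perm s z : vander (col_perm s z) = (-1) ^+ s * vander z.
Proof.
rewrite /vander -det_perm -det_mulmx; congr (\det _).
rewrite -row_permE; apply/matrixP => i j; by rewrite !mxE.
Qed.

Lemma jac_perm s z : jac (col_perm s z) = (-1) ^+ s * jac z.
Proof.
have [kp k0 e] := vander_jac; apply: (mulfI k0).
by rewrite -e vander_perm e mulrCA.
Qed.

Lemma symmap_perm s z : symmap (col_perm s z) = symmap z.
Proof.
apply/rowP => i; rewrite !symmapE !mxE -!coef_prod_1pX [in RHS](reindex_inj (@perm_inj _ s)).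
by rewrite (eq_bigr (fun k => 1 + z 0 (s k) *: 'X))// => k _; rewrite mxE.
Qed.

Lemma symmap_last z : symmap z 0 ord_max = \prod_i z 0 i.
Proof.
rewrite symmapE mxE /elsym (bigD1 [set: 'I_d]%SET) ?cardsT ?card_ord//= [X in _ + X]big1 ?addr0.
  by apply: eq_bigl => k; rewrite finset.in_setT.
move=> A /andP[/eqP cA /eqP[]]; apply/eqP; rewrite eqEcard finset.subsetT cardsT card_ord cA.
exact: leqnn.
Qed.

Lemma vander_differentiable z : differentiable vander z.
Proof.
have -> : vander = fun z => \sum_(s : 'S_d) (-1) ^+ s * mono (fun i => s i : nat) z.
  by apply/funext => w; exact: vander_sum.
apply: differentiable_sumr => s; apply: differentiable_scale.
exact: (mono_differentiable (fun i => s i : nat)).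
Qed.

Lemma jac_differentiable z : differentiable (@jac R n) z.
Proof.
have [kp k0 e] := vander_jac.
have -> : @jac R n = fun z => kp^-1 * vander z by apply/funext => w; rewrite e mulKf.
by apply: differentiable_scale; exact: vander_differentiable.
Qed.

Lemma differentiable_opp (F : 'rV[C]_d -> C) w :
  differentiable F w -> differentiable (fun w => - F w) w.
Proof. by move=> hF; under eq_fun do rewrite -mulN1r; exact: differentiable_scale. Qed.

Lemma redp_differentiable m k w : differentiable (fun w : 'rV[C]_d => (redp w m)`_k) w.
Proof.
elim: m k w => [|m IH] k w; first exact: (differentiable_const (1 : {poly C})`_k w).
under eq_fun do rewrite redp_coefS chi_coef.
apply: differentiable_add; first by case: k => [|k]; [exact: differentiable_const|exact: IH].
apply: differentiable_opp; apply: differentiable_mul; first exact: IH.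
apply: differentiable_add; first exact: differentiable_const.
apply: differentiable_opp; apply: differentiable_sumr => i; under eq_fun do rewrite -mulrA mulrC.
by apply: differentiable_scale; exact: coord_differentiable.
Qed.

Lemma quot_det_differentiable (a : 'I_d -> nat) w : differentiable (quot_det a) w.
Proof.
apply: differentiable_sumr => s; apply: differentiable_scale.
apply: differentiable_prodr => i; under eq_fun do rewrite mxE.
exact: redp_differentiable.
Qed.

End jacobian_determinant.

(** * Estimates on the symmetrized polydisc *)

Section symmetric_estimates.
Context {R : realType} {n : nat}.
Local Notation C := R[i].
Local Notation d := n.+2.
Implicit Types (z w h : 'rV[C]_d).

(** The weights [(rho - r)^-1 ^+ k] turn the two-term recursion into the
    identity [r + (rho - r) = rho]. *)
Lemma newton_le (y : nat -> C) (r rho : R) m k : 0 <= r -> r < rho -> (forall k, nc (y k) <= r) ->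
  nc (newton y m k) <= (rho - r)^-1 ^+ k * rho ^+ m.
Proof.
move=> r0 rr hy; have q0 : 0 < rho - r by rewrite subr_gt0.
have rho0 : 0 <= rho by rewrite ltW// (le_lt_trans r0).
have i0 : 0 <= (rho - r)^-1 by rewrite invr_ge0 ltW.
elim: m k => [|m IH] k.
  have n00 : newton y 0 0 = 1 by [].
  have n0S j : newton y 0 j.+1 = 0 by [].
  rewrite expr0 mulr1; case: k => [|k]; first by rewrite n00 nc1 expr0.
  by rewrite n0S nc0 exprn_ge0.
case: k => [|k] /=.
  have := IH 0%N; rewrite expr0 !mul1r addr0 ncM exprS => h.
  by apply: ler_pM => //; rewrite ?nc_ge0// (le_trans (hy 0%N))// ltW.
apply: le_trans (ncD _ _) _; rewrite ncM.
apply: (@le_trans _ _ (r * ((rho - r)^-1 ^+ k.+1 * rho ^+ m) + (rho - r)^-1 ^+ k * rho ^+ m)).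
  by rewrite lerD// ler_pM ?nc_ge0.
have -> : (rho - r)^-1 ^+ k = (rho - r)^-1 ^+ k.+1 * (rho - r).
  by rewrite exprSr mulfVK// gt_eqF.
rewrite le_eqVlt; apply/orP; left; apply/eqP; rewrite [rho ^+ m.+1]exprS; ring.
Qed.

Lemma newton_poly_le (y : nat -> C) k j : (forall k, nc (y k) <= 1) ->
  nc (newton_poly y k)`_j <= 2 ^+ k.
Proof.
move=> hy; elim: k j => [|k IH] j.
  rewrite /newton_poly big_ord0 coef1 expr0; by case: (j == 0%N); rewrite ?nc1 ?nc0.
rewrite /newton_poly big_ord_recr /= -/(newton_poly y k) mulrBr coefB coefMX coefMC.
apply: le_trans (ncB _ _) _; rewrite exprS mulr2n mulrDl mul1r; apply: lerD.
  by case: (j == 0%N) => //; rewrite nc0 exprn_ge0.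
by rewrite ncM -[leRHS]mulr1 ler_pM ?nc_ge0.
Qed.

Lemma quot_det_le (r rho : R) : 0 <= r -> r < rho -> rho <= 1 -> exists2 K : R, 0 <= K &
  forall z (a : 'I_d -> nat), in_polydisc r z -> nc (quot_det a (symmap z)) <= K * rho ^+ degree a.
Proof.
move=> r0 rr rho1; have q0 : 0 < rho - r by rewrite subr_gt0.
have rho0 : 0 <= rho by rewrite ltW// (le_lt_trans r0).
pose B := \sum_(j < d) (rho - r)^-1 ^+ j * 2 ^+ j.
have B0 : 0 <= B by apply: sumr_ge0 => j _; rewrite mulr_ge0// exprn_ge0// invr_ge0 ltW.
have redp_le z m k : in_polydisc r z -> nc (redp (symrow z) m)`_k <= B * rho ^+ m.
  move=> hz; rewrite redp_newton coef_sum; apply: le_trans (nc_sum _ _ _) _.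
  rewrite mulr_suml; apply: ler_sum => j _; rewrite coefZ ncM mulrAC.
  apply: ler_pM; rewrite ?nc_ge0//; first exact: newton_le.
  by apply: newton_poly_le => i; apply: le_trans (hz _) _; rewrite ltW// (lt_le_trans rr).
exists (\sum_(s : 'S_d) B ^+ d); first by apply: sumr_ge0 => s _; rewrite exprn_ge0.
move=> z a hz; rewrite symmapE /quot_det /determinant; apply: le_trans (nc_sum _ _ _) _.
rewrite mulr_suml; apply: ler_sum => s _; rewrite nc_sign nc_prod.
have -> : B ^+ d = \prod_(i < d) B by rewrite prodr_const card_ord.
rewrite -(degree_perm s) expr_degree.
rewrite -big_split /=; apply: ler_prod => i _; rewrite nc_ge0 mxE; exact: redp_le.
Qed.

Lemma size_chi w : size (chi w) = d.+1.
Proof.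
apply/eqP; rewrite eqn_leq; apply/andP; split.
  apply/leq_sizeP => j dj; rewrite chi_coef (_ : (j == d) = false) ?sub0r; last by apply/eqP; lia.
  rewrite big1 ?oppr0// => i _; rewrite (_ : (j == _) = false) ?mulr0//.
  by apply/eqP; have := ltn_ord i; lia.
rewrite ltnNge; apply/negP => /leq_sizeP/(_ d (leqnn _)) /eqP; apply/negP.
rewrite chi_coef eqxx big1 ?subr0 ?oner_eq0// => i _; rewrite (_ : (d == _) = false) ?mulr0//.
by apply/eqP; have := ltn_ord i; lia.
Qed.

Lemma symmap_onto w : exists z, symmap z = w.
Proof.
have [rs e] := closed_field_poly_normal (chi w).
have lc : lead_coef (chi w) = 1.
  rewrite lead_coefE size_chi /= chi_coef eqxx big1 ?subr0// => i _.
  by rewrite (_ : (d == _) = false) ?mulr0//; apply/eqP; have := ltn_ord i; lia.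
rewrite lc scale1r in e.
have sz : size rs = d by have := size_chi w; rewrite e size_prod_XsubC => -[].
exists (\row_i rs`_i); apply: (@chi_inj C d); rewrite symmapE chi_symrow e.
rewrite [RHS](big_nth 0) sz big_mkord; apply: eq_bigr => i _; by rewrite mxE.
Qed.

(** If a root [x] of the perturbed polynomial were larger than [r1], the
    product of its distances to the original roots would be at least [((r1 -
    r0) * M) ^+ d] with [M] the maximum of 1 and the modulus of [x], while
    that product is the value at [x] of the perturbation, less than [((r1 -
    r0) * M) ^+ d] for small [h]. *)
Lemma near_symmap z0 (r0 r1 : R) : 0 <= r0 -> r0 < r1 -> r1 <= 1 -> in_polydisc r0 z0 ->
  exists2 e : R, 0 < e & forall h, rnorm h < e ->
    exists2 z, symmap z = symmap z0 + h & in_polydisc r1 z.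
Proof.
move=> r00 r01 r11 hz0; pose q := r1 - r0; have q0 : 0 < q by rewrite subr_gt0.
exists (q ^+ d / d%:R); first by rewrite divr_gt0 ?exprn_gt0 ?ltr0n.
move=> h; rewrite ltr_pdivlMr ?ltr0n// => hh; have [z hz] := symmap_onto (symmap z0 + h).
exists z => // k; rewrite leNgt; apply/negP => tk.
set x := z 0 k in tk; set t := nc x in tk.
pose M := Num.max 1 t; have M1 : 1 <= M by rewrite le_max lexx.
have tM : t <= M by rewrite le_max lexx orbT.
have M0 : 0 < M by exact: lt_le_trans M1.
have root : (chi (symmap z)).[x] = 0.
  by rewrite symmapE chi_symrow horner_prod (bigD1 k)//= hornerXsubC subrr mul0r.
have e : \prod_m (x - z0 0 m) = \sum_(i < d) (h 0 i * (-1) ^+ i) * x ^+ (d - i.+1).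
  have -> : \prod_m (x - z0 0 m) = (chi (symmap z0)).[x].
    by rewrite symmapE chi_symrow horner_prod; apply: eq_bigr => m _; rewrite hornerXsubC.
  rewrite -[LHS]subr0 -[X in _ - X]root hz /chi !hornerE !horner_sum opprB addrC addrA subrK.
  rewrite -sumrB; apply: eq_bigr => i _; rewrite !hornerZ hornerXn -mulrBl -mulrBl mxE.
  by rewrite addrAC subrr add0r.
have lower : (q * M) ^+ d <= nc (\prod_m (x - z0 0 m)).
  have -> : (q * M) ^+ d = \prod_(i < d) (q * M) by rewrite prodr_const card_ord.
  rewrite nc_prod.
  apply: ler_prod => m _; rewrite mulr_ge0 ?(ltW q0) ?(ltW M0)//=.
  have := nc_tri x (z0 0 m) 0; rewrite !subr0 -/t => ht; have := hz0 m => hm.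
  apply: (@le_trans _ _ (t - r0)); last by lra.
  rewrite /M; have [t1|t1] := lerP t 1; first by rewrite /q; lra.
  have : t * (q + r0 - 1) <= 0 by apply: mulr_ge0_le0; [exact: nc_ge0|rewrite /q; lra].
  have : (t - 1) * r0 >= 0 by rewrite mulr_ge0// subr_ge0 ltW.
  by move: (q) => q'; nra.
have upper : nc (\prod_m (x - z0 0 m)) <= rnorm h * d%:R * M ^+ d.
  rewrite e; apply: le_trans (nc_sum _ _ _) _.
  rewrite mulrAC -[d%:R](_ : \sum_(i < d) 1 = _); last by rewrite sumr_const card_ord.
  rewrite mulr_sumr; apply: ler_sum => i _; rewrite mulr1 !ncM !ncX ncN nc1 expr1n mulr1.
  apply: ler_pM; rewrite ?nc_ge0 ?exprn_ge0 ?nc_ge0//; first exact: nc_coord_le.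
  apply: (@le_trans _ _ (M ^+ (d - i.+1))); first by rewrite lerXn2r ?nnegrE ?nc_ge0// ltW.
  by rewrite ler_weXn2l// leq_subr.
have := le_trans lower upper; rewrite exprMn ler_pM2r ?exprn_gt0// leNgt.
by rewrite hh.
Qed.

(** Along the direction [(0, 1, 2, ...)] the product of the differences is a
    nonzero polynomial, with finitely many zeros. *)
Lemma vander_dense z (e : R) : 0 < e -> exists2 h, rnorm h < e & vander (z + h) != 0.
Proof.
move=> e0; pose p : {poly C} := \prod_(i < d) \prod_(j < d | (i < j)%N)
   ((z 0 j - z 0 i)%:P + (j%:R - i%:R) *: 'X).
pose v (t : R) : 'rV[C]_d := t%:C%C *: \row_k k%:R.
have pE t : p.[t%:C%C] = vander (z + v t).
  rewrite vander_prod horner_prod; apply: eq_bigr => i _; rewrite horner_prod.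
  apply: eq_bigr => j _; rewrite !hornerE !mxE; ring.
have p0 : p != 0.
  apply/prodf_neq0 => i _; apply/prodf_neq0 => j ij; apply/eqP => /(congr1 (fun q : {poly C} => q`_1)).
  rewrite coefD coefC /= add0r coefZ coefX eqxx mulr1 coef0 => /eqP.
  by rewrite subr_eq0 eqr_nat => /eqP ji; rewrite ji ltnn in ij.
pose t k : R := e / d.+1%:R / k.+1%:R.
have t0 k : 0 < t k by rewrite !divr_gt0 ?ltr0n.
suff [k] : exists k, p.[(t k)%:C%C] != 0.
  rewrite pE => h; exists (v (t k)) => //; apply: rnorm_lt => // i.
  rewrite !mxE ncM nc_real gtr0_norm//.
  have -> : nc (i%:R : C) = i%:R.
    have -> : (i%:R : C) = (i%:R : R)%:C%C by rewrite rmorph_nat.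
    by rewrite nc_real ger0_norm ?ler0n.
  apply: (@le_lt_trans _ _ (e / d.+1%:R * d%:R)).
    rewrite ler_pM ?(ltW (t0 k)) ?ler0n ?ler_nat ?(ltnW (ltn_ord i))//.
    by rewrite ler_pdivrMr ?ltr0n// ler_peMr ?ler1n// divr_ge0 ?ler0n// ltW.
  by rewrite mulrAC ltr_pdivrMr ?ltr0n// ltr_pM2l// ltr_nat.
apply: contrapT => h.
have all_root : all (root p) [seq (t k)%:C%C | k <- iota 0 (size p)].
  apply/allP => x /mapP[k _ ->]; apply/rootP/eqP/negPn/negP => hk; apply: h; by exists k.
have : uniq [seq (t k)%:C%C | k <- iota 0 (size p)].
  rewrite map_inj_uniq ?iota_uniq// => k l /(congr1 (@complex.Re R)) /= tkl.
  have ne : e / d.+1%:R != 0 by rewrite gt_eqF// divr_gt0 ?ltr0n.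
  by move: tkl => /(mulfI ne)/invr_inj/eqP; rewrite eqr_nat eqSS => /eqP.
move=> /(max_poly_roots p0 all_root); by rewrite size_map size_iota ltnn.
Qed.

End symmetric_estimates.

(** * The Hardy space of the symmetrized polydisc *)

Section symmetrized_hardy_space.
Context {R : realType} {n : nat}.
Local Notation C := R[i].
Local Notation d := n.+2.
Local Notation V := (fspace R n).
Local Notation I := ('I_d -> nat).
Local Notation Gd := (@sym_polydisc R n).
Implicit Types (f g G : V) (z w h : 'rV[C]_d) (a : I).

(** [Uh] without its normalization. *)
Definition Wop f : V := patch (fun=> 0) (@polydisc R n) (fun z => jac z * f (symmap z)).

Lemma symmap_Gd z : (forall k, nc (z 0 k) < 1) -> Gd (symmap z).
Proof. by move=> /polydiscE hz; exists z. Qed.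

Lemma Wop_polydisc f z : (forall k, nc (z 0 k) < 1) -> Wop f z = jac z * f (symmap z).
Proof. exact: patch_polydisc. Qed.

Lemma comp_symmap f z : holomorphic_on Gd f -> (forall k, nc (z 0 k) < 1) ->
  differentiable (fun z => f (symmap z)) z.
Proof.
move=> hf hz; apply: (@differentiable_comp _ _ _ _ (@symmap R n) f).
  exact: symmap_differentiable.
by apply: hf; exact: symmap_Gd.
Qed.

Lemma hol_Wop f : holomorphic_on Gd f -> hol (Wop f).
Proof.
move=> hf; apply: hol_patch => z hz.
by apply: differentiable_mul; [exact: jac_differentiable|exact: comp_symmap].
Qed.

Lemma Wop_antisym f : Defs.antisymmetric (Wop f).
Proof.
move=> s z /polydiscE hz; have hzs k : nc (col_perm s z 0 k) < 1 by rewrite mxE.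
by rewrite !Wop_polydisc// jac_perm symmap_perm mulrA.
Qed.

Lemma sup_integral_Wop f : holomorphic_on Gd f ->
  sup_integral (sym_density f) = sqsum (taylor (Wop f)).
Proof.
move=> hf; rewrite -sup_integral_hol; last exact: hol_Wop.
have unit_itv (r : R) : [set` `]0%R, 1%R[ ] r -> 0 < r < 1 by rewrite /= in_itv.
have E r : 0 < r < 1 ->
    torus_integral_at (sym_density f) r = torus_integral_at (sq_modulus (Wop f)) r.
  move=> /andP[r0 r1]; congr torus_integral; apply/funext => t; congr (_%:E).
  have hz : forall k, nc (circle_point r t 0 k) < 1.
    exact: (polydisc_lt1 r1 (cpt_polydisc t (ltW r0))).
  rewrite /sym_density /sq_modulus Wop_polydisc// -exprMn mulrC; congr (_ ^+ 2).
  by symmetry; exact: ncM.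
have S : [set torus_integral_at (sym_density f) r | r in `]0%R, 1%R[ ] =
    [set torus_integral_at (sq_modulus (Wop f)) r | r in `]0%R, 1%R[ ].
  apply/seteqP; split=> x [r hr <-]; exists r; [exact: hr| |exact: hr|].
    by symmetry; exact: (E r (unit_itv r hr)).
  exact: (E r (unit_itv r hr)).
by rewrite /sup_integral S.
Qed.

Lemma hcar_sym f : hcar (H2sym n) f <->
  [/\ holomorphic_on Gd f, supported_in Gd f & (sqsum (taylor (Wop f)) < +oo)%E].
Proof.
by split=> -[hf sf nf]; split=> //; move: nf; rewrite sup_integral_Wop.
Qed.

Lemma hcar_Wop f : hcar (H2sym n) f -> hcar (H2anti n) (Wop f).
Proof.
move=> /hcar_sym[hf sf nf]; apply/hcar_anti; split=> //; first exact: hol_Wop.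
  exact: patch_supported.
exact: Wop_antisym.
Qed.

Lemma Wop_lin (x : C) f g : Wop (x *: f + g) = x *: Wop f + Wop g.
Proof.
apply/funext => z; have [/polydiscE hz|hz] := pselect (polydisc z).
  change (Wop (x *: f + g) z = x * Wop f z + Wop g z); rewrite !Wop_polydisc//.
  by rewrite mulrCA -mulrDr.
change (Wop (x *: f + g) z = x * Wop f z + Wop g z).
by rewrite /Wop !patchN ?notin_setE// mulr0 addr0.
Qed.

(** The Jacobian is a nonzero polynomial, so Parseval's formula on the unit
    torus gives a positive norm. *)
Lemma jac_norm_gt0 : 0 < @jac_norm R n.
Proof.
have [kp kp0 e] := @vander_jac R n.
pose c (a : I) : C := kp^-1 * \sum_(s : 'S_d) (-1) ^+ s * (a == (fun i => s i : nat))%:R.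
have delta (s : 'S_d) z : boxsum n.+1 (fun a => (a == (fun i => s i : nat))%:R * mono a z) =
    mono (fun i => s i : nat) z.
  pose b : {ffun 'I_d -> 'I_d} := [ffun i => s i].
  have bE : (fun i => b i : nat) = (fun i => s i : nat) by apply/funext => i; rewrite ffunE.
  rewrite /boxsum (bigD1 b)//= bE eqxx mul1r big1 ?addr0// => b' bb.
  rewrite (_ : _ == _ = false) ?mul0r//; apply/eqP => b'E; move/eqP: bb; apply.
  by apply/ffunP => i; apply/val_inj; rewrite /= ffunE; exact: (congr1 (fun f : I => f i) b'E).
have jacE z : jac z = boxsum n.+1 (fun a => c a * mono a z).
  apply: (mulfI kp0); rewrite -e vander_sum -boxsumZ.
  transitivity (boxsum n.+1 (fun a => \sum_(s : 'S_d) (-1) ^+ s * ((a == (fun i => s i : nat))%:R * mono a z))).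
    by rewrite /boxsum exchange_big /=; apply: eq_bigr => s _; rewrite -(delta s z) -boxsumZ.
  apply: eq_boxsum => a; rewrite /c mulrA mulVKf// mulr_suml.
  by apply: eq_bigr => s _; rewrite mulrA.
have [_ hP] := parseval_box n.+1 c (ler01 : 0 <= 1 :> R).
have tE : torus_integral_at (sq_modulus (@jac R n)) 1 =
    (boxsum n.+1 (fun a => (nc (c a) * 1 ^+ degree a) ^+ 2))%:E.
  rewrite -hP; congr torus_integral; apply/funext => t; congr (_%:E).
  by rewrite -[in RHS]jacE.
rewrite /jac_norm tE /= sqrtr_gt0 /boxsum.
pose b : {ffun 'I_d -> 'I_d} := [ffun i => i].
rewrite (bigD1 b)//= ltr_pwDl//; last by apply: sumr_ge0 => b' _; exact: sqr_ge0.
rewrite expr1n mulr1 exprn_gt0// nc_gt0 mulf_neq0 ?invr_eq0//.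
rewrite (bigD1 (1%g : 'S_d))//= odd_perm1 mul1r big1 ?addr0.
  have -> : (fun i => b i : nat) = (fun i => (1%g : 'S_d) i : nat).
    by apply/funext => i; rewrite ffunE perm1.
  by rewrite eqxx oner_eq0.
move=> s s1; rewrite (_ : _ == _ = false) ?mulr0//; apply/eqP => h; move/eqP: s1; apply.
apply/permP => i; apply/val_inj; rewrite perm1 /=.
by have := congr1 (fun f : I => f i) h; rewrite /= ffunE.
Qed.

Lemma UhE f : Uh f = ((@jac_norm R n)^-1)%:C%C *: Wop f.
Proof.
apply/funext => z; change (Uh f z = ((@jac_norm R n)^-1)%:C%C * Wop f z).
have [hz|hz] := pselect (polydisc z).
  by rewrite /Uh /Wop !patchT// inE.
by rewrite /Uh /Wop !patchN ?notin_setE// mulr0.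
Qed.

Lemma hcar_Uh f : hcar (H2sym n) f -> hcar (H2anti n) (Uh f).
Proof. by move=> hf; rewrite UhE; apply: (hcarZ anti_coords); exact: hcar_Wop. Qed.

Lemma Uh_norm f : hcar (H2sym n) f -> hnorm (H2anti n) (Uh f) = hnorm (H2sym n) f.
Proof.
move=> hf; have hW := hcar_Wop hf; have j0 := jac_norm_gt0.
have [hol_f _ _] := (hcar_sym f).1 hf.
transitivity ((@jac_norm R n)^-1 * hnorm (H2anti n) (Wop f)).
  by rewrite UhE (hnormZ anti_coords _ hW) nc_real ger0_norm// invr_ge0 ltW.
have e : sup_integral (sq_modulus (Wop f)) = sup_integral (sym_density f).
  by rewrite (sup_integral_hol (hol_Wop hol_f)) (sup_integral_Wop hol_f).
exact: (congr1 (fun x => (@jac_norm R n)^-1 * Num.sqrt (fine x)) e).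
Qed.

Lemma differentiable_continuity (F : 'rV[C]_d -> C) z (e : R) : differentiable F z -> 0 < e ->
  exists2 dl : R, 0 < dl & forall h, rnorm h < dl -> nc (F (z + h) - F z) <= e.
Proof.
move=> /has_diffP[l hl] e0; have [d1 d10 h1] := hl 1 ltr01.
pose M := 1 + \sum_k nc (l k).
have M0 : 0 < M by rewrite ltr_pwDl// sumr_ge0// => k _; exact: nc_ge0.
exists (Num.min d1 (e / M)) => [|h]; first by rewrite lt_min d10 divr_gt0.
rewrite lt_min => /andP[hd he]; rewrite -[F _ - F z](subrK (rowlin l h)).
apply: le_trans (ncD _ _) _.
apply: (@le_trans _ _ (rnorm h * M)); last by rewrite -ler_pdivlMr// ltW.
rewrite mulrDr mulr1; apply: lerD; first by have := h1 h hd; rewrite mul1r.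
apply: nc_rowlin => k; exact: nc_coord_le.
Qed.

(** Where the coordinates are distinct the Jacobian can be divided out;
    elsewhere the values follow by continuity, as such points are dense. *)
Lemma Wop_inj f g : holomorphic_on Gd f -> holomorphic_on Gd g ->
  supported_in Gd f -> supported_in Gd g -> Wop f = Wop g -> f = g.
Proof.
move=> hf hg sf sg e; apply/funext => w; have [|hw] := pselect (Gd w); last by rewrite sf// sg.
move=> [z /polydiscE hz <-]; apply: nc_forall_eps => r r0.
pose F z := f (symmap z) - g (symmap z).
have dF : differentiable F z.
  apply: differentiable_add; first exact: comp_symmap.
  by apply: differentiable_opp; exact: comp_symmap.
have [d1 d10 h1] := differentiable_continuity dF r0; have [d2 d20 h2] := polydisc_ball hz.
have [h] := @vander_dense R n z (Num.min d1 d2) ltac:(by rewrite lt_min d10 d20).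
rewrite lt_min => /andP[hd1 hd2] /jac_neq0 jz.
have := h1 h hd1; have F0 : F (z + h) = 0.
  apply: (mulfI jz); rewrite mulr0 mulrBr -!Wop_polydisc; [|exact: h2..].
  by rewrite e subrr.
by rewrite F0 sub0r ncN.
Qed.

(** The preimage is the series of the [quot_det a], weighted by the Taylor
    coefficients of [G]. Averaging over the permutations of the exponents
    turns its product with the Jacobian into the Taylor series of [G], and the
    geometric domination near each point makes it holomorphic. *)
Lemma Wop_surj G : hcar (H2anti n) G -> exists2 f, hcar (H2sym n) f & Wop f = G.
Proof.
move=> /hcar_anti[hG sG nG aG]; have aT := taylor_antisym hG aG.
have [M hM] := sqsum_bounded nG; have [kp kp0 ke] := @vander_jac R n.
have M0 : 0 <= M by apply: le_trans (hM (fun=> 0%N)); exact: nc_ge0.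
pose b a : C := kp * (d`!%:R^-1 * taylor G a).
pose B := nc kp * (nc (d`!%:R^-1 : C) * M).
have bB a : nc (b a) <= B by rewrite /b /B !ncM !ler_wpM2l ?nc_ge0.
have B0 : 0 <= B by rewrite !mulr_ge0 ?nc_ge0.
pose f0 w := boxlim (fun a => b a * quot_det a w).
have dom (r : R) : 0 <= r -> r < 1 -> exists q K : R, [/\ 0 <= q, q < 1 &
    forall z a, in_polydisc r z -> nc (b a * quot_det a (symmap z)) <= K * q ^+ degree a].
  move=> r0 r1; pose q := (r + 1) / 2.
  have rq : r < q by rewrite /q; lra.
  have q1 : q < 1 by rewrite /q; lra.
  have [K K0 hK] := @quot_det_le R n r q r0 rq (ltW q1).
  exists q, (B * K); split=> // [|z a hz]; first by rewrite (le_trans r0)// ltW.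
  by rewrite ncM -mulrA; apply: ler_pM; rewrite ?nc_ge0//; exact: hK.
pose f : V := patch (fun=> 0) Gd f0.
have fE w : Gd w -> f w = f0 w by move=> hw; rewrite /f patchT// inE.
have sum_eq z N : jac z * boxsum N (fun a => b a * quot_det a (symmap z)) =
    boxsum N (fun a => taylor G a * mono a z).
  rewrite -boxsumZ.
  transitivity (boxsum N (fun a => \sum_(s : 'S_d) d`!%:R^-1 * (taylor G (a \o s) * mono (a \o s) z))).
    apply: eq_boxsum => a.
    transitivity (d`!%:R^-1 * taylor G a * \det (\matrix_(i < d, j < d) z 0 i ^+ a j)).
      rewrite det_powers -/(vander z) ke -symmapE /b.
      move: (jac z) (quot_det _ _) (taylor _ _) (d`!%:R^-1) => j q t u; ring.
    rewrite /determinant mulr_sumr; apply: eq_bigr => s _.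
    have -> : \prod_i (\matrix_(i, j) z 0 i ^+ a j) i (s i) = mono (a \o s) z.
      by rewrite /mono; apply: eq_bigr => i _; rewrite mxE.
    rewrite aT -!mulrA; congr (_ * _); rewrite mulrCA; congr (_ * _).
  rewrite /boxsum exchange_big /=.
  under eq_bigr => s _.
    rewrite -/(boxsum N (fun a => d`!%:R^-1 * (taylor G (a \o s) * mono (a \o s) z))).
    rewrite boxsumZ (boxsum_perm s N (fun a => taylor G a * mono a z)).
    over.
  by rewrite sumr_const card_Sn -[LHS]mulr_natl mulrA mulfV ?mul1r// pnatr_eq0 -lt0n fact_gt0.
have jf z : (forall k, nc (z 0 k) < 1) -> jac z * f (symmap z) = G z.
  move=> hz; rewrite fE; last exact: symmap_Gd.
  have [r /andP[r0 r1] hr] := polydisc_room hz; have [q [K [q0 q1 hq]]] := dom r (ltW r0) r1.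
  have := climZ (jac z) (boxlimP q0 q1 (fun a => hq z a hr)).
  move=> /clim_unique; apply; apply: clim_eq (taylor_series hG hz) => N.
  by rewrite sum_eq.
have WfG : Wop f = G.
  apply/funext => z; have [/polydiscE hz|hz] := pselect (polydisc z).
    by rewrite Wop_polydisc// jf.
  by rewrite /Wop patchN ?notin_setE// sG.
have hf : holomorphic_on Gd f.
  move=> w [z /polydiscE hz <-]; have [r0 /andP[r00 r01] hr0] := polydisc_room hz.
  pose r1 := (r0 + 1) / 2.
  have r1r : r0 < r1 by rewrite /r1; lra.
  have r11 : r1 < 1 by rewrite /r1; lra.
  have [dl dl0 hdl] := near_symmap (ltW r00) r1r (ltW r11) hr0.
  have [q [K [q0 q1 hq]]] := dom r1 (le_trans (ltW r00) (ltW r1r)) r11.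
  apply: (@differentiable_near _ _ f f0 _ dl dl0).
    move=> h /hdl[z' <- hz']; apply: fE; apply: symmap_Gd; exact: polydisc_lt1 hz'.
  apply: (boxlim_differentiable dl0 q0 q1) => [a h _|a h /hdl[z' <- hz']]; last exact: hq.
  by apply: differentiable_scale; exact: quot_det_differentiable.
exists f => //; apply/hcar_sym; split=> //; last by rewrite WfG.
by move=> w hw; rewrite /f patchN// notin_setE.
Qed.

End symmetrized_hardy_space.

(** * The entries of the row and the theorem *)

Section row_entries.
Context {R : realType} {n : nat}.
Local Notation C := R[i].
Local Notation d := n.+2.
Local Notation V := (fspace R n).
Local Notation I := ('I_d -> nat).
Local Notation Gd := (@sym_polydisc R n).
Implicit Types (f g : V) (m : I).

Lemma jac_norm_inv_neq0 : ((@jac_norm R n)^-1)%:C%C != 0.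
Proof. by rewrite -nc_gt0 nc_real gtr0_norm invr_gt0 jac_norm_gt0. Qed.

Lemma Uh_lin (x : C) f g : Uh (x *: f + g) = x *: Uh f + Uh g.
Proof. by rewrite !UhE Wop_lin scalerDr !scalerA mulrC. Qed.

Lemma Uh_inj f g : hcar (H2sym n) f -> hcar (H2sym n) g -> Uh f = Uh g -> f = g.
Proof.
move=> /hcar_sym[hf sf _] /hcar_sym[hg sg _]; rewrite !UhE => e.
apply: Wop_inj => //; apply/funext => z.
exact: (mulfI jac_norm_inv_neq0 (congr1 (fun F : V => F z) e)).
Qed.

Lemma sym_lin (x : C) f g : hcar (H2sym n) f -> hcar (H2sym n) g -> hcar (H2sym n) (x *: f + g).
Proof.
move=> hf hg; have hW := coords_closed anti_coords x (hcar_Wop hf) (hcar_Wop hg).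
rewrite -Wop_lin in hW; have /hcar_anti[_ _ nW _] := hW.
have /hcar_sym[Hf sf _] := hf; have /hcar_sym[Hg sg _] := hg.
apply/hcar_sym; split; [move=> w hw|move=> w hw|exact: nW].
  change (differentiable (fun w => x * f w + g w) w).
  apply: differentiable_add; first by apply: differentiable_scale; exact: Hf.
  exact: Hg.
change (x * f w + g w = 0); rewrite (sf w hw) (sg w hw) mulr0; exact: addr0.
Qed.

Lemma Uh_surj g : hcar (H2anti n) g -> exists2 f, hcar (H2sym n) f & Uh f = g.
Proof.
move=> hg; have [|f hf e] := @Wop_surj _ _ ((@jac_norm R n)%:C%C *: g); first exact: (hcarZ anti_coords).
exists f => //; rewrite UhE e scalerA -rmorphM /= mulVf ?scale1r// gt_eqF//.
exact: jac_norm_gt0.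
Qed.

Definition csym f m : C := cA (Uh f) m.

Lemma sym_coords : l2_coords (H2sym n) csym.
Proof.
split.
- exact: sym_lin.
- move=> x f g m hf hg; rewrite /csym Uh_lin.
  exact: (coords_linear anti_coords x m (hcar_Uh hf) (hcar_Uh hg)).
- by move=> f hf; exact: (coords_lty anti_coords (hcar_Uh hf)).
- move=> f hf; rewrite -(Uh_norm hf); exact: (coords_norm anti_coords (hcar_Uh hf)).
- move=> x hx; have [g hg gE] := coords_surj anti_coords hx; have [f hf fE] := Uh_surj hg.
  by exists f; [exact: hf|move=> m; rewrite /csym fE; exact: gE].
- move=> f g hf hg e.
  exact: (Uh_inj hf hg (coords_inj anti_coords (hcar_Uh hf) (hcar_Uh hg) e)).
Qed.

(** As [Uh] is a surjective isometry, its adjoint is its inverse. *)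
Lemma Uh_adjoint g : hcar (H2anti n) g ->
  hcar (H2sym n) (adjoint (H2sym n) (H2anti n) (@Uh R n) g) /\
  Uh (adjoint (H2sym n) (H2anti n) (@Uh R n) g) = g.
Proof.
pose B (g : V) : V := xget 0 [set f | hcar (H2sym n) f /\ Uh f = g].
have BP g' : hcar (H2anti n) g' -> hcar (H2sym n) (B g') /\ Uh (B g') = g'.
  move=> /Uh_surj[f hf fE].
  by apply: (@xgetPex _ 0 [set f | hcar (H2sym n) f /\ Uh f = g']); exists f.
have Bb : bounded_op (H2anti n) (H2sym n) B.
  split=> [g' /BP[h _]|x g1 g2 h1 h2|]; first exact: h.
    have [b1 e1] := BP _ h1; have [b2 e2] := BP _ h2.
    have [b3 e3] := BP _ (coords_closed anti_coords x h1 h2).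
    by apply: (Uh_inj b3 (sym_lin x b1 b2)); rewrite e3 Uh_lin e1 e2.
  by exists 1 => g' hg'; have [b e] := BP _ hg'; rewrite mul1r -(Uh_norm b) e.
have Ba : is_adjoint (H2sym n) (H2anti n) (@Uh R n) B.
  move=> f g' hf hg'; have [b e] := BP _ hg'; rewrite -{1}e.
  exact: (hdot_isometry sym_coords (fun x f1 f2 _ _ => Uh_lin x f1 f2) (@Uh_norm R n) hf b).
move=> hg; rewrite (adjointE sym_coords Bb Ba hg); exact: BP.
Qed.

Definition entry_shift (k : 'I_d) f g := is_shift (H := H2sym n) (c := csym) k f g.

Lemma Zop_shift (k : 'I_d) f : hcar (H2sym n) f -> entry_shift k f (Zop k.+1 f).
Proof.
move=> hf; have [hY Y1 Y0] := Yop_shift k (hcar_Uh hf).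
have [hZ ZE] := Uh_adjoint hY.
split; first exact: hZ; first by move=> m; rewrite /csym /Zop /= ZE Y1.
by move=> m m0; rewrite /csym /Zop /= ZE Y0.
Qed.

Lemma Wop_Tp f (z : 'rV[C]_d) : (forall k, nc (z 0 k) < 1) -> Wop (Tp f) z = (\prod_i z 0 i) * Wop f z.
Proof. by move=> hz; rewrite (Wop_polydisc _ hz) (Wop_polydisc _ hz) /Tp symmap_last mulrCA. Qed.

Lemma Tp_holomorphic f : holomorphic_on Gd f -> holomorphic_on Gd (Tp f).
Proof.
move=> hf w hw; apply: differentiable_mul; last exact: hf.
exact: coord_differentiable.
Qed.

Lemma taylor_Tp f (a : I) : holomorphic_on Gd f -> taylor (Wop (Tp f)) a =
  if [forall i, (0 < a i)%N] then taylor (Wop f) (fun i => (a i).-1) else 0.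
Proof.
move=> hf; apply: (has_ps_unique _ (has_ps_taylor (hol_Wop (Tp_holomorphic hf)))
  (has_ps_mul_coords (has_ps_taylor (hol_Wop hf)))) => z hz.
exact: Wop_Tp.
Qed.

Lemma taylor_scale (x : C) (F : V) (a : I) : hol F -> taylor (x *: F) a = x * taylor F a.
Proof.
move=> hF; have h0 : hol (0 : V) by move=> z _; exact: differentiable_const.
have t0 : taylor (0 : V) a = 0.
  by have := taylor_lin (-1) a h0 h0; rewrite scaler0 addr0 mulN1r addNr.
by have := taylor_lin x a hF h0; rewrite addr0 t0 addr0.
Qed.

Lemma Tp_shift f : hcar (H2sym n) f -> entry_shift ord_max f (Tp f).
Proof.
move=> /hcar_sym[hf sf nf]; split.
- apply/hcar_sym; split; first exact: Tp_holomorphic.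
    by move=> w hw; rewrite /Tp sf// mulr0.
  rewrite (sqsum_image (e := fun a i => (a i).+1)).
  + rewrite (@sqsum_eq _ _ _ (taylor (Wop f)))// => a; rewrite taylor_Tp// ifT//.
    exact/forallP.
  + by move=> a b /funeqP e; apply/funext => i; have [] := e i.
  + move=> a ha; rewrite taylor_Tp// ifF//; apply/negP => /forallP a0.
    apply: (ha (fun i => (a i).-1)); apply/funext => i; by rewrite prednK.
- move=> m; rewrite /csym /cA !UhE; have hT := Tp_holomorphic hf.
  rewrite (taylor_scale _ _ (hol_Wop hT)) (taylor_scale _ _ (hol_Wop hf)); congr (_ * (_ * _)).
  have gapE i : of_gaps (raise 1 ord_max m) i = (of_gaps m i).+1.
    by rewrite -add_ones_of_gaps -ltnS ltn_ord addn1.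
  rewrite taylor_Tp// ifT; last by apply/forallP => i; rewrite gapE.
  by congr taylor; apply/funext => i; rewrite gapE.
- move=> m m0; rewrite /csym /cA UhE.
  rewrite (taylor_scale _ _ (hol_Wop (Tp_holomorphic hf))) taylor_Tp// ifF ?mulr0//; apply/negP => /forallP /(_ ord_max).
  rewrite /of_gaps m0 big1// => k; rewrite ltnNge -ltnS ltn_ord//.
Qed.

(** The index [ord_max] stands for [Tp], and the other indices for the [Zop]. *)
Lemma entry_is_shift (k : 'I_d) f : hcar (H2sym n) f -> entry_shift k f (entry k f).
Proof.
by move=> hf; rewrite /entry; case: eqP => [->|_]; [exact: Tp_shift|exact: Zop_shift].
Qed.

End row_entries.

Theorem theorem4p3 (R : realType) (n : nat) (T : fspace R n -> fspace R n)
    (hT : bounded_op (H2sym n) (H2sym n) T) :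
  compact_op (H2sym n) (H2sym n) T <->
  opnorm (hsum n.+2 (H2sym n)) (hsum n.+2 (H2sym n)) (eta j T)
    @[j --> \oo] --> 0%E.
Proof.
have E1 k f : hcar (H2sym n) f -> hcar (H2sym n) (@entry R n k f).
  by move=> /(entry_is_shift k)[].
have E2 k f a : hcar (H2sym n) f -> csym (@entry R n k f) (raise 1 k a) = csym f a.
  by move=> /(entry_is_shift k)[].
have E3 k f a : hcar (H2sym n) f -> a k = 0%N -> csym (@entry R n k f) a = 0.
  by move=> /(entry_is_shift k)[_ _]; exact.
split; first exact: (compact_eta sym_coords E1 E2 E3 hT).
exact: (eta_compact sym_coords E1 E2 E3 hT).
Qed.
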